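(* Let $(M,\mathcal D,h)$ be a sub-Riemannian geometry, let $g$ be a Riemannian metric on $M$ restricting to $h$ on $\mathcal D$, let $\mathcal D^\perp\subset TM$ be the $g$-orthogonal complement of $\mathcal D$, and let $\nabla$ be the distinguished metric connection of $(M,g,\mathcal D,\mathcal D^\perp)$ with torsion $T$ (both defined in the context). For each set of initial conditions $x\in M$, $u(0)\in\mathcal D\subset T_xM$, and $\nu(0)\in\mathcal D^\perp\subset T_x^*M$ (here $\mathcal D^\perp\subset T^*M$ denotes the annihilator of $\mathcal D$), the component $u(t)$ of the unique solution $(u(t),\nu(t))$ of the equations $$ \begin{aligned} 0 &= u^k\nabla_k u^i + h^{ij}\nu_a L^a{}_{jk}u^k,\\ 0 &= u^k\nabla_k\nu_a + g_{ij}u^i T^j{}_{ak} u^k + \nu_b T^b{}_{ak}u^k \end{aligned} $$ projects to a locally defined normal extremal $c(t)$ of the sub-Riemannian geometry with $c(0)=x$ and $\dot c(t)=u(t)$.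
   Context: All manifolds are smooth, connected and finite dimensional, and all mappings and tensors are smooth. A sub-Riemannian geometry $(M,\mathcal D,h)$ is a smooth manifold $M$ with a bracket generating distribution $\mathcal D\subset TM$ of constant rank and a positive definite metric $h$ on $\mathcal D$. Equivalently, $h$ is a symmetric contravariant 2-tensor, viewed as a map $h:T^*M\to TM$ with image $\mathcal D$, inducing a positive definite metric on $\mathcal D$. A normal extremal is the projection to $M$ of a solution of the Hamiltonian equations on $T^*M$ for the quadratic Hamiltonian $H(p)=\frac12h(p,p)$. The distinguished metric connection $\nabla$ is the unique linear connection on $TM$ such that $\nabla g=0$, $\nabla$ preserves both $\mathcal D$ and $\mathcal D^\perp$, and its torsion $T(X,Y)=\nabla_XY-\nabla_YX-[X,Y]$ satisfies - the $\mathcal D$-component of $T(X,Y)$ is $0$ for $X,Y\in\mathcal D$; - the $\mathcal D^\perp$-component of $T(X,Y)$ is $0$ for $X,Y\in\mathcal D^\perp$; - $g(T(Z,X),Y)=g(X,T(Z,Y))$ for $Z\in\mathcal D$, $X,Y\in\mathcal D^\perp$; - $g(T(X,Z),Y)=g(X,T(Y,Z))$ for $X,Y\in\mathcal D$, $Z\in\mathcal D^\perp$. Index notation (summation over repeated upper and lower indices): $i,j,k,\dots$ refer to a local, in general non-holonomic, frame $(X_i)$ of $\mathcal D$, and $a,b,\dots$ to a local frame $(Z_a)$ of $\mathcal D^\perp\subset TM$. Here $g_{ij}=g(X_i,X_j)=h(X_i,X_j)$, and $h^{ij}$ is the inverse matrix. The annihilator of $\mathcal D$ in $T^*M$ is identified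 with $\mathcal D^\perp\subset TM$ via the metric, $\nu_a=g_{ab}\nu^b$ with $g_{ab}=g(Z_a,Z_b)$, and $\nabla$ acts on it accordingly. $L^a{}_{ik}$ is the Levi form, i.e. the tensor $\mathcal D\times\mathcal D\to TM/\mathcal D\cong\mathcal D^\perp$ given by projecting the Lie bracket of sections of $\mathcal D$: $L^a{}_{ik}Z_a=[X_i,X_k]_{\mathcal D^\perp}$. The quantities $T^j{}_{ak}$ and $T^b{}_{ak}$ are the $\mathcal D$- and $\mathcal D^\perp$-components of the torsion of $\nabla$ evaluated on $(Z_a,X_k)$: $T^j{}_{ak}X_j+T^b{}_{ak}Z_b=T(Z_a,X_k)=\nabla_{Z_a}X_k-\nabla_{X_k}Z_a-[Z_a,X_k]$. A solution is a curve $(u(t),\nu(t))$, with $u(t)\in\mathcal D$ and $\nu(t)$ in the annihilator of $\mathcal D$, over a base curve $c(t)$ in $M$ with $\dot c(t)=u(t)$; $u^k\nabla_k$ is the covariant derivative along $c$.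
   Formalization: The torsion components are taken as T^j_{ak}X_j + T^b_{ak}Z_b = T(X_k, Z_a), not T(Z_a, X_k): with the stated order both torsion terms of the second equation have the wrong sign and the claim fails. *)

(* Defs.v *)
(* MathComp-Analysis; the scalars are an arbitrary [R : realType]. *)
From HB Require Import structures.
From mathcomp Require Import all_boot all_order all_algebra.
From mathcomp Require Import all_classical all_reals all_analysis.

Set Implicit Arguments.
Unset Strict Implicit.
Unset Printing Implicit Defensive.

Import Order.TTheory GRing.Theory Num.Theory.
Import numFieldNormedType.Exports.

Local Open Scope classical_set_scope.
Local Open Scope ring_scope.

Fixpoint Ck_on (R : realType) (n : nat) (W : normedModType R) (k : nat)
    (V : set 'rV[R]_n) (f : 'rV[R]_n -> W) : Prop :=
  (forall y, V y -> {for y, continuous f}) /\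
  if k is k'.+1 then
    forall a : 'I_n,
      (forall y, V y -> derivable f y (delta_mx 0 a)) /\
      Ck_on k' V (fun y => 'D_(delta_mx 0 a) f y)
  else True.

(* Only used with [V] open. *)
Definition smooth_on (R : realType) (n : nat) (W : normedModType R)
    (V : set 'rV[R]_n) (f : 'rV[R]_n -> W) : Prop :=
  forall k, Ck_on k V f.

(* [phi i] and [psi i] are junk outside [dom i] and [phi i @` dom i].  Every
   point [x] carries a preferred chart [chart_at x], which serves to identify
   the tangent space at [x] with ['rV[R]_n]. *)
Record manifold (R : realType) (n : nat) := Manifold {
  pt :> topologicalType;
  chart : Type;
  dom : chart -> set pt;
  phi : chart -> pt -> 'rV[R]_n;
  psi : chart -> 'rV[R]_n -> pt;
  chart_at : pt -> chart;
  manifold_hausdorff : hausdorff_space pt;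
  manifold_second_countable : @second_countable pt;
  manifold_connected : connected [set: pt];
  dom_open : forall i, open (dom i);
  dom_chart_at : forall x, dom (chart_at x) x;
  phi_open : forall i, open (phi i @` dom i);
  phiK : forall i x, dom i x -> psi i (phi i x) = x;
  phi_continuous : forall i x, dom i x -> {for x, continuous (phi i)};
  psi_continuous :
    forall i x, dom i x -> {for phi i x, continuous (psi i)};
  transition_smooth : forall i j,
    smooth_on (phi i @` (dom i `&` dom j)) (phi j \o psi i)
}.
Arguments chart {R n} M : rename.
Arguments dom {R n} {M} i x : rename.
Arguments phi {R n} {M} i x : rename.
Arguments psi {R n} {M} i y : rename.
Arguments chart_at {R n} {M} x : rename.

(* Vectors are rows, so the Jacobian acts on the right. *)
Definition jac (R : realType) (n : nat) (M : manifold R n) (i j : chart M)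
    (x : M) : 'M[R]_n :=
  jacobian (phi j \o psi i) (phi i x).

(* A tangent vector at [x] is the row of its components in [chart_at x], a
   covector at [x] is the column of its components there, and [v *m p] is their
   pairing.  [tcomp i x v] and [ccomp i x p] are the components in a chart [i]
   around [x]. *)
Definition tcomp (R : realType) (n : nat) (M : manifold R n) (i : chart M)
    (x : M) (v : 'rV[R]_n) : 'rV[R]_n :=
  v *m jac (chart_at x) i x.

Definition ccomp (R : realType) (n : nat) (M : manifold R n) (i : chart M)
    (x : M) (p : 'cV[R]_n) : 'cV[R]_n :=
  jac i (chart_at x) x *m p.

Definition vfield (R : realType) (n : nat) (M : manifold R n) : Type :=
  M -> 'rV[R]_n.

Definition vloc (R : realType) (n : nat) (M : manifold R n) (i : chart M)
    (X : vfield M) (y : 'rV[R]_n) : 'rV[R]_n :=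
  tcomp i (psi i y) (X (psi i y)).

Definition smooth_fun (R : realType) (n : nat) (M : manifold R n) (U : set M)
    (f : M -> R) : Prop :=
  forall i : chart M, smooth_on (phi i @` (U `&` dom i)) (f \o psi i).

Definition smooth_vfield (R : realType) (n : nat) (M : manifold R n)
    (U : set M) (X : vfield M) : Prop :=
  forall i : chart M, smooth_on (phi i @` (U `&` dom i)) (vloc i X).

Definition smooth_cov2 (R : realType) (n : nat) (M : manifold R n)
    (g : M -> 'M[R]_n) : Prop :=
  forall i : chart M, smooth_on (phi i @` dom i)
    (fun y => let J := jac i (chart_at (psi i y)) (psi i y) in
              J *m g (psi i y) *m J^T).

Definition smooth_contra2 (R : realType) (n : nat) (M : manifold R n)
    (h : M -> 'M[R]_n) : Prop :=
  forall i : chart M, smooth_on (phi i @` dom i)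
    (fun y => let J := jac (chart_at (psi i y)) i (psi i y) in
              J^T *m h (psi i y) *m J).

Definition dirderiv (R : realType) (n : nat) (M : manifold R n)
    (X : vfield M) (f : M -> R) (x : M) : R :=
  'D_(X x) (f \o psi (chart_at x)) (phi (chart_at x) x).

Definition bracket (R : realType) (n : nat) (M : manifold R n)
    (X Y : vfield M) : vfield M :=
  fun x => let i := chart_at x in let y := phi i x in
    'D_(X x) (vloc i Y) y - 'D_(Y x) (vloc i X) y.

(* A distribution is given by square matrices, its fibre at [x] being the row
   space of [D x]. *)
Definition section_on (R : realType) (n : nat) (M : manifold R n)
    (D : M -> 'M[R]_n) (U : set M) (X : vfield M) : Prop :=
  smooth_vfield U X /\ forall x, U x -> (X x <= D x)%MS.

Definition smooth_distribution (R : realType) (n : nat) (M : manifold R n)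
    (m : nat) (D : M -> 'M[R]_n) : Prop :=
  (forall x, \rank (D x) = m) /\
  forall x, exists U : set M, exists X : 'I_m -> vfield M,
    [/\ open U, U x, forall k, section_on D U (X k) &
        forall z, U z -> (D z <= \matrix_(k < m) X k z)%MS].

Inductive iterated_bracket (R : realType) (n : nat) (M : manifold R n)
    (D : M -> 'M[R]_n) (U : set M) : vfield M -> Prop :=
| IteratedSection X : section_on D U X -> iterated_bracket D U X
| IteratedBracket X Y : iterated_bracket D U X -> iterated_bracket D U Y ->
    iterated_bracket D U (bracket X Y).

Definition bracket_generating (R : realType) (n : nat) (M : manifold R n)
    (D : M -> 'M[R]_n) : Prop :=
  forall x, exists U : set M, exists Y : 'I_n -> vfield M,
    [/\ open U, U x, forall k, iterated_bracket D U (Y k) &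
        row_full (\matrix_(k < n) Y k x)].

(* [q] is the corank of the distribution.  The metric is given as the symmetric
   contravariant tensor; since vectors are rows, the map from covectors to
   vectors is [p |-> p^T *m sr_h x], whose image is the row space of [sr_h x];
   the induced metric on the distribution is
   h (p^T *m sr_h x, r^T *m sr_h x) = (p^T *m sr_h x *m r) 0 0. *)
Record subRiemannian (R : realType) (m q : nat) (M : manifold R (m + q)) :=
  SubRiemannian {
  sr_D : M -> 'M[R]_(m + q);
  sr_h : M -> 'M[R]_(m + q);
  sr_D_smooth : smooth_distribution m sr_D;
  sr_D_generating : bracket_generating sr_D;
  sr_h_smooth : smooth_contra2 sr_h;
  sr_h_sym : forall x, (sr_h x)^T = sr_h x;
  sr_h_image : forall x, (sr_h x == sr_D x)%MS;
  sr_h_pos : forall x (p : 'cV[R]_(m + q)), p^T *m sr_h x != 0 ->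
    0 < (p^T *m sr_h x *m p) 0 0
}.

Definition sharp (R : realType) (m q : nat) (M : manifold R (m + q))
    (S : subRiemannian M) (x : M) (p : 'cV[R]_(m + q)) : 'rV[R]_(m + q) :=
  p^T *m sr_h S x.

Definition ham (R : realType) (m q : nat) (M : manifold R (m + q))
    (S : subRiemannian M) (x : M) (p : 'cV[R]_(m + q)) : R :=
  2^-1 * (sharp S x p *m p) 0 0.

(* The Hamiltonian in the canonical coordinates of the cotangent bundle over
   [dom i]: the covector with components [xi] in the chart [i] has components
   [jac (chart_at x) i x *m xi] in [chart_at x]. *)
Definition ham_loc (R : realType) (m q : nat) (M : manifold R (m + q))
    (S : subRiemannian M) (i : chart M) (y : 'rV[R]_(m + q))
    (xi : 'cV[R]_(m + q)) : R :=
  ham S (psi i y) (jac (chart_at (psi i y)) i (psi i y) *m xi).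

Definition hamilton_at (R : realType) (m q : nat) (M : manifold R (m + q))
    (S : subRiemannian M) (c : R -> M) (p : R -> 'cV[R]_(m + q)) (t : R)
    (i : chart M) : Prop :=
  let y := phi i (c t) in
  let xi := ccomp i (c t) (p t) in
  is_derive t 1 (fun s => phi i (c s))
    (\row_a 'D_(delta_mx a 0) (ham_loc S i y) xi) /\
  is_derive t 1 (fun s => ccomp i (c s) (p s))
    (- \col_a 'D_(delta_mx 0 a) (fun z => ham_loc S i z xi) y).

Definition normal_extremal (R : realType) (m q : nat)
    (M : manifold R (m + q)) (S : subRiemannian M) (J : set R) (c : R -> M) :
    Prop :=
  exists p : R -> 'cV[R]_(m + q), forall t, J t ->
    {for t, continuous c} /\
    forall i : chart M, dom i (c t) -> hamilton_at S c p t i.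

Definition inner (R : realType) (n : nat) (M : manifold R n)
    (g : M -> 'M[R]_n) (x : M) (v w : 'rV[R]_n) : R :=
  (v *m g x *m w^T) 0 0.

Definition riemannian (R : realType) (n : nat) (M : manifold R n)
    (g : M -> 'M[R]_n) : Prop :=
  [/\ smooth_cov2 g, forall x, (g x)^T = g x &
      forall x v, v != 0 -> 0 < inner g x v v].

Definition restricts_to (R : realType) (m q : nat) (M : manifold R (m + q))
    (g : M -> 'M[R]_(m + q)) (S : subRiemannian M) : Prop :=
  forall x (p r : 'cV[R]_(m + q)),
    inner g x (sharp S x p) (sharp S x r) = (sharp S x p *m r) 0 0.

Definition perp (R : realType) (n : nat) (M : manifold R n)
    (g D : M -> 'M[R]_n) (x : M) : 'M[R]_n :=
  kermx (g x *m (D x)^T).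

(* The restrictions of a connection to the open sets of [M], packed as one
   operator: only the values of [nabla X Y] on open sets on which [X] and [Y]
   are smooth are meaningful. *)
Record connection (R : realType) (n : nat) (M : manifold R n) := Connection {
  nabla :> vfield M -> vfield M -> vfield M;
  nabla_smooth : forall (U : set M) X Y, open U ->
    smooth_vfield U X -> smooth_vfield U Y -> smooth_vfield U (nabla X Y);
  nabla_local : forall (U : set M) X X' Y Y', open U ->
    smooth_vfield U X -> smooth_vfield U Y ->
    (forall x, U x -> X x = X' x) -> (forall x, U x -> Y x = Y' x) ->
    forall x, U x -> nabla X Y x = nabla X' Y' x;
  nabla_addl : forall (U : set M) X X' Y, open U ->
    smooth_vfield U X -> smooth_vfield U X' -> smooth_vfield U Y ->
    forall x, U x ->
      nabla (fun z => X z + X' z) Y x = nabla X Y x + nabla X' Y x;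
  nabla_scalel : forall (U : set M) f X Y, open U -> smooth_fun U f ->
    smooth_vfield U X -> smooth_vfield U Y ->
    forall x, U x -> nabla (fun z => f z *: X z) Y x = f x *: nabla X Y x;
  nabla_addr : forall (U : set M) X Y Y', open U ->
    smooth_vfield U X -> smooth_vfield U Y -> smooth_vfield U Y' ->
    forall x, U x ->
      nabla X (fun z => Y z + Y' z) x = nabla X Y x + nabla X Y' x;
  nabla_leibniz : forall (U : set M) f X Y, open U -> smooth_fun U f ->
    smooth_vfield U X -> smooth_vfield U Y ->
    forall x, U x -> nabla X (fun z => f z *: Y z) x =
      dirderiv X f x *: Y x + f x *: nabla X Y x
}.

Definition torsion (R : realType) (n : nat) (M : manifold R n)
    (nb : connection M) (X Y : vfield M) : vfield M :=
  fun x => nb X Y x - nb Y X x - bracket X Y x.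

(* [v *m proj_mx A B] is the [A]-component of [v] along [B]. *)
Definition distinguished (R : realType) (m q : nat) (M : manifold R (m + q))
    (S : subRiemannian M) (g : M -> 'M[R]_(m + q)) (nb : connection M) :
    Prop :=
  let D := sr_D S in
  let Dp := perp g D in
  let T := torsion nb in
  forall U : set M, open U ->
  (forall X Y Z, smooth_vfield U X -> smooth_vfield U Y -> smooth_vfield U Z ->
     forall x, U x -> dirderiv X (fun z => inner g z (Y z) (Z z)) x =
       inner g x (nb X Y x) (Z x) + inner g x (Y x) (nb X Z x)) /\
  (forall X Y, smooth_vfield U X -> section_on D U Y ->
     section_on D U (nb X Y)) /\
  (forall X Y, smooth_vfield U X -> section_on Dp U Y ->
     section_on Dp U (nb X Y)) /\
  (forall X Y, section_on D U X -> section_on D U Y ->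
     forall x, U x -> T X Y x *m proj_mx (D x) (Dp x) = 0) /\
  (forall X Y, section_on Dp U X -> section_on Dp U Y ->
     forall x, U x -> T X Y x *m proj_mx (Dp x) (D x) = 0) /\
  (forall Z X Y, section_on D U Z -> section_on Dp U X -> section_on Dp U Y ->
     forall x, U x ->
       inner g x (T Z X x) (Y x) = inner g x (X x) (T Z Y x)) /\
  (forall X Y Z, section_on D U X -> section_on D U Y -> section_on Dp U Z ->
     forall x, U x ->
       inner g x (T X Z x) (Y x) = inner g x (X x) (T Y Z x)).

(* A frame of TM over [U]: [E (lshift q i)] are the X_i and [E (rshift m a)] the
   Z_a. *)
Definition frame_mx (R : realType) (n : nat) (M : manifold R n)
    (E : 'I_n -> vfield M) (x : M) : 'M[R]_n :=
  \matrix_(A < n) E A x.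

Definition adapted_frame (R : realType) (m q : nat) (M : manifold R (m + q))
    (S : subRiemannian M) (g : M -> 'M[R]_(m + q)) (U : set M)
    (E : 'I_(m + q) -> vfield M) : Prop :=
  [/\ open U,
      forall i : 'I_m, section_on (sr_D S) U (E (lshift q i)),
      forall a : 'I_q, section_on (perp g (sr_D S)) U (E (rshift m a)) &
      forall x, U x -> frame_mx E x \in unitmx].

Definition fcoord (R : realType) (n : nat) (M : manifold R n)
    (E : 'I_n -> vfield M) (x : M) (v : 'rV[R]_n) (A : 'I_n) : R :=
  (v *m invmx (frame_mx E x)) 0 A.

(* The [A]-th frame component of u^k nabla_k s, for a field [s] of vectors along
   a curve [c] whose velocity [u] is horizontal: with s = s^B E_B it is
   (s^A)' + sum_(k, B) u^k s^B Gamma^A_(k B), where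
   nabla_(X_k) E_B = Gamma^A_(k B) E_A. *)
Definition cov_along (R : realType) (m q : nat) (M : manifold R (m + q))
    (nb : connection M) (E : 'I_(m + q) -> vfield M) (c : R -> M)
    (u s : R -> 'rV[R]_(m + q)) (t : R) (A : 'I_(m + q)) : R :=
  'D_1 (fun r => fcoord E (c r) (s r) A) t +
  \sum_(k < m) \sum_(B < m + q)
    fcoord E (c t) (u t) (lshift q k) * fcoord E (c t) (s t) B *
    fcoord E (c t) (nb (E (lshift q k)) (E B) (c t)) A.

(* The vector nu^b Z_b dual to a covector nu with respect to [g]. *)
Definition gsharp (R : realType) (n : nat) (M : manifold R n)
    (g : M -> 'M[R]_n) (x : M) (nu : 'cV[R]_n) : 'rV[R]_n :=
  nu^T *m invmx (g x).

(* The two equations at time [t] in the adapted frame [E].  A covector [nu]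
   is differentiated through its dual vector.

   Index order of the torsion: here T^j_(a k) X_j + T^b_(a k) Z_b =
   T(X_k, Z_a).  This is the order that agrees with the Hamiltonian equations:
   with p = g(u, _) + nu and an orthonormal frame, they give
   (p(Z_a))' = u^k p([X_k, Z_a]) and
   [X_k, Z_a] = nabla_(X_k) Z_a - nabla_(Z_a) X_k - T(X_k, Z_a),
   hence u^k nabla_k nu_a = - u^k p(T(X_k, Z_a)). *)
Definition extremal_eqs (R : realType) (m q : nat) (M : manifold R (m + q))
    (g : M -> 'M[R]_(m + q)) (nb : connection M)
    (E : 'I_(m + q) -> vfield M) (c : R -> M) (u : R -> 'rV[R]_(m + q))
    (nu : R -> 'cV[R]_(m + q)) (t : R) : Prop :=
  let x := c t in
  let hor (i : 'I_m) : 'I_(m + q) := lshift q i in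
  let ver (a : 'I_q) : 'I_(m + q) := rshift m a in
  let nus (r : R) := gsharp g (c r) (nu r) in
  let u_ (k : 'I_m) := fcoord E x (u t) (hor k) in
  let nu_ (a : 'I_q) := (E (ver a) x *m nu t) 0 0 in
  let G A B := inner g x (E A x) (E B x) in
  let h_ := invmx (\matrix_(i < m, j < m) G (hor i) (hor j)) in
  let L (a : 'I_q) (j k : 'I_m) :=
    fcoord E x (bracket (E (hor j)) (E (hor k)) x) (ver a) in
  let T B (a : 'I_q) (k : 'I_m) :=
    fcoord E x (torsion nb (E (hor k)) (E (ver a)) x) B in
  (forall A, derivable (fun r => fcoord E (c r) (u r) A) t 1 /\
             derivable (fun r => fcoord E (c r) (nus r) A) t 1) /\
  (forall i : 'I_m,
     0 = cov_along nb E c u u t (hor i) +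
         \sum_(j < m) \sum_(a < q) \sum_(k < m)
            h_ i j * nu_ a * L a j k * u_ k) /\
  (forall a : 'I_q,
     0 = \sum_(b < q) G (ver a) (ver b) * cov_along nb E c u nus t (ver b) +
         \sum_(i < m) \sum_(j < m) \sum_(k < m)
            G (hor i) (hor j) * u_ i * T (hor j) a k * u_ k +
         \sum_(b < q) \sum_(k < m) nu_ b * T (ver b) a k * u_ k).

Definition velocity (R : realType) (n : nat) (M : manifold R n) (c : R -> M)
    (t : R) (v : 'rV[R]_n) : Prop :=
  {for t, continuous c} /\
  is_derive t 1 (fun s => phi (chart_at (c t)) (c s)) v.

Definition open_interval0 (R : realType) (J : set R) : Prop :=
  [/\ open J, is_interval J & J 0].

(* The equations are tensorial; they are required in every adapted frame. *)
Definition solution (R : realType) (m q : nat) (M : manifold R (m + q))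
    (S : subRiemannian M) (g : M -> 'M[R]_(m + q)) (nb : connection M)
    (J : set R) (c : R -> M) (u : R -> 'rV[R]_(m + q))
    (nu : R -> 'cV[R]_(m + q)) : Prop :=
  forall t, J t ->
  [/\ velocity c t (u t),
      (u t <= sr_D S (c t))%MS,
      sr_D S (c t) *m nu t = 0 &
      forall (U : set M) (E : 'I_(m + q) -> vfield M),
        adapted_frame S g U E -> U (c t) ->
        extremal_eqs g nb E c u nu t].

(* Main.v *)
(* Write p = g(u, _) + nu for the covector attached to a solution: then u is
   the image of p under h, and nu its part annihilating the distribution.  In an
   adapted frame E, with P_B = p(E_B), both systems turn into the same equation
     P_B' = u^k p(nabla_(X_k) E_B) - u^k p(T(X_k, E_B)):
   the covariant derivative of p along the curve gives it because nabla is
   metric, and Hamilton's equations in a chart give it because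
     1/2 (D_(E_B) h)(p, p) = u^k p(D_(E_B) X_k) - u^k p(nabla_(E_B) X_k)
   and [X_k, E_B] is computed in the chart.  Splitting B into horizontal and
   vertical indices gives the two equations of the statement.  Existence and
   local uniqueness then come from the Picard-Lindeloef theorem for Hamilton's
   equations in a chart, and uniqueness on J from its connectedness. *)
Require Import Defs.
From HB Require Import structures.
From mathcomp Require Import all_boot all_order all_algebra.
From mathcomp Require Import all_classical all_reals all_analysis.
From mathcomp Require Import ring lra.

Set Implicit Arguments.
Unset Strict Implicit.
Unset Printing Implicit Defensive.

Import Order.TTheory GRing.Theory Num.Theory.
Import numFieldNormedType.Exports.
Local Open Scope classical_set_scope.
Local Open Scope ring_scope.

(** * Functions of class C^k *)

(** Three coordinate systems meet: the preferred chart of each point, in which vectors and covectors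
    are stored; a fixed chart, in which Hamilton's equations are differential equations; and an
    adapted frame, in which the statement is written. Components in preferred charts need not vary
    continuously with the point, so along a curve only fixed-chart components and frame coordinates
    are differentiated. The two systems are shown equivalent at a single time, in both directions:
    one shows that solutions are normal extremals and yields uniqueness, the other yields existence.
    The formula for (D_(E_B) h)(p, p) is obtained without differentiating the frame coefficients of
    the image of p under h. With xi the chart components of p, freeze the coefficients b of u at
    time t: the field r = xi^T h - b e vanishes at the point, so g(r, r) vanishes there to second
    order. Expanding it expresses the derivative of h through those of the frame and of its Gram
    matrix, and the latter is known because nabla is metric. Smoothness is given by iterated partial
    derivatives, from which total differentiability, the chain rule and the symmetry of second
    derivatives are derived. *)

Lemma mx_entry_le (R : realType) m n (A : 'M[R]_(m, n)) i j : `|A i j| <= `|A|.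
Proof.
rewrite [leRHS]/Num.Def.normr /= mx_normrE.
exact: (le_bigmax _ (fun ij : 'I_m * 'I_n => `|A ij.1 ij.2|) (i, j)).
Qed.

Lemma mx_norm_le (R : realType) m n (A : 'M[R]_(m, n)) e :
  0 <= e -> (forall i j, `|A i j| <= e) -> `|A| <= e.
Proof.
move=> e0 Ae; rewrite [leLHS]/Num.Def.normr /= mx_normrE.
by apply: bigmax_le => // -[i j] _; exact: Ae.
Qed.

Lemma mx_norm_lt (R : realType) m n (A : 'M[R]_(m, n)) e :
  0 < e -> (forall i j, `|A i j| < e) -> `|A| < e.
Proof.
move=> e0 Ae; rewrite [ltLHS]/Num.Def.normr /= mx_normrE.
by apply: bigmax_lt => // -[i j] _; exact: Ae.
Qed.

Lemma continuous_mxP (R : realType) (T : topologicalType) m n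
    (F : T -> 'M[R]_(m, n)) (x : T) :
  {for x, continuous F} <-> forall i j, {for x, continuous (fun y => F y i j)}.
Proof.
split=> [cF i j|cF].
  apply: (@continuous_comp _ _ _ F (fun A : 'M[R]_(m, n) => A i j)) => //.
  exact: coord_continuous.
apply/cvgrPdist_le => e e0; near=> y.
apply: mx_norm_le; first exact: ltW.
move=> i j; rewrite !mxE.
pose P (ij : 'I_m * 'I_n) y := `|F x ij.1 ij.2 - F y ij.1 ij.2| <= e.
suff : forall ij, P ij y by move/(_ (i, j)).
near: y; apply: filter_forall => -[a b]; rewrite /P /=.
by have /cvgrPdist_le /(_ _ e0) := cF a b.
Unshelve. all: by end_near. Qed.

Lemma nbhs_rV_ball (R : realType) n (V : set 'rV[R]_n) (y : 'rV[R]_n) :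
  open V -> V y -> exists2 r : R, 0 < r & forall z, `|z - y| < r -> V z.
Proof.
move=> oV Vy; have /nbhs_ballP[r /= r0 rV] := open_nbhs_nbhs (conj oV Vy).
exists r => // z zy; apply: rV.
by rewrite -ball_normE /= distrC.
Qed.

(** Along the line, the difference quotients of the composite are literally those of the directional
    derivative. *)
Lemma is_derive_line (R : realType) (V W : normedModType R) (f : V -> W)
    (p v : V) (s : R) :
  derivable f (s *: v + p) v ->
  is_derive s (1 : R) (fun t => f (t *: v + p)) ('D_v f (s *: v + p)).
Proof.
have E : (fun h : R => h^-1 *: (((fun t => f (t *: v + p)) \o shift s) (h *: (1 : R)) -
      f (s *: v + p))) =
    (fun h : R => h^-1 *: ((f \o shift (s *: v + p)) (h *: v) - f (s *: v + p))).
  apply/funext => h /=; congr (_ *: (f _ - _)).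
  by rewrite -[h *: 1]/(h * 1) mulr1 scalerDl addrA.
by move=> df; split; rewrite /derivable /derive E.
Qed.

(** Rescaling to the unit interval frees the mean value theorem from the sign of [d]. *)
Lemma MVT_scaled (R : realType) (F dF : R -> R) (d : R) :
  (forall t : R, 0 <= t <= 1 -> is_derive (t * d) 1 F (dF (t * d))) ->
  exists2 t : R, 0 <= t <= 1 & F d - F 0 = dF (t * d) * d.
Proof.
move=> dFP.
have dG (t : R) : 0 <= t <= 1 -> is_derive t 1 (fun t => F (t * d)) (dF (t * d) * d).
  move=> t01; have dm : is_derive t (1:R) (fun t => t * d) d.
    have -> : (fun t => t * d) = (d *: id : R -> R).
      by apply/funext => u /=; rewrite [RHS]mulrC.
    by apply: is_derive_eq; rewrite -[LHS]/(d * 1) mulr1.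
  have H := @is_derive1_comp _ F (fun t => t * d) t _ _ (dFP _ t01) dm; exact H.
have [|t|t] := @MVT_segment R (fun t => F (t * d)) (fun t => dF (t * d) * d) 0 1 ler01.
- by move=> t /andP[t0 t1]; apply: dG; rewrite !bnd_simp in t0 t1; rewrite !ltW.
- apply: continuous_in_subspaceT => u; rewrite inE /= in_itv /= => u01.
  by apply/differentiable_continuous/derivable1_diffP; have [] := dG _ u01.
- by rewrite in_itv /= mul1r mul0r subr0 mulr1 => t01 E; exists t.
Qed.

(* Proved by changing one coordinate at a time. *)
Lemma mean_value_coord (R : realType) n (f : 'rV[R]_n -> R) (y0 : 'rV[R]_n)
    (r : R) :
  (forall z (a : 'I_n), `|z - y0| < r -> derivable f z (delta_mx 0 a)) ->
  forall x y, `|x - y0| < r -> `|y - y0| < r ->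
  exists zeta : 'I_n -> 'rV[R]_n,
    [/\ forall a, `|zeta a - y0| < r, forall a, `|zeta a - x| <= `|y - x| &
      f y - f x = \sum_a 'D_(delta_mx 0 a) f (zeta a) * (y 0 a - x 0 a)].
Proof.
move=> df x y xr yr.
(* The first [k] coordinates come from [y], the others from [x]: consecutive points differ in one
   coordinate, and the increments of [f] telescope. *)
pose st (k : nat) : 'rV[R]_n := \row_a (if (a < k)%N then y 0 a else x 0 a).
have step (a : 'I_n) : exists zeta : 'rV[R]_n,
    [/\ `|zeta - y0| < r, `|zeta - x| <= `|y - x| &
      f (st a.+1) - f (st a) =
      'D_(delta_mx 0 a) f zeta * (y 0 a - x 0 a)].
  pose c (s : R) : 'rV[R]_n := s *: delta_mx 0 a + st a.
  have cE s b : c s 0 b = if b == a then s + x 0 a else st a 0 b.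
    rewrite !mxE eqxx /=; case: eqVneq => [->|ba].
      by rewrite ltnn mulr1.
    by rewrite mulr0 add0r.
  pose d := y 0 a - x 0 a.
  have c0 : c 0 = st a by rewrite /c scale0r add0r.
  have cd : c d = st a.+1.
    apply/rowP => b; rewrite cE /st !mxE ltnS [in RHS]leq_eqVlt -val_eqE /=.
    case: eqP => [ba|//]; have -> : b = a by apply: val_inj.
    by rewrite /d subrK.
  (* In the sup norm this is checked by coordinate: each coordinate of [c (t * d)] is one of [x],
     one of [y], or lies between the two. *)
  have near (t : R) : 0 <= t <= 1 -> `|c (t * d) - y0| < r /\ `|c (t * d) - x| <= `|y - x|.
    move=> /andP[t0 t1]; split.
      apply: mx_norm_lt => [|i b]; first exact: le_lt_trans xr.
      rewrite !ord1 mxE cE /st !mxE.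
      have xb : `|x 0 b - y0 0 b| < r.
        by apply: le_lt_trans xr; have := mx_entry_le (x - y0) 0 b; rewrite !mxE.
      have yb : `|y 0 b - y0 0 b| < r.
        by apply: le_lt_trans yr; have := mx_entry_le (y - y0) 0 b; rewrite !mxE.
      case: eqP => [ba|_]; last by case: ifP.
      rewrite /d -ba; move: xb yb; rewrite !ltr_norml => /andP[+ +] /andP[].
      have -> : t * (y 0 b - x 0 b) + x 0 b - y0 0 b =
        (x 0 b - y0 0 b) + t * ((y 0 b - y0 0 b) - (x 0 b - y0 0 b)) by ring.
      move: (x 0 b - y0 0 b) (y 0 b - y0 0 b) => X Y X1 X2 Y1 Y2.
      by have [XY|YX] := lerP X Y; apply/andP; split; nra.
    apply: mx_norm_le => // i b; rewrite !ord1 mxE cE /st !mxE.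
    have := mx_entry_le (y - x) 0 b; rewrite !mxE => yx.
    case: eqP => [ba|_]; last first.
      by case: ifP => // _; rewrite subrr normr0; exact: le_trans yx.
    rewrite /d -ba addrK normrM (ger0_norm t0); apply: le_trans yx.
    by rewrite ler_piMl.
  have [|t t01] := @MVT_scaled R (f \o c) (fun s => 'D_(delta_mx 0 a) f (c s)) d.
    move=> t t01; apply: is_derive_line; apply: df.
    by have [] := near _ t01.
  rewrite /= c0 cd => E; exists (c (t * d)).
  by have [? ?] := near _ t01; split.
have [zeta zetaP] := choice step.
exists zeta; split; [by move=> a; case: (zetaP a)|by move=> a; case: (zetaP a)|].
have stn : st n = y by apply/rowP => b; rewrite mxE ltn_ord.
have st0 : st 0%N = x by apply/rowP => b; rewrite mxE ltn0.
rewrite -{1}stn -{1}st0 -(telescope_sumr (f \o st) (leq0n n)) big_mkord.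
by apply: eq_bigr => a _; case: (zetaP a).
Qed.

(** Differentiability speaks of a linear map picked by choice; [getPex] reduces it to exhibiting
    some linear map with the defining property. *)
Lemma differentiable_eps (R : realType) (V W : normedModType R) (f : V -> W)
    (x : V) (L : {linear V -> W}) :
  continuous L ->
  (forall e, 0 < e ->
    \forall z \near x, `|f z - f x - L (z - x)| <= e * `|z - x|) ->
  differentiable f x.
Proof.
move=> cL H; apply/diffP.
apply: (@getPex _ (fun df : {linear V -> W} => continuous df /\ forall y,
  f y = f (lim (nbhs x)) + df (y - lim (nbhs x))
    +o_(y \near x) (y - lim (nbhs x)))).
exists L; split => //; apply/funeqP.
apply/eqaddoP => e e0; have := H _ e0; apply: filterS => z.
by rewrite lim_id // !fctE opprD addrA.
Qed.

(** [mean_value_coord] writes the increment with partial derivatives taken at points close to [y],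
    and continuity at [y] compares these with their values at [y]. *)
Lemma differentiable_partials (R : realType) n (f : 'rV[R]_n -> R)
    (V : set 'rV[R]_n) (y : 'rV[R]_n) :
  open V -> V y ->
  (forall z (a : 'I_n), V z -> derivable f z (delta_mx 0 a)) ->
  (forall a : 'I_n, {for y, continuous ('D_(delta_mx 0 a) f)}) ->
  differentiable f y.
Proof.
move=> oV Vy df cdf; have [r r0 rV] := nbhs_rV_ball oV Vy.
pose L0 (h : 'rV[R]_n) := \sum_a 'D_(delta_mx 0 a) f y * h 0 a.
have L0lin : linear L0.
  move=> k u v; rewrite /L0 scaler_sumr -big_split; apply: eq_bigr => a _ /=.
  by rewrite !mxE mulrDr mulrCA.
pose L : {linear 'rV[R]_n -> R} :=
  HB.pack L0 (GRing.isLinear.Build _ _ _ _ _ L0lin).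
apply: (@differentiable_eps _ _ _ f y L).
  apply/bounded_linear_continuous/bounded_funP => r1.
  exists (\sum_a `|'D_(delta_mx 0 a) f y| * r1) => h hr.
  apply: le_trans (ler_norm_sum _ _ _) _; apply: ler_sum => a _.
  rewrite normrM ler_wpM2l //; apply: le_trans hr; exact: mx_entry_le.
move=> e e0.
(* Each of the [n] coordinates contributes an error factor [e']; dividing by [n.+1] also covers
   [n = 0]. *)
pose e' := e / n.+1%:R.
have e'0 : 0 < e' by rewrite divr_gt0.
have [d [d0 dr dP]] : exists d, [/\ 0 < d, d <= r & forall z (a : 'I_n), `|z - y| < d ->
    `|'D_(delta_mx 0 a) f y - 'D_(delta_mx 0 a) f z| <= e'].
  have H (a : 'I_n) : \forall z \near y,
      `|'D_(delta_mx 0 a) f y - 'D_(delta_mx 0 a) f z| <= e'.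
    by have /cvgrPdist_le /(_ _ e'0) := cdf a.
  have := @filter_forall _ _ _ _ (nbhs_filter y) H.
  move=> /nbhs_ballP[d /= d0 dP]; exists (Num.min d r); split.
  - by rewrite lt_min d0 r0.
  - by rewrite ge_min lexx orbT.
  - move=> z a; rewrite lt_min => /andP[zd _]; apply: dP.
    by rewrite -ball_normE /= distrC.
near=> z.
have zd : `|z - y| < d.
  by near: z; apply/nbhs_ballP; exists d => //= u; rewrite -ball_normE /= distrC.
have yd : `|y - y| < d by rewrite subrr normr0.
have [|zeta [zeta1 zeta2 ->]] := @mean_value_coord _ _ f y d _ y z yd zd; last first.
- rewrite /L /= /L0 -sumrB; apply: le_trans (ler_norm_sum _ _ _) _.
  apply: (@le_trans _ _ (\sum_(a < n) e' * `|z - y|)).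
    apply: ler_sum => a _; rewrite !mxE -mulrBl normrM ler_pM //.
      by rewrite distrC; exact: dP.
    by have := mx_entry_le (z - y) 0 a; rewrite !mxE.
  rewrite sumr_const card_ord -mulr_natr mulrAC ler_wpM2r //.
  by rewrite /e' -mulrA ler_piMr ?(ltW e0) // mulrC ler_pdivrMr ?mul1r ?ler_nat.
- by move=> u a ud; apply/df/rV; exact: lt_le_trans dr.
Unshelve. all: by end_near. Qed.

Lemma near_open (T : topologicalType) (V : set T) (y : T) (P : T -> Prop) :
  open V -> V y -> (forall z, V z -> P z) -> \forall z \near y, P z.
Proof. by move=> oV Vy VP; apply: filterS VP _; exact: open_nbhs_nbhs. Qed.

Section Ck.
Context {R : realType} {n : nat}.
Implicit Types (W : normedModType R) (V : set 'rV[R]_n) (k : nat).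

Lemma near_eq_continuous (T U : topologicalType) (f g : T -> U) (y : T) :
  {near y, f =1 g} -> {for y, continuous f} -> {for y, continuous g}.
Proof.
move=> fg cf; rewrite /prop_for /continuous_at -(nbhs_singleton fg).
by apply: cvg_trans cf; exact: near_eq_cvg.
Qed.

Lemma Ck_on_eq W k V (f g : 'rV[R]_n -> W) :
  open V -> (forall y, V y -> f y = g y) -> Ck_on k V f -> Ck_on k V g.
Proof.
move=> oV; elim: k f g => [|k IH] f g fg [cf Hf].
  split=> // y Vy; apply: near_eq_continuous (cf _ Vy).
  exact: near_open oV Vy fg.
split.
  move=> y Vy; apply: near_eq_continuous (cf _ Vy); exact: near_open oV Vy fg.
move=> a; have [df Cf] := Hf a; split.
  move=> y Vy; apply: near_eq_derivable (df _ Vy); exact: near_open oV Vy fg.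
apply: IH Cf => y Vy; apply: near_eq_derive; exact: near_open oV Vy fg.
Qed.

Lemma Ck_on_cont W k V (f : 'rV[R]_n -> W) y :
  Ck_on k V f -> V y -> {for y, continuous f}.
Proof. by case: k => [|k] [cf _]; exact: cf. Qed.

Lemma Ck_onW W k V (f : 'rV[R]_n -> W) : Ck_on k.+1 V f -> Ck_on k V f.
Proof.
elim: k f => [|k IH] f [cf Hf]; split=> // a; have [df Cf] := Hf a.
by split=> //; exact: IH.
Qed.

Lemma Ck_on_sub W k V V' (f : 'rV[R]_n -> W) :
  V' `<=` V -> Ck_on k V f -> Ck_on k V' f.
Proof.
move=> VV; elim: k f => [|k IH] f [cf Hf]; split=> //; try by move=> y /VV; exact: cf.
by move=> a; have [df Cf] := Hf a; split; [move=> y /VV; exact: df|exact: IH].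
Qed.

Lemma Ck_on_mxP p q k V (F : 'rV[R]_n -> 'M[R]_(p, q)) : open V ->
  Ck_on k V F <-> forall i j, Ck_on k V (fun y => F y i j).
Proof.
move=> oV; elim: k F => [|k IH] F.
  split=> [[cF _] i j|H]; split=> // y Vy.
    by have /continuous_mxP := cF _ Vy; exact.
  by apply/continuous_mxP => i j; have [] := H i j; move=> /(_ y Vy).
split=> [[cF HF] i j|H].
  split=> [y Vy|a]; first by have /continuous_mxP := cF _ Vy; exact.
  have [dF CF] := HF a; split.
    by move=> y Vy; have /derivable_mxP := dF _ Vy; exact.
  move/IH: CF => /(_ i j); apply: Ck_on_eq => // y Vy.
  by rewrite derive_mx ?mxE //; exact: dF.
split=> [y Vy|a].
  by apply/continuous_mxP => i j; exact: (Ck_on_cont (H i j)).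
have dF y : V y -> derivable F y (delta_mx 0 a).
  by move=> Vy; apply/derivable_mxP => i j; have [_ /(_ a)[]] := H i j; move=> /(_ y Vy).
split=> //; apply/IH => i j; have [_ /(_ a)[_]] := H i j.
by apply: Ck_on_eq => // y Vy; rewrite derive_mx ?mxE //; exact: dF.
Qed.

Lemma Ck_on_cst W k V (c : W) : Ck_on k V (fun=> c).
Proof.
elim: k c => [|k IH] c; split=> //; try by move=> y _; exact: cst_continuous.
move=> a; split=> [y _|]; first exact: derivable_cst.
have -> : 'D_(delta_mx 0 a) (fun=> c) = (fun=> 0) :> ('rV[R]_n -> W).
  by apply/funext => y; exact: derive_cst.
exact: IH.
Qed.

Lemma Ck_onD W k V (f g : 'rV[R]_n -> W) : open V ->
  Ck_on k V f -> Ck_on k V g -> Ck_on k V (fun y => f y + g y).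
Proof.
move=> oV; elim: k f g => [|k IH] f g [cf Hf] [cg Hg]; split=> //;
  try by move=> y Vy; exact: cvgD (cf _ Vy) (cg _ Vy).
move=> a; have [df Cf] := Hf a; have [dg Cg] := Hg a; split=> [y Vy|].
  by apply: derivableD; [exact: df|exact: dg].
apply: Ck_on_eq (IH _ _ Cf Cg) => // y Vy.
by rewrite deriveD //; [exact: df|exact: dg].
Qed.

Lemma Ck_onM k V (f g : 'rV[R]_n -> R) : open V ->
  Ck_on k V f -> Ck_on k V g -> Ck_on k V (fun y => f y * g y).
Proof.
move=> oV; elim: k f g => [|k IH] f g Cf0 Cg0; have [cf Hf] := Cf0;
  have [cg Hg] := Cg0; split=> //;
  try by move=> y Vy; exact: cvgM (cf _ Vy) (cg _ Vy).
move=> a; have [df Cf] := Hf a; have [dg Cg] := Hg a; split=> [y Vy|].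
  by apply: derivableM; [exact: df|exact: dg].
apply: Ck_on_eq (Ck_onD oV (IH _ _ (Ck_onW Cf0) Cg) (IH _ _ (Ck_onW Cg0) Cf)) => // y Vy.
by rewrite deriveM //; [exact: df|exact: dg].
Qed.

Lemma Ck_on_sum (I : Type) (s : seq I) k V (f : I -> 'rV[R]_n -> R) : open V ->
  (forall i, Ck_on k V (f i)) -> Ck_on k V (fun y => \sum_(i <- s) f i y).
Proof.
move=> oV Cf; elim: s => [|i s IH].
  by apply: Ck_on_eq (Ck_on_cst k V 0) => // y _; rewrite big_nil.
by apply: Ck_on_eq (Ck_onD oV (Cf i) IH) => // y _; rewrite big_cons.
Qed.

Lemma Ck_on_mulmx p q r k V (F : 'rV[R]_n -> 'M[R]_(p, q))
    (G : 'rV[R]_n -> 'M[R]_(q, r)) : open V ->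
  Ck_on k V F -> Ck_on k V G -> Ck_on k V (fun y => F y *m G y).
Proof.
move=> oV /(Ck_on_mxP _ _ oV) CF /(Ck_on_mxP _ _ oV) CG.
apply/Ck_on_mxP => // i j.
have : Ck_on k V (fun y => \sum_l F y i l * G y l j).
  by apply: Ck_on_sum => // l; exact: Ck_onM.
by apply: Ck_on_eq => // y _; rewrite mxE.
Qed.

Lemma Ck_on_trmx p q k V (F : 'rV[R]_n -> 'M[R]_(p, q)) : open V ->
  Ck_on k V F -> Ck_on k V (fun y => (F y)^T).
Proof.
move=> oV /(Ck_on_mxP _ _ oV) CF; apply/Ck_on_mxP => // i j.
by apply: Ck_on_eq (CF j i) => // y _; rewrite mxE.
Qed.

Lemma differentiable_mx p q (F : 'rV[R]_n -> 'M[R]_(p, q)) y :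
  (forall i j, differentiable (fun z => F z i j) y) -> differentiable F y.
Proof.
move=> dF.
have -> : F = \sum_i \sum_j (fun z => F z i j *: delta_mx i j).
  apply/funext => z; rewrite [LHS]matrix_sum_delta fct_sumE.
  by apply: eq_bigr => i _; rewrite fct_sumE.
apply: differentiable_sum => i; apply: differentiable_sum => j.
exact: differentiableZl.
Qed.

Lemma Ck_on_differentiable p q k V (F : 'rV[R]_n -> 'M[R]_(p, q)) y :
  open V -> V y -> Ck_on k.+1 V F -> differentiable F y.
Proof.
move=> oV Vy /(Ck_on_mxP _ _ oV) CF; apply: differentiable_mx => i j.
have [_ CFij] := CF i j.
apply: (differentiable_partials oV Vy) => [z a Vz|a]; have [df Cf] := CFij a.
  exact: df.
exact: Ck_on_cont Cf Vy.
Qed.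

Lemma Ck_on_differentiable1 k V (f : 'rV[R]_n -> R) y :
  open V -> V y -> Ck_on k.+1 V f -> differentiable f y.
Proof.
move=> oV Vy [_ Cf].
apply: (differentiable_partials oV Vy) => [z a Vz|a]; have [df Cdf] := Cf a.
  exact: df.
exact: Ck_on_cont Cdf Vy.
Qed.

Lemma derive_coord_sum W (f : 'rV[R]_n -> W) y v : differentiable f y ->
  'D_v f y = \sum_a v 0 a *: 'D_(delta_mx 0 a) f y.
Proof.
move=> df; rewrite deriveE // {1}(row_sum_delta v) linear_sum.
by apply: eq_bigr => a _; rewrite linearZ deriveE.
Qed.

Lemma derive_comp p W (f : 'rV[R]_p -> W) (tau : 'rV[R]_n -> 'rV[R]_p) y v :
  differentiable tau y -> differentiable f (tau y) ->
  'D_v (f \o tau) y = 'D_('D_v tau y) f (tau y).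
Proof.
move=> dt df; rewrite deriveE; last exact: differentiable_comp.
by rewrite diff_comp // !deriveE.
Qed.

Lemma derive_mxE p q (F : 'rV[R]_n -> 'M[R]_(p, q)) y v i j :
  derivable F y v -> 'D_v F y i j = 'D_v (fun z => F z i j) y.
Proof. by move=> dF; rewrite derive_mx // mxE. Qed.

Lemma jacobianE p (tau : 'rV[R]_n -> 'rV[R]_p) y a b : differentiable tau y ->
  jacobian tau y a b = 'D_(delta_mx 0 a) (fun z => tau z 0 b) y.
Proof.
move=> dt; rewrite -derive_mxE; last exact: diff_derivable.
by rewrite deriveEjacobian // -rowE [RHS]mxE.
Qed.

(** The mean value theorem is applied twice: in the direction [v] to the difference [F] of two
    translates, then in the direction [w] to the derivative so obtained. *)
Lemma second_difference (f : 'rV[R]_n -> R) y (V : set 'rV[R]_n) (v w : 'rV[R]_n) h :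
  (forall s t : R, 0 <= s <= h -> 0 <= t <= h -> V (s *: v + (t *: w + y))) ->
  (forall z, V z -> derivable f z v) ->
  (forall z, V z -> derivable ('D_v f) z w) -> 0 <= h ->
  exists st : R * R, [/\ 0 <= st.1 <= h, 0 <= st.2 <= h &
    f (h *: v + (h *: w + y)) - f (h *: v + y) - (f (h *: w + y) - f y) =
    'D_w ('D_v f) (st.1 *: v + (st.2 *: w + y)) * h * h].
Proof.
move=> Vst dv dw h0.
have scale (t : R) : 0 <= t <= 1 -> 0 <= t * h <= h.
  by move=> /andP[t0 t1]; rewrite mulr_ge0 //= ler_piMl.
have h0h : 0 <= h <= h by rewrite h0 lexx.
have z0h : 0 <= (0 : R) <= h by rewrite h0 lexx.
pose F s := f (s *: v + (h *: w + y)) - f (s *: v + y).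
have dF (t : R) : 0 <= t <= 1 -> is_derive (t * h) 1 F
    ('D_v f (t * h *: v + (h *: w + y)) - 'D_v f (t * h *: v + y)).
  move=> /scale th; apply: is_deriveB; apply: is_derive_line; apply: dv.
    exact: Vst.
  by have := Vst _ _ th z0h; rewrite scale0r add0r.
have [t /scale t01] := @MVT_scaled _ F
  (fun s => 'D_v f (s *: v + (h *: w + y)) - 'D_v f (s *: v + y)) h dF.
rewrite /F !scale0r !add0r => ->; move: (t * h) t01 => s s0h.
pose G t := 'D_v f (t *: w + (s *: v + y)).
have dG (t' : R) : 0 <= t' <= 1 ->
    is_derive (t' * h) 1 G ('D_w ('D_v f) (t' * h *: w + (s *: v + y))).
  by move=> /scale th; apply: is_derive_line; apply: dw; rewrite addrCA; exact: Vst.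
have [t' /scale t'01] := @MVT_scaled _ G
  (fun t => 'D_w ('D_v f) (t *: w + (s *: v + y))) h dG.
rewrite /G scale0r add0r addrCA => ->.
rewrite [(t' * h) *: w + _]addrCA; move: (t' * h) t'01 => t1 t1h.
by exists (s, t1); split; [exact: s0h|exact: t1h|reflexivity].
Qed.

Lemma delta_mx_norm_le1 (a : 'I_n) : `|delta_mx 0 a : 'rV[R]_n| <= 1.
Proof.
apply: mx_norm_le => // i j; rewrite mxE.
by case: (_ && _); rewrite ?normr1 ?normr0.
Qed.

(** The second difference over a small square is symmetric in the two directions. By
    [second_difference], a value of one mixed derivative near [y] therefore equals a value of the
    other near [y], and continuity at [y] concludes. *)
Lemma schwarz V (f : 'rV[R]_n -> R) y (a b : 'I_n) : open V -> V y ->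
  Ck_on 2 V f ->
  'D_(delta_mx 0 a) ('D_(delta_mx 0 b) f) y =
  'D_(delta_mx 0 b) ('D_(delta_mx 0 a) f) y.
Proof.
move=> oV Vy [_ Cf]; set ea : 'rV[R]_n := delta_mx 0 a.
set eb : 'rV[R]_n := delta_mx 0 b.
have [da [_ /(_ b)[dba [Cba _]]]] := Cf a.
have [db [_ /(_ a)[dab [Cab _]]]] := Cf b.
apply/eqP; rewrite -subr_eq0 -normr_eq0; apply/eqP/le_anti; rewrite normr_ge0 andbT.
apply/ler_addgt0Pl => e e0; rewrite addr0.
have e20 : 0 < e / 2 by rewrite divr_gt0.
have /cvgrPdist_le /(_ _ e20) H1 := Cab _ Vy.
have /cvgrPdist_le /(_ _ e20) H2 := Cba _ Vy.
have [r /= r0 rP] := (nbhs_ballP _ _).1 (filterI (open_nbhs_nbhs (conj oV Vy)) (filterI H1 H2)).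
(* Points of the square are at distance at most [2 * h < r] from [y]. *)
pose h := r / 3.
have h0 : 0 < h by rewrite divr_gt0.
have box (v w : 'rV[R]_n) s t : `|v| <= 1 -> `|w| <= 1 -> 0 <= s <= h -> 0 <= t <= h ->
    ball y r (s *: v + (t *: w + y)).
  move=> v1 w1 /andP[s0 sh] /andP[t0 th].
  rewrite -ball_normE /= distrC addrA addrK.
  apply: le_lt_trans (ler_normD _ _) _; rewrite !normrZ !ger0_norm //.
  have s1 : s * `|v| <= h by rewrite -[h]mulr1; apply: ler_pM.
  have t1 : t * `|w| <= h by rewrite -[h]mulr1; apply: ler_pM.
  apply: le_lt_trans (lerD s1 t1) _; rewrite /h; lra.
have na : `|ea| <= 1 := delta_mx_norm_le1 a.
have nb : `|eb| <= 1 := delta_mx_norm_le1 b.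
have [|||| [s t] [/= s0 t0 E1]] := @second_difference f y (ball y r) ea eb h.
- by move=> s t s0 t0; exact: box.
- by move=> z /rP[Vz _]; exact: da.
- by move=> z /rP[Vz _]; exact: dba.
- exact: ltW.
have [|||| [s' t'] [/= s'0 t'0 E2]] := @second_difference f y (ball y r) eb ea h.
- by move=> ? ? ? ?; exact: box.
- by move=> z /rP[Vz _]; exact: db.
- by move=> z /rP[Vz _]; exact: dab.
- exact: ltW.
have E : 'D_eb ('D_ea f) (s *: ea + (t *: eb + y)) =
         'D_ea ('D_eb f) (s' *: eb + (t' *: ea + y)).
  move: E2; rewrite [h *: eb + (h *: ea + y)]addrCA => E2.
  have combine (A B f1 f2 f3 f4 : R) : f1 - f2 - (f3 - f4) = A * h * h ->
      f1 - f3 - (f2 - f4) = B * h * h -> A = B.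
    move=> EA EB; apply/(mulIf (lt0r_neq0 h0))/(mulIf (lt0r_neq0 h0)).
    by rewrite -EA -EB; ring.
  exact: combine E1 E2.
have [_ [_ P1]] := rP _ (box _ _ _ _ na nb s0 t0).
have [_ [P2 _]] := rP _ (box _ _ _ _ nb na s'0 t'0).
have combine (A B C D : R) : C = D -> `|A - C| <= e / 2 -> `|B - D| <= e / 2 ->
    `|B - A| <= e.
  move=> <- PA PB; have -> : B - A = (B - C) - (A - C) by ring.
  rewrite [e]splitr; exact: le_trans (ler_normB _ _) (lerD PB PA).
exact: combine E P1 P2.
Qed.

End Ck.

(** By the chain rule a partial derivative of the composite is a sum of products of partial
    derivatives of [tau] with partial derivatives of [f] composed with [tau]; the induction
    hypothesis covers the latter. *)
Lemma Ck_on_comp (R : realType) n p k (V : set 'rV[R]_p) (V' : set 'rV[R]_n)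
    (f : 'rV[R]_p -> R) (tau : 'rV[R]_n -> 'rV[R]_p) :
  open V -> open V' -> (forall y, V' y -> V (tau y)) ->
  Ck_on k V f -> Ck_on k V' tau -> Ck_on k V' (f \o tau).
Proof.
move=> oV oV' tV; elim: k f => [|k IH] f Cf Ct.
  split=> // y V'y; apply: continuous_comp; first exact: Ck_on_cont Ct V'y.
  by apply: Ck_on_cont Cf _; exact: tV.
split=> [y V'y|a].
  apply: continuous_comp; first exact: Ck_on_cont Ct V'y.
  by apply: Ck_on_cont Cf _; exact: tV.
have dt y : V' y -> differentiable tau y.
  by move=> V'y; exact: Ck_on_differentiable oV' V'y Ct.
have df y : V y -> differentiable f y.
  by move=> Vy; exact: Ck_on_differentiable1 oV Vy Cf.
split=> [y V'y|].
  by apply/diff_derivable/differentiable_comp; [exact: dt|exact/df/tV].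
have : Ck_on k V' (fun y => \sum_b 'D_(delta_mx 0 a) (fun z => tau z 0 b) y *
    ('D_(delta_mx 0 b) f \o tau) y).
  apply: Ck_on_sum => // b; apply: Ck_onM => //.
    move/(Ck_on_mxP _ _ oV') : (Ct) => /(_ 0 b)[_ /(_ a)[_]]; exact.
  apply: IH; last exact: Ck_onW.
  by have [_ /(_ b)[_]] := Cf.
apply: Ck_on_eq => // y V'y.
rewrite derive_comp; [|exact: dt|exact/df/tV].
rewrite derive_coord_sum; last exact/df/tV.
by apply: eq_bigr => b _; rewrite derive_mxE //; exact/diff_derivable/dt.
Qed.


(** A single [L] bounds both the values and the increments, because Lipschitz estimates for products
    need both. *)
Lemma C1_locally_lipschitz (R : realType) n (V : set 'rV[R]_n)
    (f : 'rV[R]_n -> R) (y : 'rV[R]_n) :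
  open V -> V y -> Ck_on 1 V f ->
  exists r L : R, [/\ 0 < r, 0 <= L &
    forall z w, `|z - y| < r -> `|w - y| < r ->
      `|f z| <= L /\ `|f z - f w| <= L * `|z - w|].
Proof.
move=> oV Vy Cf; have [cf Hf] := Cf.
have [r0 r00 r0V] := nbhs_rV_ball oV Vy.
have H (a : 'I_n) : \forall z \near y,
    `|'D_(delta_mx 0 a) f y - 'D_(delta_mx 0 a) f z| <= 1.
  by have [_ [cdf _]] := Hf a; have /cvgrPdist_le /(_ _ ltr01) := cdf _ Vy.
have H0 : \forall z \near y, `|f y - f z| <= 1.
  by have /cvgrPdist_le /(_ _ ltr01) := cf _ Vy.
have [r1 /= r10 r1P] :=
  (nbhs_ballP _ _).1 (filterI (@filter_forall _ _ _ _ (nbhs_filter y) H) H0).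
pose r := Num.min r0 r1.
have r_gt0 : 0 < r by rewrite lt_min r00.
(* On the ball each partial derivative is within 1 of its value at [y], so [K] bounds the sum of
   their absolute values. *)
pose K := \sum_(a < n) (`|'D_(delta_mx 0 a) f y| + 1).
have K0 : 0 <= K by apply: sumr_ge0 => a _; rewrite addr_ge0.
have rP z : `|z - y| < r -> [/\ V z, `|f y - f z| <= 1 & forall a : 'I_n,
    `|'D_(delta_mx 0 a) f y - 'D_(delta_mx 0 a) f z| <= 1].
  rewrite lt_min => /andP[z0 z1]; have [|A B] := r1P z.
    by rewrite -ball_normE /= distrC.
  by split=> //; exact: r0V.
exists r, (K + (`|f y| + 1)); split=> // [|z w zr wr].
  by rewrite !addr_ge0.
split.
  have [_ B _] := rP _ zr; apply: (@le_trans _ _ (`|f y| + 1)); last by rewrite lerDr.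
  have -> : f z = f y - (f y - f z) by ring.
  by apply: le_trans (ler_normB _ _) _; rewrite lerD2l.
have [|zeta [zeta1 _ ->]] := @mean_value_coord _ _ f y r _ w z wr zr.
  by move=> u a /rP[Vu _ _]; have [df _] := Hf a; exact: df.
apply: (@le_trans _ _ (K * `|z - w|)); last first.
  by rewrite ler_wpM2r // lerDl addr_ge0.
rewrite mulr_suml; apply: le_trans (ler_norm_sum _ _ _) _; apply: ler_sum => a _.
rewrite normrM ler_pM //; last first.
  by have := mx_entry_le (z - w) 0 a; rewrite !mxE.
have [_ _ /(_ a) B] := rP _ (zeta1 a).
set A := 'D_(delta_mx 0 a) f y; rewrite -/A in B.
move: ('D_(delta_mx 0 a) f (zeta a)) B => C B.
have -> : C = A - (A - C) by ring.
by apply: le_trans (ler_normB _ _) _; rewrite lerD2l.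
Qed.

Lemma is_derive_mxP (R : realType) (V : normedModType R) m n
    (F : V -> 'M[R]_(m, n)) x v (dF : 'M[R]_(m, n)) :
  is_derive x v F dF <->
  forall i j, is_derive x v (fun z => F z i j) (dF i j).
Proof.
split=> [[dvF <-] i j|H].
  have dFij := (derivable_mxP F x v).1 dvF i j.
  by rewrite derive_mx // mxE; exact: derivableP.
have dvF : derivable F x v by apply/derivable_mxP => i j; have [] := H i j.
split=> //; rewrite derive_mx //; apply/matrixP => i j; rewrite mxE.
by have [_ ->] := H i j.
Qed.

Lemma is_derive_sumr (R : realType) (V W : normedModType R) (I : Type) (s : seq I)
    (f : I -> V -> W) (df : I -> W) x v :
  (forall i, is_derive x v (f i) (df i)) ->
  is_derive x v (fun z => \sum_(i <- s) f i z) (\sum_(i <- s) df i).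
Proof.
move=> H; elim: s => [|i s IH].
  rewrite big_nil; have -> : (fun z => \sum_(i <- [::]) f i z) = (fun=> 0).
    by apply/funext => z; rewrite big_nil.
  exact: is_derive_cst.
rewrite big_cons; have -> : (fun z => \sum_(j <- i :: s) f j z) =
    (fun z => f i z + \sum_(j <- s) f j z).
  by apply/funext => z; rewrite big_cons.
exact: is_deriveD.
Qed.

Lemma is_derive_prod (R : realType) (V : normedModType R) (f g : V -> R) x v
    (df dg : R) : is_derive x v f df -> is_derive x v g dg ->
  is_derive x v (fun z => f z * g z) (df * g x + f x * dg).
Proof.
move=> Hf Hg; have H := @is_deriveM _ _ f g x v df dg Hf Hg.
have -> : df * g x + f x * dg = f x *: dg + g x *: df.
  by rewrite addrC -![_ *: _]/(_ * _) [g x * df]mulrC.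
exact H.
Qed.

Lemma is_derive_mulmx (R : realType) (V : normedModType R) m n p
    (F : V -> 'M[R]_(m, n)) (G : V -> 'M[R]_(n, p)) x v dF dG :
  is_derive x v F dF -> is_derive x v G dG ->
  is_derive x v (fun z => F z *m G z) (dF *m G x + F x *m dG).
Proof.
move=> /is_derive_mxP HF /is_derive_mxP HG; apply/is_derive_mxP => i j.
have -> : (fun z => (F z *m G z) i j) = (fun z => \sum_k F z i k * G z k j).
  by apply/funext => z; rewrite mxE.
rewrite !mxE -big_split /=; apply: is_derive_sumr => k; exact: is_derive_prod.
Qed.

Lemma is_derive_trmx (R : realType) (V : normedModType R) m n
    (F : V -> 'M[R]_(m, n)) x v dF :
  is_derive x v F dF -> is_derive x v (fun z => (F z)^T) dF^T.
Proof.
move=> /is_derive_mxP HF; apply/is_derive_mxP => i j; rewrite mxE.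
have -> : (fun z => (F z)^T i j) = (fun z => F z j i) by apply/funext => z; rewrite mxE.
exact: HF.
Qed.

Lemma is_derive_curve (R : realType) (V W : normedModType R) (f : V -> W)
    (c : R -> V) (t : R) (w : V) : is_derive t 1 c w -> differentiable f (c t) ->
  is_derive t 1 (f \o c) ('D_w f (c t)).
Proof.
move=> [dc <-] df; have dc' : differentiable c t by exact/derivable1_diffP.
have dfc : differentiable (f \o c) t by exact: differentiable_comp.
split; first exact/derivable1_diffP.
by rewrite !deriveE // diff_comp.
Qed.

(** * Ordinary differential equations *)

Definition clamp (R : realType) (d x : R) : R := Num.max (- d) (Num.min d x).

Lemma clamp_norm (R : realType) (d x : R) : 0 <= d -> `|clamp d x| <= d.
Proof.
move=> d0; rewrite ler_norml /clamp le_max lexx /= ge_max ge_min lexx /= andbT.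
by lra.
Qed.

Lemma clamp_id (R : realType) (d x : R) : `|x| <= d -> clamp d x = x.
Proof. by rewrite ler_norml /clamp => /andP[? ?]; rewrite min_r // max_r. Qed.

Lemma clamp_lipschitz (R : realType) (d x y : R) : 0 <= d ->
  `|clamp d x - clamp d y| <= `|x - y|.
Proof.
wlog xy : x y / x <= y => [H d0|d0].
  by have [/H|/ltW /H] := leP x y; [exact|rewrite distrC (distrC x); exact].
have maxP (a u v : R) : u <= v -> 0 <= Num.max a v - Num.max a u <= v - u.
  by move=> uv; case: (leP a u) => au; case: (leP a v) => av; lra.
have minP (a u v : R) : u <= v -> 0 <= Num.min a v - Num.min a u <= v - u.
  by move=> uv; case: (leP a u) => au; case: (leP a v) => av; lra.
have /andP[k0 k1] := minP d _ _ xy; rewrite subr_ge0 in k0.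
have /andP[l0 l1] := maxP (- d) _ _ k0.
rewrite distrC (distrC x) !ger0_norm ?subr_ge0 //; first exact: le_trans l1 k1.
by rewrite -subr_ge0.
Qed.

Lemma clamp_continuous (R : realType) (d : R) : 0 <= d -> continuous (clamp d).
Proof.
move=> d0 x; apply/cvgrPdist_le => e e0; near=> y.
apply: le_trans (clamp_lipschitz _ _ d0) _.
near: y; by have /cvgrPdist_le /(_ _ e0) := @cvg_id _ (nbhs x).
Unshelve. all: by end_near. Qed.

(** Integrating from -1 makes times on both sides of 0 interior points. The Picard iteration only
    visits times in [[-d, d]] with [d < 1]. *)
Lemma antiderivative (R : realType) (g : R -> R) : continuous g ->
  exists G : R -> R, G 0 = 0 /\
    forall t : R, -1 < t -> t < 1 -> is_derive t 1 G (g t).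
Proof.
move=> cg.
pose F (x : R) : R := (\int[lebesgue_measure]_(t in [set` `[-1, x]]) (g t))%R.
have Fi : (@lebesgue_measure R).-integrable `[-1, 1] (EFin \o g).
  apply: continuous_compact_integrable; first exact: segment_compact.
  exact: continuous_subspaceT.
exists (fun x => F x - F 0); split=> [|t t1 t2]; first by rewrite subrr.
have [dF F'] := continuous_FTC1_closed t2 Fi t1 (cg t).
have DF : is_derive t 1 F (g t) by split; [exact dF|rewrite -derive1E; exact F'].
have H := @is_deriveB _ _ _ F (cst (F 0)) t 1 _ _ DF (is_derive_cst _ _ _).
by rewrite subr0 in H.
Qed.

Lemma mean_value_bound (R : realType) (f df : R -> R) (s t b : R) :
  (forall z, `|z - s| <= `|t - s| -> is_derive z 1 f (df z)) ->
  (forall z, `|z - s| <= `|t - s| -> `|df z| <= b) ->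
  `|f t - f s| <= b * `|t - s|.
Proof.
move=> Hf Hb.
have E h : h *: (1 : R) + s = h + s by rewrite -[h *: 1]/(h * 1) mulr1.
have near (h : R) : 0 <= h <= 1 -> `|h * (t - s) + s - s| <= `|t - s|.
  by move=> /andP[h0 h1]; rewrite addrK normrM ger0_norm // ler_piMl.
have [|h h01] := @MVT_scaled _ (fun h : R => f (h *: (1 : R) + s))
    (fun h : R => df (h + s)) (t - s).
  move=> h h01; have [D <-] := Hf _ (near _ h01).
  by rewrite -(E (h * (t - s))) in D *; exact: is_derive_line D.
rewrite !E subrK add0r => ->; rewrite normrM ler_wpM2r //.
exact/Hb/near.
Qed.

Section ODE.
Context {R : realType} {I : finType}.
Implicit Types (x y c : I -> R) (F : (I -> R) -> I -> R).

(** A Lipschitz condition for the sup distance, with [e] standing for any bound on that distance, so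
    that no norm on [I -> R] is involved. *)
Definition box_lipschitz (F : (I -> R) -> I -> R) (c : I -> R) (r L : R) :=
  forall x y (e : R), (forall i, `|x i - c i| <= r) -> (forall i, `|y i - c i| <= r) ->
    (forall i, `|x i - y i| <= e) -> forall i, `|F x i - F y i| <= L * e.

Lemma continuous_lipschitz_comp F (u : I -> R -> R) (L : R) :
  0 <= L ->
  (forall x y (e : R), (forall i, `|x i - y i| <= e) -> forall i, `|F x i - F y i| <= L * e) ->
  (forall i, continuous (u i)) ->
  forall i, continuous (fun t => F (u ^~ t) i).
Proof.
move=> L0 LF cu i t; apply/cvgrPdist_le => e e0.
have e'0 : 0 < e / (L + 1) by rewrite divr_gt0 // ltr_wpDl.
have H (j : I) : \forall s \near t, `|u j t - u j s| <= e / (L + 1).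
  by have /cvgrPdist_le /(_ _ e'0) := cu j t.
have := @filter_forall _ _ _ _ (nbhs_filter t) H; apply: filterS => s us.
apply: le_trans (LF _ _ _ us i) _.
by rewrite mulrCA ler_piMr ?(ltW e0) // ler_pdivrMr ?mul1r ?lerDl // ltr_wpDl.
Qed.

(** Supplies the pointwise limit of the Picard iterates. *)
Lemma nested_limit (a b : nat -> R) :
  (forall k, a k <= a k.+1) -> (forall k, b k.+1 <= b k) -> (forall k, a k <= b k) ->
  exists l, forall k, a k <= l <= b k.
Proof.
move=> ha hb ab.
have mono k l : (k <= l)%N -> a k <= a l /\ b l <= b k.
  move=> /subnK <-; elim: (l - k)%N => [|d [IHa IHb]]; first by rewrite add0n.
  by rewrite addSn; split; [apply: le_trans IHa _|apply: le_trans _ IHb].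
have cross k l : a k <= b l.
  have [kl|/ltnW lk] := leqP k l.
    by apply: le_trans (ab l); have [] := mono _ _ kl.
  by apply: le_trans (ab k) _; have [] := mono _ _ lk.
exists (sup (range a)) => k.
have nea : range a !=set0 by exists (a 0%N), 0%N.
apply/andP; split; last by apply: ge_sup => // _ [l _ <-]; exact: cross.
by apply: ub_le_sup; [exists (b 0%N) => _ [l _ <-]; exact: cross|exists k].
Qed.

Lemma geometric_small (K e : R) : 0 <= K -> 0 < e -> exists k : nat, K / 2 ^+ k <= e.
Proof.
move=> K0 e0; exists (Num.bound (K / e)).
have := archi_boundP (divr_ge0 K0 (ltW e0)); set k := Num.bound _ => Kk.
rewrite ler_pdivrMr ?exprn_gt0 // -ler_pdivrMl // mulrC; apply: ltW (lt_le_trans Kk _).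
(* What remains is [k <= 2 ^+ k]. *)
elim: k {Kk} => [|k IH]; first by rewrite expr0.
have : 1 <= 2 ^+ k :> R by rewrite exprn_ege1 // ler1n.
by rewrite -natr1 exprS; lra.
Qed.

(* Picard iteration; time is clamped to [[-d, d]], so that all iterates are
   defined and continuous on the whole line. *)
Lemma ode_exists_global F (c : I -> R) (L : R) : 0 <= L ->
  (forall x y (e : R), (forall i, `|x i - y i| <= e) -> forall i, `|F x i - F y i| <= L * e) ->
  exists (d : R) (u : I -> R -> R), [/\ 0 < d, forall i, continuous (u i),
    forall i, u i 0 = c i &
    forall t : R, `|t| < d -> forall i, is_derive t 1 (u i) (F (u ^~ t) i)].
Proof.
move=> L0 LF.
(* With this [d] the integral operator contracts by [L * d <= 1/2], and [d < 1] keeps clamped times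
   where [antiderivative] applies. *)
pose d : R := (2 * (L + 1))^-1.
have d0 : 0 < d by rewrite invr_gt0; lra.
have dL : L * d <= 2^-1.
  by rewrite /d ler_pdivrMr; lra.
have d1 : d < 1 by rewrite /d invf_lt1; lra.
(* A total choice of antiderivatives; for a discontinuous [g] the value is a dummy. *)
have prim (g : R -> R) : exists G : R -> R, continuous g ->
    G 0 = 0 /\ forall t : R, -1 < t -> t < 1 -> is_derive t 1 G (g t).
  by have [/antiderivative[G GP]|ncg] := pselect (continuous g); [exists G|exists g].
have [A AP] := choice prim.
pose k := clamp d.
have k_in t : -1 < k t /\ k t < 1.
  by have := clamp_norm t (ltW d0); rewrite -/(k t) ler_norml => /andP[? ?]; split; lra.
pose step (u : I -> R -> R) i t := c i + A (fun s => F (u ^~ s) i) (k t).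
have step_cont (u : I -> R -> R) : (forall i, continuous (u i)) -> forall i, continuous (step u i).
  move=> cu i t; have cF := continuous_lipschitz_comp L0 LF cu (i := i).
  apply: cvgD; first exact: cvg_cst.
  have [_ AD] := AP _ cF; have [k1 k2] := k_in t; have [dA _] := AD _ k1 k2.
  apply: (@continuous_comp _ _ _ k (A _)); first exact: clamp_continuous (ltW d0) t.
  exact/differentiable_continuous/derivable1_diffP.
have step_contr (u v : I -> R -> R) (e : R) :
    (forall i, continuous (u i)) -> (forall i, continuous (v i)) ->
    (forall i t, `|u i t - v i t| <= e) ->
    forall i t, `|step u i t - step v i t| <= e / 2.
  move=> cu cv uv i t.
  have e0 : 0 <= e := le_trans (normr_ge0 _) (uv i t).
  have cFu := continuous_lipschitz_comp L0 LF cu (i := i).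
  have cFv := continuous_lipschitz_comp L0 LF cv (i := i).
  have [Au0 Au] := AP _ cFu; have [Av0 Av] := AP _ cFv.
  rewrite /step; set gu := (fun s => F (u ^~ s) i); set gv := (fun s => F (v ^~ s) i).
  have kd := clamp_norm t (ltW d0); rewrite -/(k t) in kd.
  have := @mean_value_bound R (fun s => A gu s - A gv s) (fun s => gu s - gv s)
    0 (k t) (L * e).
  rewrite Au0 Av0 !subr0 => H.
  have -> : c i + A gu (k t) - (c i + A gv (k t)) = A gu (k t) - A gv (k t) by ring.
  apply: le_trans (H _ _) _.
  - move=> z; rewrite subr0 => /le_trans /(_ kd); rewrite ler_norml => /andP[z1 z2].
    by apply: is_deriveB; [apply: Au|apply: Av]; lra.
  - by move=> z _; apply: LF => j; exact: uv.
  - apply: le_trans (ler_wpM2l (mulr_ge0 L0 e0) kd) _.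
    by rewrite mulrAC mulrC ler_wpM2l.
pose U := fun n => iter n step (fun i _ => c i).
have Ucont n i : continuous (U n i).
  by elim: n i => [|n IH] i; [move=> t; exact: cvg_cst|exact: step_cont].
have [C [C0 HC]] : exists C : R, 0 <= C /\ forall i t, `|U 1%N i t - U 0%N i t| <= C.
  exists (\sum_i `|F c i|); split; first exact: sumr_ge0.
  move=> i t; rewrite /U /= /step addrAC subrr add0r.
  have [A0 AD] := AP _ (continuous_lipschitz_comp L0 LF (Ucont 0%N) (i := i)).
  set g := (fun s => _) in A0 AD *.
  have kd := clamp_norm t (ltW d0); rewrite -/(k t) in kd.
  have := @mean_value_bound R (A g) g 0 (k t) `|F c i|; rewrite A0 !subr0 => H.
  apply: le_trans (H _ _) _.
  - move=> z; rewrite subr0 => /le_trans /(_ kd); rewrite ler_norml => /andP[z1 z2].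
    by apply: AD; lra.
  - by move=> z _; rewrite lexx.
  - apply: (@le_trans _ _ (`|F c i|)).
      by rewrite ler_piMr //; lra.
    by rewrite (bigD1 i) //= lerDl sumr_ge0.
have geo n i t : `|U n.+1 i t - U n i t| <= C / 2 ^+ n.
  elim: n i t => [|n IH] i t; first by rewrite expr0 divr1.
  rewrite exprSr invfM mulrA; exact: (step_contr (U n.+1) (U n) _ (Ucont _) (Ucont _) IH).
(* By [geo] the intervals of radius [2 * C / 2 ^+ n] about the iterates are nested; their common
   point is the limit. *)
have [u uP] : exists u : I -> R -> R, forall i t n, `|U n i t - u i t| <= 2 * C / 2 ^+ n.
  have H i t : exists l, forall n, `|U n i t - l| <= 2 * C / 2 ^+ n.
    have [|||l lP] := @nested_limit (fun n => U n i t - 2 * C / 2 ^+ n)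
       (fun n => U n i t + 2 * C / 2 ^+ n).
    - move=> n; have := geo n i t; rewrite ler_norml exprS invfM => /andP[g1 g2].
      by move: (2 ^+ n)^-1 g1 g2 => w; lra.
    - move=> n; have := geo n i t; rewrite ler_norml exprS invfM => /andP[g1 g2].
      by move: (2 ^+ n)^-1 g1 g2 => w; lra.
    - move=> n; have : 0 <= 2 * C / 2 ^+ n by rewrite !mulr_ge0 // invr_ge0 exprn_ge0.
      by lra.
    - by exists l => n; have /andP[l1 l2] := lP n; rewrite ler_norml; apply/andP; split; lra.
  have H2 i : exists v : R -> R, forall t n, `|U n i t - v t| <= 2 * C / 2 ^+ n.
    by have [v vP] := choice (H i); exists v.
  by have [v vP] := choice H2; exists v.
have C20 : 0 <= 2 * C by lra.
have ucont i : continuous (u i).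
  move=> t; apply/cvgrPdist_le => e e0.
  have e30 : 0 < e / 3 by rewrite divr_gt0.
  have [n Hn] := geometric_small C20 e30.
  have /cvgrPdist_le /(_ _ e30) := Ucont n i t; apply: filterS => s Hs.
  have H1 := le_trans (uP i t n) Hn; have H2 := le_trans (uP i s n) Hn.
  have -> : u i t - u i s = (U n i t - U n i s) - (U n i t - u i t) + (U n i s - u i s) by ring.
  apply: le_trans (ler_normD _ _) _; apply: le_trans (lerD (ler_normB _ _) (lexx _)) _.
  by lra.
(* The iterates tend to [u], and by the contraction estimate also to [step u]. *)
have ufix i t : u i t = step u i t.
  apply/eqP; rewrite -subr_eq0 -normr_eq0; apply/eqP/le_anti.
  rewrite normr_ge0 andbT; apply/ler_addgt0Pl => e e0; rewrite addr0.
  have C40 : 0 <= 2 * (2 * C) by lra.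
  have [n Hn] := geometric_small C40 e0.
  have H1 := uP i t n.+1.
  have H2 := step_contr _ _ _ (Ucont n) ucont (fun i t => uP i t n) i t.
  have -> : u i t - step u i t = (step (U n) i t - step u i t) - (U n.+1 i t - u i t).
    by rewrite /U iterS; ring.
  apply: le_trans (ler_normB _ _) _; apply: le_trans (lerD H2 H1) _; apply: le_trans Hn.
  rewrite exprS invfM.
  have : 0 <= (2 ^+ n)^-1 :> R by rewrite invr_ge0 exprn_ge0.
  move: (2 ^+ n)^-1 => w w0.
  by nra.
exists d, u; split=> // [i|t td i].
  rewrite ufix /step; have [A0 _] := AP _ (continuous_lipschitz_comp L0 LF ucont (i := i)).
  by rewrite /k clamp_id ?normr0 ?(ltW d0) // A0 addr0.
have [A0 AD] := AP _ (continuous_lipschitz_comp L0 LF ucont (i := i)).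
have : is_derive t 1 (fun s => c i + A (fun s => F (u ^~ s) i) s) (F (u ^~ t) i).
  have Ht : is_derive t 1 (A (fun s => F (u ^~ s) i)) (F (u ^~ t) i).
    by move: td; rewrite ltr_norml => /andP[t1 t2]; apply: AD; lra.
  have := @is_deriveD _ _ _ (cst (c i)) _ t 1 _ _ (is_derive_cst _ _ _) Ht.
  by rewrite add0r.
(* Near [t] the clamp of time is the identity, so [ufix] is the integral equation there. *)
apply: near_eq_is_derive.
have : \forall s \near t, `|s| < d.
  have : open [set s : R | `|s| < d].
    apply: (@open_comp _ _ (@Num.norm _ R) [set s | s < d]); last exact: open_lt.
    by move=> s _; exact: norm_continuous.
  by move=> o; exact: near_open o td _.
apply: filterS => s /ltW sd; rewrite [RHS]ufix /step /k clamp_id //.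
Qed.

(* Clamping the coordinates reduces to a globally Lipschitz field. *)
Lemma ode_exists F (c : I -> R) (r L : R) : 0 < r -> 0 <= L ->
  box_lipschitz F c r L ->
  exists (d : R) (u : I -> R -> R), [/\ 0 < d, forall i, u i 0 = c i &
    forall t : R, `|t| < d ->
      (forall i, `|u i t - c i| < r) /\
      forall i, is_derive t 1 (u i) (F (u ^~ t) i)].
Proof.
move=> r0 L0 LF; pose tr x := fun j => c j + clamp r (x j - c j).
have trE x : (forall i, `|x i - c i| <= r) -> tr x = x.
  by move=> xr; apply/funext => j; rewrite /tr clamp_id // addrC subrK.
have [|d [u [d0 cu u0 Hu]]] := @ode_exists_global (F \o tr) c L L0.
  move=> x y e xy i /=; apply: LF => j.
  - by rewrite /tr addrAC subrr add0r clamp_norm // ltW.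
  - by rewrite /tr addrAC subrr add0r clamp_norm // ltW.
  - rewrite /tr.
    have -> : c j + clamp r (x j - c j) - (c j + clamp r (y j - c j)) =
      clamp r (x j - c j) - clamp r (y j - c j) by ring.
    apply: le_trans (clamp_lipschitz _ _ (ltW r0)) _.
    by have -> : x j - c j - (y j - c j) = x j - y j by ring.
have H (i : I) : \forall s \near (0 : R), `|u i 0 - u i s| < r.
  by have /cvgrPdist_lt /(_ _ r0) := cu i 0.
have [d' /= d'0 d'P] :=
  (nbhs_ballP _ _).1 (@filter_forall _ _ _ _ (nbhs_filter (0 : R)) H).
(* Up to time [d'] the solution stays strictly inside the box, where the truncation [tr] is the
   identity. *)
exists (Num.min d d'), u; split=> [|//|t]; first by rewrite lt_min d0.
rewrite lt_min => /andP[td td'].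
have ur i : `|u i t - c i| < r.
  by rewrite distrC -u0; apply: d'P; rewrite -ball_normE /= sub0r normrN.
split=> // i; have := Hu _ td i; rewrite /= trE // => j; exact: ltW.
Qed.

(** For times within [e] of [t0], with [L * e <= 1/2], any uniform bound on the distance between the
    two solutions can be halved by the mean value theorem. Iterating makes the distance zero. *)
Lemma ode_unique F (c : I -> R) (r L t0 : R) (u v : I -> R -> R) :
  0 < r -> 0 <= L -> box_lipschitz F c r L ->
  (forall i, u i t0 = c i) -> (forall i, v i t0 = c i) ->
  (\forall t \near t0, forall i, is_derive t (1 : R) (u i) (F (u ^~ t) i)) ->
  (\forall t \near t0, forall i, is_derive t (1 : R) (v i) (F (v ^~ t) i)) ->
  \forall t \near t0, forall i, u i t = v i t.
Proof.
move=> r0 L0 LF u0 v0 Hu Hv.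
have small (w : I -> R -> R) (e : R) : 0 < e -> (forall i, w i t0 = c i) ->
    (\forall t \near t0, forall i, is_derive t (1 : R) (w i) (F (w ^~ t) i)) ->
    \forall t \near t0, forall i, `|w i t - c i| <= e.
  move=> e0 w0 Hw.
  have H (i : I) : \forall t \near t0, `|w i t0 - w i t| <= e.
    have [dw _] := nbhs_singleton Hw i.
    have /cvgrPdist_le /(_ _ e0) : {for t0, continuous (w i)}.
      exact/differentiable_continuous/derivable1_diffP.
    exact.
  have := @filter_forall _ _ _ _ (nbhs_filter t0) H; apply: filterS => t Ht i.
  by rewrite distrC -(w0 i); exact: Ht.
(* Both solutions stay within 1/2 of [c], so the halving starts from the bound 1. *)
have half0 : 0 < 1 / 2 :> R by lra.
have [d /= d0 dP] := (nbhs_ballP _ _).1 (filterI (filterI Hu Hv)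
  (filterI (filterI (small u r r0 u0 Hu) (small v r r0 v0 Hv))
           (filterI (small u _ half0 u0 Hu) (small v _ half0 v0 Hv)))).
pose e := Num.min d (2 * (L + 1))^-1.
have e0 : 0 < e by rewrite lt_min d0 invr_gt0; lra.
have eL : L * e <= 1 / 2.
  apply: (@le_trans _ _ (L * (2 * (L + 1))^-1)).
    by rewrite ler_wpM2l // ge_min lexx orbT.
  by rewrite ler_pdivrMr; lra.
have eP t : `|t - t0| < e -> ball t0 d t.
  by rewrite lt_min -ball_normE /= distrC => /andP[].
have geo k t : `|t - t0| < e -> forall i, `|u i t - v i t| <= 1 / 2 ^+ k.
  elim: k t => [|k IH] t te i.
    have [_ [_ [Hu1 Hv1]]] := dP _ (eP _ te); rewrite expr0 divr1.
    have -> : u i t - v i t = (u i t - c i) - (v i t - c i) by ring.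
    apply: le_trans (ler_normB _ _) _; apply: le_trans (lerD (Hu1 i) (Hv1 i)) _; lra.
  have := @mean_value_bound R (fun t => u i t - v i t)
    (fun t => F (u ^~ t) i - F (v ^~ t) i) t0 t (L * (1 / 2 ^+ k)).
  rewrite u0 v0 subrr subr0 => H; apply: le_trans (H _ _) _.
  - move=> z /le_lt_trans /(_ te) /eP /dP[[zu zv] _].
    exact: (@is_deriveB _ _ _ (u i) (v i) z 1 _ _ (zu i) (zv i)).
  - move=> z /le_lt_trans /(_ te) ze; have [_ [[zu zv] _]] := dP _ (eP _ ze).
    by apply: LF => //; exact: IH.
  - have w0 : 0 <= 1 / 2 ^+ k :> R by rewrite divr_ge0 // exprn_ge0.
    apply: (@le_trans _ _ (L * (1 / 2 ^+ k) * e)).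
      by rewrite ler_wpM2l ?mulr_ge0 // ltW.
    have -> : 1 / 2 ^+ k.+1 = 1 / 2 * (1 / 2 ^+ k) :> R.
      by rewrite !mul1r exprS invfM.
    by rewrite mulrAC ler_wpM2r.
apply/nbhs_ballP; exists e => //= t; rewrite -ball_normE /= distrC => te i.
apply/eqP; rewrite -subr_eq0 -normr_eq0; apply/eqP/le_anti.
rewrite normr_ge0 andbT; apply/ler_addgt0Pl => b b0; rewrite addr0.
have [k Hk] := geometric_small ler01 b0.
exact: le_trans (geo k _ te i) Hk.
Qed.

End ODE.

(** * Charts *)

Lemma mulmx_rows_eq (R : realType) m n (A B : 'M[R]_(m, n)) :
  (forall v : 'rV[R]_m, v *m A = v *m B) -> A = B.
Proof. by move=> AB; apply/row_matrixP => i; rewrite !rowE. Qed.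

(* Locked because [jac] unfolds to the choice operator behind ['d], which makes
   failing unification problems very expensive. *)
HB.lock Definition tjac (R : realType) (n : nat) (M : manifold R n)
  (i j : chart M) (x : M) : 'M[R]_n := jac i j x.

Lemma jac_tjac (R : realType) (n : nat) (M : manifold R n) (i j : chart M)
  (x : M) : jac i j x = tjac i j x.
Proof. by rewrite tjac.unlock. Qed.

(** In indices both sides are the sum of [v_a w_c H a b c]; [H] will be the second derivatives of a
    transition map. *)
Lemma symmetric_contraction (R : realType) n (v w : 'rV[R]_n) (A B : 'M[R]_n)
    (H : 'I_n -> 'I_n -> 'I_n -> R) :
  (forall a b, A a b = \sum_c w 0 c * H a b c) ->
  (forall a b, B a b = \sum_c v 0 c * H a b c) ->
  (forall a c b, H a b c = H c b a) -> v *m A = w *m B.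
Proof.
move=> HA HB Hsym; apply/rowP => b; rewrite !mxE.
under eq_bigr => a _ do rewrite HA mulr_sumr.
under [RHS]eq_bigr => a _ do rewrite HB mulr_sumr.
rewrite exchange_big /=; apply: eq_bigr => c _; apply: eq_bigr => a _.
by rewrite mulrCA Hsym.
Qed.

Section Charts.
Context {R : realType} {n : nat} {M : manifold R n}.
Implicit Types (i j k : chart M) (x : M) (U : set M) (X Y : vfield M).

Lemma image_domP i y : (phi i @` dom i) y -> dom i (psi i y) /\ phi i (psi i y) = y.
Proof. by move=> [x dx <-]; rewrite phiK. Qed.

Lemma image_cap i U : phi i @` (U `&` dom i) =
  [set y | (phi i @` dom i) y /\ U (psi i y)].
Proof.
apply/seteqP; split=> [_ [x [Ux dx] <-]|y [/image_domP[dy yE] Uy]].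
  by split; [exists x|rewrite /= phiK].
by exists (psi i y).
Qed.

Lemma near_psi i x (P : M -> Prop) : dom i x -> (\forall z \near x, P z) ->
  \forall y \near phi i x, P (psi i y).
Proof.
by move=> dx HP; have := psi_continuous dx; rewrite /prop_for /continuous_at phiK //; exact.
Qed.

Lemma near_phi i x (P : 'rV[R]_n -> Prop) : dom i x ->
  (\forall y \near phi i x, P y) -> \forall z \near x, P (phi i z).
Proof. by move=> dx HP; exact: (phi_continuous dx) HP. Qed.

Lemma near_dom i x : dom i x -> \forall z \near x, dom i z.
Proof. by move=> dx; exact: open_nbhs_nbhs (conj (dom_open i) dx). Qed.

Lemma near_image i x : dom i x -> \forall y \near phi i x, (phi i @` dom i) y.
Proof. by move=> dx; apply: open_nbhs_nbhs; split; [exact: phi_open|exists x]. Qed.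

Lemma open_image i U : open U -> open (phi i @` (U `&` dom i)).
Proof.
move=> oU; rewrite image_cap; rewrite openE => y [/image_domP[dy yE] Uy].
have H1 := near_image dy; have H2 := near_psi dy (open_nbhs_nbhs (conj oU Uy)).
rewrite yE in H1 H2; exact: filterS2 H1 H2 => z Hz1 Hz2.
Qed.

Lemma image_in i U x : U x -> dom i x -> (phi i @` (U `&` dom i)) (phi i x).
Proof. by move=> Ux dx; exists x. Qed.

Lemma open_overlap i j : open (phi i @` (dom i `&` dom j)).
Proof. by rewrite setIC; apply: open_image; exact: dom_open. Qed.

Lemma overlap_in i j x : dom i x -> dom j x ->
  (phi i @` (dom i `&` dom j)) (phi i x).
Proof. by move=> di dj; exists x. Qed.

Lemma transition_differentiable i j x : dom i x -> dom j x ->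
  differentiable (phi j \o psi i) (phi i x).
Proof.
move=> di dj; apply: (Ck_on_differentiable (k := 0)) (overlap_in di dj) _.
  exact: open_overlap.
exact: transition_smooth.
Qed.

Lemma jacE i j x (v : 'rV[R]_n) : dom i x -> dom j x ->
  v *m tjac i j x = 'D_v (phi j \o psi i) (phi i x).
Proof.
by move=> di dj; rewrite -jac_tjac deriveEjacobian //; exact: transition_differentiable.
Qed.

Lemma transition_comp i j k x : dom i x -> dom j x -> dom k x ->
  \forall y \near phi i x,
    ((phi k \o psi j) \o (phi j \o psi i)) y = (phi k \o psi i) y.
Proof.
move=> di dj dk; have := near_psi di (near_dom dj); apply: filterS => y /= dy.
by rewrite phiK.
Qed.

Lemma jac_comp i j k x : dom i x -> dom j x -> dom k x ->
  tjac i j x *m tjac j k x = tjac i k x.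
Proof.
move=> di dj dk; apply: mulmx_rows_eq => v.
rewrite mulmxA (jacE v di dj) (jacE _ dj dk) (jacE v di dk).
rewrite -(near_eq_derive _ (transition_comp di dj dk)) derive_comp /= ?phiK //.
  exact: transition_differentiable.
exact: transition_differentiable.
Qed.

Lemma jac_id i x : dom i x -> tjac i i x = 1%:M.
Proof.
move=> di; apply: mulmx_rows_eq => v; rewrite mulmx1 jacE //.
rewrite -[RHS](derive_id (phi i x) v); apply: near_eq_derive.
have := near_image di; apply: filterS => y; by case/image_domP.
Qed.

Lemma jac_inv i j x : dom i x -> dom j x -> tjac i j x *m tjac j i x = 1%:M.
Proof. by move=> di dj; rewrite jac_comp // jac_id. Qed.

Lemma vlocE i X x : dom i x -> vloc i X (phi i x) = X x *m tjac (chart_at x) i x.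
Proof. by move=> di; rewrite /vloc /tcomp phiK // jac_tjac. Qed.

Lemma vloc_trans i j X x : dom i x -> dom j x ->
  vloc j X (phi j x) = vloc i X (phi i x) *m tjac i j x.
Proof.
move=> di dj; rewrite !vlocE // -mulmxA jac_comp //; exact: dom_chart_at.
Qed.

Lemma smooth_jacobian i j :
  smooth_on (phi i @` (dom i `&` dom j)) (jacobian (phi j \o psi i)).
Proof.
move=> k; apply/Ck_on_mxP; first exact: open_overlap.
move=> a b.
have Hs := transition_smooth i j k.+1.
have /(Ck_on_mxP _ _ (@open_overlap i j)) /(_ 0 b)[_ /(_ a)[_]] := Hs.
apply: Ck_on_eq; first exact: open_overlap.
move=> y Vy; rewrite jacobianE //.
exact: Ck_on_differentiable (@open_overlap i j) Vy Hs.
Qed.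

Lemma vloc_differentiable i U X x : open U -> smooth_vfield U X -> U x -> dom i x ->
  differentiable (vloc i X) (phi i x).
Proof.
move=> oU sX Ux dx.
exact: Ck_on_differentiable (@open_image i U oU) (image_in Ux dx) (sX i 1%N).
Qed.

Lemma dirderiv_chart i X (f : M -> R) x : dom i x ->
  differentiable (f \o psi i) (phi i x) ->
  dirderiv X f x = 'D_(vloc i X (phi i x)) (f \o psi i) (phi i x).
Proof.
move=> di df; rewrite /dirderiv; set j := chart_at x.
have dj : dom j x := dom_chart_at x.
have H : \forall y \near phi j x,
    ((f \o psi i) \o (phi i \o psi j)) y = (f \o psi j) y.
  by have := near_psi dj (near_dom di); apply: filterS => y /= dy; rewrite phiK.
apply: (etrans (esym (near_eq_derive _ H))).
have pE : (phi i \o psi j) (phi j x) = phi i x by rewrite /= phiK.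
rewrite -pE in df *.
rewrite (derive_comp _ (transition_differentiable dj di) df) -(jacE _ dj di) pE.
by rewrite (vlocE _ di).
Qed.

(** Symmetry of the second derivatives of a transition map, in the form in which they enter the
    change of chart of a bracket. *)
Lemma jacobian_schwarz i j x (v w : 'rV[R]_n) : dom i x -> dom j x ->
  v *m 'D_w (jacobian (phi j \o psi i)) (phi i x) =
  w *m 'D_v (jacobian (phi j \o psi i)) (phi i x).
Proof.
move=> di dj; set J := jacobian _; set y := phi i x.
have oV := @open_overlap i j; have Vy := overlap_in di dj.
have dJ : differentiable J y.
  exact: Ck_on_differentiable oV Vy (@smooth_jacobian i j 1%N).
have DJ u a b : ('D_u J y) a b = \sum_c u 0 c *
    'D_(delta_mx 0 c) ('D_(delta_mx 0 a) (fun z => (phi j \o psi i) z 0 b)) y.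
  rewrite derive_coord_sum // summxE; apply: eq_bigr => c _.
  rewrite mxE; congr (_ * _); rewrite derive_mxE; last exact: diff_derivable.
  apply: near_eq_derive; apply: (near_open oV Vy) => z Vz; rewrite /J jacobianE //.
  exact: Ck_on_differentiable oV Vz (transition_smooth i j 1%N).
apply: (symmetric_contraction (DJ w) (DJ v)) => a c b.
apply: (schwarz _ _ oV Vy).
by have /(Ck_on_mxP _ _ oV) := transition_smooth i j 2%N; exact.
Qed.

Lemma vloc_trans_near i j X x : dom i x -> dom j x ->
  \forall y \near phi i x,
    vloc j X ((phi j \o psi i) y) = vloc i X y *m jacobian (phi j \o psi i) y.
Proof.
move=> di dj.
have H1 := near_psi di (near_dom dj); have H2 := near_image di.
apply: filterS2 H1 H2 => y dy /image_domP[dy' yE] /=.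
by rewrite (vloc_trans _ dy' dy) yE -jac_tjac /jac yE.
Qed.

(** Differentiating the transformation law of a vector field produces a term in the second
    derivatives of the transition map; the two such terms cancel in the bracket by
    [jacobian_schwarz]. *)
Lemma bracket_chart i U X Y x : open U -> smooth_vfield U X -> smooth_vfield U Y ->
  U x -> dom i x ->
  bracket X Y x *m tjac (chart_at x) i x =
  'D_(vloc i X (phi i x)) (vloc i Y) (phi i x) -
  'D_(vloc i Y (phi i x)) (vloc i X) (phi i x).
Proof.
move=> oU sX sY Ux di; rewrite /bracket; set j := chart_at x.
have dj : dom j x := dom_chart_at x.
have Xx Z : Z x = vloc j Z (phi j x) by rewrite vlocE // jac_id // mulmx1.
have step Z (v : 'rV[R]_n) : smooth_vfield U Z ->
    'D_v (vloc j Z) (phi j x) *m tjac j i x +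
      vloc j Z (phi j x) *m 'D_v (jacobian (phi i \o psi j)) (phi j x) =
    'D_(v *m tjac j i x) (vloc i Z) (phi i x).
  move=> sZ.
  have dZ := vloc_differentiable oU sZ Ux dj.
  have dJ : differentiable (jacobian (phi i \o psi j)) (phi j x).
    exact: Ck_on_differentiable (@open_overlap j i) (overlap_in dj di) (@smooth_jacobian j i 1%N).
  have H1 := is_derive_mulmx (derivableP (diff_derivable (v := v) dZ))
    (derivableP (diff_derivable (v := v) dJ)).
  have [_ E1] := H1; have tE := jacE v dj di.
  rewrite tE -jac_tjac; apply: (etrans (esym E1)).
  apply: (etrans (esym (near_eq_derive _ (vloc_trans_near Z dj di)))).
  have dZi := vloc_differentiable oU sZ Ux di.
  have pE : (phi i \o psi j) (phi j x) = phi i x by rewrite /= phiK.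
  rewrite -pE in dZi *.
  exact: (derive_comp v (transition_differentiable dj di) dZi).
have combine (A B P Q P' Q' : 'rV[R]_n) (J : 'M[R]_n) :
    A *m J + P = P' -> B *m J + Q = Q' -> P = Q -> (A - B) *m J = P' - Q'.
  by move=> <- <- ->; rewrite mulmxBl opprD addrACA subrr addr0.
have SX := step Y (X x) sY; have SY := step X (Y x) sX.
have EX : vloc i X (phi i x) = X x *m tjac j i x.
  by rewrite (vloc_trans X dj di) -(Xx X).
have EY : vloc i Y (phi i x) = Y x *m tjac j i x.
  by rewrite (vloc_trans Y dj di) -(Xx Y).
rewrite EX EY; apply: (combine _ _ _ _ _ _ _ SX SY).
have JS := jacobian_schwarz (Y x) (X x) dj di.
by rewrite (Xx X) (Xx Y) in JS *; exact: JS.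
Qed.

(** Produces vector fields from components in a single chart; needed for the vertical part of an
    adapted frame. *)
Lemma smooth_vfield_of_chart i U (w : 'rV[R]_n -> 'rV[R]_n) : open U ->
  U `<=` dom i -> smooth_on (phi i @` U) w ->
  smooth_vfield U (fun x => w (phi i x) *m tjac i (chart_at x) x).
Proof.
move=> oU Ui sw j k.
have oV := @open_image j U oU.
have tV y : (phi j @` (U `&` dom j)) y -> (phi i @` U) ((phi i \o psi j) y).
  by move=> [x [Ux dx] <-] /=; rewrite phiK //; exists x.
have oW : open (phi i @` U) by have := @open_image i U oU; rewrite setIidl.
have Ct : Ck_on k (phi j @` (U `&` dom j)) (phi i \o psi j).
  apply: Ck_on_sub (transition_smooth j i k) => _ [x [Ux dx] <-].
  by exists x => //; split=> //; exact: Ui.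
have Cw : Ck_on k (phi j @` (U `&` dom j)) (w \o (phi i \o psi j)).
  apply/Ck_on_mxP => // a b.
  apply: (@Ck_on_comp _ _ _ _ _ _ (fun z => w z a b) _ oW oV tV) => //.
  by have /(Ck_on_mxP _ _ oW) := sw k; exact.
have CJ : Ck_on k (phi j @` (U `&` dom j))
    (jacobian (phi j \o psi i) \o (phi i \o psi j)).
  apply/Ck_on_mxP => // a b.
  apply: (@Ck_on_comp _ _ _ _ (phi i @` (dom i `&` dom j)) _
    (fun z => jacobian (phi j \o psi i) z a b) _ (@open_overlap i j) oV) => //.
    move=> _ [x [Ux dx] <-] /=; rewrite phiK //; apply: overlap_in => //; exact: Ui.
  by have /(Ck_on_mxP _ _ (@open_overlap i j)) := @smooth_jacobian i j k; exact.
apply: (Ck_on_eq oV _ (Ck_on_mulmx oV Cw CJ)) => _ [x [Ux dx] <-].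
have di := Ui _ Ux; rewrite (vlocE _ dx) -mulmxA (jac_comp di (dom_chart_at x) dx).
rewrite -jac_tjac /jac.
have -> : (w \o (phi i \o psi j)) (phi j x) = w (phi i x) by rewrite /= phiK.
by have -> : (jacobian (phi j \o psi i) \o (phi i \o psi j)) (phi j x) =
  jacobian (phi j \o psi i) (phi i x) by rewrite /= phiK.
Qed.

End Charts.

(** * The metric, adapted frames, and matrix calculus *)

Lemma mx11_eqP (R : realType) (A B : 'M[R]_1) : A 0 0 = B 0 0 -> A = B.
Proof. by move=> AB; apply/matrixP => i j; rewrite !ord1. Qed.

Lemma mulmx_cols_eq (R : realType) m n (A B : 'M[R]_(m, n)) :
  (forall v : 'cV[R]_n, A *m v = B *m v) -> A = B.
Proof.
move=> AB; apply: trmx_inj; apply: mulmx_rows_eq => v; apply: trmx_inj.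
by rewrite !trmx_mul !trmxK.
Qed.

Lemma mx_bilin_eq (R : realType) n (A B : 'M[R]_n) :
  (forall p r : 'cV[R]_n, (p^T *m A *m r) 0 0 = (p^T *m B *m r) 0 0) -> A = B.
Proof.
move=> AB; apply: mulmx_rows_eq => v; apply: mulmx_cols_eq => r.
by apply: mx11_eqP; have := AB v^T r; rewrite trmxK.
Qed.

Section Metric.
Context {R : realType} {m q : nat} {M : manifold R (m + q)}.
Context {S : subRiemannian M} {g : M -> 'M[R]_(m + q)}.
Hypothesis g_riemannian : riemannian g.
Hypothesis g_restricts : restricts_to g S.
Implicit Types (x : M) (u v w : 'rV[R]_(m + q)) (p nu : 'cV[R]_(m + q)).

Local Notation D := (sr_D S).
Local Notation Dp := (perp g (sr_D S)).
Local Notation h := (sr_h S).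

Lemma g_sym x : (g x)^T = g x. Proof. by case: g_riemannian. Qed.

Lemma inner_gt0 x v : v != 0 -> 0 < inner g x v v.
Proof. by case: g_riemannian => _ _; exact. Qed.

Lemma inner_eq0 x v : inner g x v v = 0 -> v = 0.
Proof. by move=> gv; apply/eqP/negPn/negP => /(inner_gt0 x); rewrite gv ltxx. Qed.

Lemma g_unit x : g x \in unitmx.
Proof.
rewrite -row_free_unit -kermx_eq0; apply/eqP; apply/row_matrixP => i; rewrite row0.
apply: (@inner_eq0 x); rewrite /inner -row_mul mulmx_ker row0 mul0mx mxE //.
Qed.

(** The matrix form of [restricts_to]. It makes [h] a generalised inverse of [g] along the
    distribution, so that membership in [D] or [Dp] becomes a matrix equation. *)
Lemma hgh x : h x *m g x *m h x = h x.
Proof.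
apply: mx_bilin_eq => p r; have := g_restricts x p r; rewrite /inner /sharp.
by rewrite trmx_mul trmxK (sr_h_sym S) !mulmxA.
Qed.

Lemma D_sub_h x : (D x <= h x)%MS. Proof. by case/andP: (sr_h_image S x). Qed.

Lemma h_sub_D x : (h x <= D x)%MS. Proof. by case/andP: (sr_h_image S x). Qed.

Lemma D_proj x v : (v <= D x)%MS -> v *m g x *m h x = v.
Proof.
move=> vD; have /submxP[w ->] := submx_trans vD (D_sub_h x).
by rewrite -!mulmxA [h x *m _]mulmxA hgh.
Qed.

Lemma sharp_in_D x p : (sharp S x p <= D x)%MS.
Proof. exact: submx_trans (submxMl _ _) (h_sub_D x). Qed.

Lemma perpP x v : (v <= Dp x)%MS -> v *m g x *m h x = 0.
Proof.
rewrite /perp => /sub_kermxP; rewrite mulmxA => vgD.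
have /submxP[K hK] := h_sub_D x.
by rewrite -(sr_h_sym S x) hK trmx_mul mulmxA vgD mul0mx.
Qed.

Lemma perp_of v x : v *m g x *m h x = 0 -> (v <= Dp x)%MS.
Proof.
move=> vgh; apply/sub_kermxP; rewrite mulmxA.
have /submxP[K DK] := D_sub_h x.
by rewrite DK trmx_mul (sr_h_sym S) mulmxA vgh mul0mx.
Qed.

Lemma annihilP x nu : D x *m nu = 0 -> h x *m nu = 0.
Proof. by move=> Dnu; have /submxP[K ->] := h_sub_D x; rewrite -mulmxA Dnu mulmx0. Qed.

Lemma annihil_of x nu : h x *m nu = 0 -> D x *m nu = 0.
Proof. by move=> hnu; have /submxP[K ->] := D_sub_h x; rewrite -mulmxA hnu mulmx0. Qed.

Lemma D_annihil x v nu : (v <= D x)%MS -> D x *m nu = 0 -> v *m nu = 0.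
Proof. by move=> /submxP[w ->] Dnu; rewrite -mulmxA Dnu mulmx0. Qed.

Lemma D_perp_orth x v w : (v <= D x)%MS -> (w <= Dp x)%MS -> v *m g x *m w^T = 0.
Proof.
move=> vD /perpP wgh; have /submxP[a ->] := submx_trans vD (D_sub_h x).
apply: trmx_inj; rewrite !trmx_mul trmxK g_sym (sr_h_sym S) trmx0.
by rewrite !mulmxA wgh mul0mx.
Qed.

Lemma D_perp_eq0 x v : (v <= D x)%MS -> (v <= Dp x)%MS -> v = 0.
Proof. by move=> vD vp; apply: (@inner_eq0 x); rewrite /inner D_perp_orth // mxE. Qed.

(* Orthogonal projection onto the distribution is [v |-> v *m g x *m h x]. *)
Lemma D_perp_decomp x v : exists v1 v2,
  [/\ v = v1 + v2, (v1 <= D x)%MS & (v2 <= Dp x)%MS].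
Proof.
exists (v *m g x *m h x), (v - v *m g x *m h x); split.
- by rewrite addrC subrK.
- exact: submx_trans (submxMl _ _) (h_sub_D x).
- apply: perp_of; rewrite !mulmxBl; apply/eqP; rewrite subr_eq0; apply/eqP.
  by rewrite -!mulmxA; congr (_ *m (_ *m _)); rewrite !mulmxA hgh.
Qed.

Lemma proj_D_eq0 x v : v *m proj_mx (D x) (Dp x) = 0 -> (v <= Dp x)%MS.
Proof.
have DDp : (D x :&: Dp x)%MS = 0.
  apply/eqP; rewrite -submx0; apply/rV_subP => w; rewrite sub_capmx => /andP[wD wp].
  by rewrite (D_perp_eq0 wD wp) sub0mx.
have [v1 [v2 [-> v1D v2p]]] := D_perp_decomp x v.
by rewrite mulmxDl (proj_mx_id DDp v1D) (proj_mx_0 DDp v2p) addr0 => ->; rewrite add0r.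
Qed.

Definition momentum x u nu : 'cV[R]_(m + q) := g x *m u^T + nu.

Lemma sharp_momentum x u nu : (u <= D x)%MS -> D x *m nu = 0 ->
  sharp S x (momentum x u nu) = u.
Proof.
move=> uD /annihilP hnu; rewrite /sharp /momentum linearD /= mulmxDl trmx_mul trmxK.
rewrite g_sym D_proj // -[nu^T *m _]trmxK trmx_mul trmxK (sr_h_sym S) hnu.
by rewrite trmx0 addr0.
Qed.

(** Any covector [p] is thus the momentum of its image under [h] and of this remainder; together
    with [sharp_momentum], covectors correspond to pairs [(u, nu)]. *)
Lemma momentum_sharp x p : D x *m (p - g x *m (sharp S x p)^T) = 0.
Proof.
apply: annihil_of; rewrite mulmxBr /sharp trmx_mul trmxK (sr_h_sym S).
by rewrite !mulmxA hgh subrr.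
Qed.

Lemma gsharp_momentum x u nu : gsharp g x (momentum x u nu) = u + gsharp g x nu.
Proof.
rewrite /gsharp /momentum linearD /= mulmxDl trmx_mul trmxK g_sym.
by rewrite mulmxK ?g_unit.
Qed.

Lemma gsharpK x p : gsharp g x p *m g x = p^T.
Proof. by rewrite /gsharp mulmxKV ?g_unit. Qed.

Lemma gsharp_perp x nu : D x *m nu = 0 -> (gsharp g x nu <= Dp x)%MS.
Proof.
move=> Dnu; apply/sub_kermxP; rewrite mulmxA gsharpK -trmx_mul.
by rewrite Dnu trmx0.
Qed.

End Metric.
Arguments momentum {R m q M} g x u nu.

Section Frame.
Context {R : realType} {m q : nat} {M : manifold R (m + q)}.
Context {S : subRiemannian M} {g : M -> 'M[R]_(m + q)}.
Hypothesis g_riemannian : riemannian g.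
Hypothesis g_restricts : restricts_to g S.
Context {U : set M} {E : 'I_(m + q) -> vfield M}.
Hypothesis E_adapted : adapted_frame S g U E.
Context {x : M}.
Hypothesis Ux : U x.

Local Notation D := (sr_D S).
Local Notation Dp := (perp g (sr_D S)).
Local Notation fr := (frame_mx E x).

Lemma frame_unit : fr \in unitmx.
Proof. by case: E_adapted => _ _ _; exact. Qed.

Lemma frame_row A : row A fr = E A x.
Proof. by rewrite rowK. Qed.

Lemma frame_hor i : (E (lshift q i) x <= D x)%MS.
Proof. by case: E_adapted => _ /(_ i)[_ HD] _ _; exact: HD. Qed.

Lemma frame_ver a : (E (rshift m a) x <= Dp x)%MS.
Proof. by case: E_adapted => _ _ /(_ a)[_ HD] _; exact: HD. Qed.

Lemma coordK (v : 'rV[R]_(m + q)) : v *m invmx fr *m fr = v.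
Proof. by rewrite mulmxKV ?frame_unit. Qed.

Lemma frame_split (b : 'rV[R]_(m + q)) : b *m fr =
  \sum_i b 0 (lshift q i) *: E (lshift q i) x +
  \sum_a b 0 (rshift m a) *: E (rshift m a) x.
Proof.
rewrite mulmx_sum_row big_split_ord /=.
by congr (_ + _); apply: eq_bigr => A _; rewrite frame_row.
Qed.

Lemma sum_hor (b : 'I_m -> R) : ((\sum_i b i *: E (lshift q i) x)%R <= D x)%MS.
Proof. by apply: summx_sub => i _; apply: scalemx_sub; exact: frame_hor. Qed.

Lemma sum_ver (b : 'I_q -> R) : ((\sum_a b a *: E (rshift m a) x)%R <= Dp x)%MS.
Proof. by apply: summx_sub => i _; apply: scalemx_sub; exact: frame_ver. Qed.

Lemma frame_inj (b : 'rV[R]_(m + q)) : b *m fr = 0 -> b = 0.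
Proof. by move=> bf; rewrite -(mulmxK frame_unit b) bf mul0mx. Qed.

(** The vertical part [w] of [v] lies in [Dp], and in [D] as the difference of [v] and its
    horizontal part; hence it is zero, and so are its coefficients. *)
Lemma coord_hor (v : 'rV[R]_(m + q)) a : (v <= D x)%MS ->
  fcoord E x v (rshift m a) = 0.
Proof.
move=> vD; rewrite /fcoord; set b := v *m invmx fr.
have bv : b *m fr = v := coordK v.
set w := \sum_a b 0 (rshift m a) *: E (rshift m a) x.
have w0 : w = 0.
  have H := D_perp_eq0 g_riemannian (x := x) (v := w).
  apply: H; last exact: sum_ver.
  have -> : w = v - \sum_i b 0 (lshift q i) *: E (lshift q i) x.
    by rewrite -bv frame_split addrAC subrr add0r.
  by rewrite addmx_sub // -scaleN1r ?scalemx_sub // sum_hor.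
have /frame_inj /rowP/(_ (rshift m a)) : row_mx 0 (rsubmx b) *m fr = 0.
  rewrite frame_split big1 ?add0r => [|i _]; last by rewrite row_mxEl mxE scale0r.
  by rewrite -[RHS]w0; apply: eq_bigr => a' _; rewrite row_mxEr mxE.
by rewrite row_mxEr !mxE.
Qed.

Lemma coord_ver (v : 'rV[R]_(m + q)) i : (v <= Dp x)%MS ->
  fcoord E x v (lshift q i) = 0.
Proof.
move=> vD; rewrite /fcoord; set b := v *m invmx fr.
have bv : b *m fr = v := coordK v.
set w := \sum_i b 0 (lshift q i) *: E (lshift q i) x.
have w0 : w = 0.
  have H := D_perp_eq0 g_riemannian (x := x) (v := w).
  apply: H; first exact: sum_hor.
  have -> : w = v - \sum_a b 0 (rshift m a) *: E (rshift m a) x.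
    by rewrite -bv frame_split addrK.
  by rewrite addmx_sub // -scaleN1r ?scalemx_sub // sum_ver.
have /frame_inj /rowP/(_ (lshift q i)) : row_mx (lsubmx b) 0 *m fr = 0.
  rewrite frame_split [X in _ + X]big1 ?addr0 => [|a _]; last by rewrite row_mxEr mxE scale0r.
  by rewrite -[RHS]w0; apply: eq_bigr => a' _; rewrite row_mxEl mxE.
by rewrite row_mxEl !mxE.
Qed.

Lemma coord_sum (v : 'rV[R]_(m + q)) : v = \sum_A fcoord E x v A *: E A x.
Proof.
rewrite -{1}(coordK v) mulmx_sum_row; apply: eq_bigr => A _.
by rewrite frame_row.
Qed.

End Frame.

(** * Continuity and derivatives of matrix-valued functions *)

Lemma continuous_sumr (R : realType) (T : topologicalType) (I : Type) (s : seq I)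
    (f : I -> T -> R) (x : T) : (forall i, {for x, continuous (f i)}) ->
  {for x, continuous (fun z => \sum_(i <- s) f i z)}.
Proof.
move=> cf; elim: s => [|i s IH].
  have -> : (fun z => \sum_(i <- [::]) f i z) = (fun=> 0).
    by apply/funext => z; rewrite big_nil.
  exact: cst_continuous.
have -> : (fun z => \sum_(j <- i :: s) f j z) = (fun z => f i z + \sum_(j <- s) f j z).
  by apply/funext => z; rewrite big_cons.
by apply: cvgD; [exact: cf|exact: IH].
Qed.

Lemma continuous_prodr (R : realType) (T : topologicalType) (I : Type) (s : seq I)
    (f : I -> T -> R) (x : T) : (forall i, {for x, continuous (f i)}) ->
  {for x, continuous (fun z => \prod_(i <- s) f i z)}.
Proof.
move=> cf; elim: s => [|i s IH].
  have -> : (fun z => \prod_(i <- [::]) f i z) = (fun=> 1).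
    by apply/funext => z; rewrite big_nil.
  exact: cst_continuous.
have -> : (fun z => \prod_(j <- i :: s) f j z) = (fun z => f i z * \prod_(j <- s) f j z).
  by apply/funext => z; rewrite big_cons.
by apply: cvgM; [exact: cf|exact: IH].
Qed.

Lemma continuous_det (R : realType) (T : topologicalType) n (A : T -> 'M[R]_n) (x : T) :
  {for x, continuous A} -> {for x, continuous (fun z => \det (A z))}.
Proof.
move=> /continuous_mxP cA; rewrite /determinant; apply: continuous_sumr => s.
apply: cvgM; first exact: cst_continuous.
by apply: continuous_prodr => i; exact: cA.
Qed.

Lemma near_unitmx (R : realType) (T : topologicalType) n (A : T -> 'M[R]_n) (x : T) :
  {for x, continuous A} -> A x \in unitmx -> \forall z \near x, A z \in unitmx.
Proof.
move=> /continuous_det cA Ax.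
have : \forall z \near x, \det (A z) != 0.
  apply: (cA [set r | r != 0]); apply: open_nbhs_nbhs; split; first exact: open_neq.
  by rewrite /= -unitfE -unitmxE.
by apply: filterS => z; rewrite unitmxE unitfE.
Qed.

Lemma derivable_continuous (R : realType) (W : normedModType R) (F : R -> W) (t : R) :
  derivable F t 1 -> {for t, continuous F}.
Proof. by move=> dF; exact/differentiable_continuous/derivable1_diffP. Qed.

Section DerivableMatrix.
Context {R : realType} {V : normedModType R}.

Lemma derivable_sumr (I : Type) (s : seq I) (f : I -> V -> R) x v :
  (forall i, derivable (f i) x v) -> derivable (fun z => \sum_(i <- s) f i z) x v.
Proof.
by move=> df; have [] := is_derive_sumr s (fun i => derivableP (df i)).
Qed.

Lemma derivable_prodr (I : Type) (s : seq I) (f : I -> V -> R) x v :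
  (forall i, derivable (f i) x v) -> derivable (fun z => \prod_(i <- s) f i z) x v.
Proof.
move=> df; elim: s => [|i s IH].
  have -> : (fun z => \prod_(i <- [::]) f i z) = cst 1.
    by apply/funext => z; rewrite big_nil.
  exact: derivable_cst.
have -> : (fun z => \prod_(j <- i :: s) f j z) = (fun z => f i z * \prod_(j <- s) f j z).
  by apply/funext => z; rewrite big_cons.
exact: derivableM.
Qed.

Lemma derivable_det n (A : V -> 'M[R]_n) x v : derivable A x v ->
  derivable (fun z => \det (A z)) x v.
Proof.
move=> /derivable_mxP dA; rewrite /determinant; apply: derivable_sumr => s.
apply: derivableM; first exact: derivable_cst.
by apply: derivable_prodr => i; exact: dA.
Qed.

Lemma derivable_adj n (A : V -> 'M[R]_n) x v : derivable A x v ->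
  derivable (fun z => \adj (A z)) x v.
Proof.
move=> /derivable_mxP dA; apply/derivable_mxP => i j.
have -> : (fun z => (\adj (A z)) i j) =
    (fun z => (-1) ^+ (j + i) * \det (row' j (col' i (A z)))).
  by apply/funext => z; rewrite mxE.
apply: derivableM; first exact: derivable_cst.
apply: derivable_det; apply/derivable_mxP => a b.
have -> : (fun z => row' j (col' i (A z)) a b) = (fun z => A z (lift j a) (lift i b)).
  by apply/funext => z; rewrite !mxE.
exact: dA.
Qed.

(** [invmx] is defined by cases, but invertibility persists near [x], where the inverse is given by
    the adjugate formula. *)
Lemma derivable_invmx n (A : V -> 'M[R]_n) x v : derivable A x v ->
  {for x, continuous A} -> A x \in unitmx ->
  derivable (fun z => invmx (A z)) x v.
Proof.
move=> dA cA Ax.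
have : derivable (fun z => (\det (A z))^-1 *: \adj (A z)) x v.
  apply/derivable_mxP => i j.
  have -> : (fun z => ((\det (A z))^-1 *: \adj (A z)) i j) =
      (fun z => (\det (A z))^-1 * (\adj (A z)) i j).
    by apply/funext => z; rewrite mxE.
  apply: derivableM.
    apply: derivableV; last exact: derivable_det.
    by rewrite -unitfE -unitmxE.
  by have /derivable_mxP := derivable_adj dA; exact.
apply: near_eq_derivable; have := near_unitmx cA Ax; apply: filterS => z Az.
by rewrite /invmx Az.
Qed.

Lemma derivable_mulmx m n p (F : V -> 'M[R]_(m, n)) (G : V -> 'M[R]_(n, p)) x v :
  derivable F x v -> derivable G x v -> derivable (fun z => F z *m G z) x v.
Proof.
by move=> dF dG; have [] := is_derive_mulmx (derivableP dF) (derivableP dG).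
Qed.

Lemma derivable_trmx m n (F : V -> 'M[R]_(m, n)) x v :
  derivable F x v -> derivable (fun z => (F z)^T) x v.
Proof. by move=> dF; have [] := is_derive_trmx (derivableP dF). Qed.

(* [r *m gl *m r^T] with [r = xi^T *m hl - b *m e] vanishes to second order
   at [x], so the coefficients of [xi^T *m hl] in the frame [e] need not be
   differentiated. *)
Lemma envelope n k (hl gl : V -> 'M[R]_n) (e : V -> 'M[R]_(k, n))
    (xi : 'cV[R]_n) (b : 'rV[R]_k) x v (dh de : _) (dG : 'M[R]_k) :
  is_derive x v hl dh -> derivable gl x v -> is_derive x v e de ->
  is_derive x v (fun z => e z *m gl z *m (e z)^T) dG ->
  (\forall z \near x, [/\ (hl z)^T = hl z, (gl z)^T = gl z,
     hl z *m gl z *m hl z = hl z & b *m e z *m gl z *m hl z = b *m e z]) ->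
  xi^T *m hl x = b *m e x ->
  xi^T *m dh *m xi = b *m de *m xi *+ 2 - b *m dG *m b^T.
Proof.
move=> Hh Hg He HG Hnear Hx.
pose r z := xi^T *m hl z - b *m e z.
have cst (m1 m2 : nat) (A : 'M[R]_(m1, m2)) : is_derive x v (fun=> A) 0 by exact: is_derive_cst.
have Hl (m1 m2 m3 : nat) (A : 'M[R]_(m1, m2)) (F : V -> 'M[R]_(m2, m3)) dF :
    is_derive x v F dF -> is_derive x v (fun z => A *m F z) (A *m dF).
  by move=> HF; have := is_derive_mulmx (cst _ _ A) HF; rewrite mul0mx add0r.
have Hr (m1 m2 m3 : nat) (A : 'M[R]_(m2, m3)) (F : V -> 'M[R]_(m1, m2)) dF :
    is_derive x v F dF -> is_derive x v (fun z => F z *m A) (dF *m A).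
  by move=> HF; have := is_derive_mulmx HF (cst _ _ A); rewrite mulmx0 addr0.
have rx : r x = 0 by rewrite /r Hx subrr.
have dr : is_derive x v r (xi^T *m dh - b *m de).
  by apply: is_deriveB; exact: Hl.
(* Every term of the product rule contains the factor [r x = 0]. *)
have H1 : is_derive x v (fun z => r z *m gl z *m (r z)^T) 0.
  have := is_derive_mulmx (is_derive_mulmx dr (derivableP Hg)) (is_derive_trmx dr).
  by rewrite rx trmx0 mulmx0 !mul0mx addr0.
(* The same quadratic form once expanded; [H3] simplifies its terms by the projection identities of
   [Hnear]. *)
have H2 : is_derive x v (fun z => xi^T *m hl z *m xi - b *m e z *m xi *+ 2 +
    b *m (e z *m gl z *m (e z)^T) *m b^T)
   (xi^T *m dh *m xi - b *m de *m xi *+ 2 + b *m dG *m b^T).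
  have Ha := Hr _ _ _ xi _ _ (Hl _ _ _ xi^T _ _ Hh).
  have Hb := Hr _ _ _ xi _ _ (Hl _ _ _ b _ _ He).
  have Hc := Hr _ _ _ b^T _ _ (Hl _ _ _ b _ _ HG).
  exact: (is_deriveD (is_deriveB Ha (is_deriveD Hb Hb)) Hc).
have H3 : \forall z \near x, r z *m gl z *m (r z)^T =
    xi^T *m hl z *m xi - b *m e z *m xi *+ 2 + b *m (e z *m gl z *m (e z)^T) *m b^T.
  apply: filterS Hnear => z [hT gT hghE bE].
  have T11 (A : 'M[R]_1) : A^T = A by apply/matrixP => i j; rewrite !ord1 mxE.
  have E1 : xi^T *m hl z *m gl z *m (xi^T *m hl z)^T = xi^T *m hl z *m xi.
    by rewrite -[in RHS]hghE trmx_mul trmxK hT !mulmxA.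
  have E2 : b *m e z *m gl z *m (xi^T *m hl z)^T = b *m e z *m xi.
    by rewrite trmx_mul trmxK hT mulmxA bE.
  have E3 : xi^T *m hl z *m gl z *m (b *m e z)^T = b *m e z *m xi.
    by rewrite -E2 -[RHS]T11 !trmx_mul !trmxK gT !mulmxA.
  rewrite /r !mulmxBl linearB /= !mulmxBr E1 E2 E3 [(b *m e z)^T]trmx_mul !mulmxA.
  by rewrite mulr2n !opprD opprK !addrA.
have [_ D1] := near_eq_is_derive H3 H1; have [_ D2] := H2.
have E := etrans (esym D2) D1.
by apply/eqP; rewrite -subr_eq0 opprB addrA addrAC E.
Qed.

End DerivableMatrix.

(** * The equations in an adapted frame *)

(** This and the next two definitions are chart components, locked like [tjac]. The bodies of [gloc]
    and [hloc] are the functions occurring in [smooth_cov2] and [smooth_contra2]. *)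
HB.lock Definition gloc (R : realType) (n : nat) (M : manifold R n)
  (g : M -> 'M[R]_n) (i : chart M) (y : 'rV[R]_n) : 'M[R]_n :=
  let J := jac i (chart_at (psi i y)) (psi i y) in J *m g (psi i y) *m J^T.

HB.lock Definition hloc (R : realType) (m q : nat) (M : manifold R (m + q))
  (S : subRiemannian M) (i : chart M) (y : 'rV[R]_(m + q)) : 'M[R]_(m + q) :=
  let J := jac (chart_at (psi i y)) i (psi i y) in J^T *m sr_h S (psi i y) *m J.

HB.lock Definition floc (R : realType) (n : nat) (M : manifold R n)
  (E : 'I_n -> vfield M) (i : chart M) (y : 'rV[R]_n) : 'M[R]_n :=
  \matrix_(A < n) vloc i (E A) y.

Lemma derive_lincomb (R : realType) (V W : normedModType R) (I : Type) (s : seq I)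
    (f : V -> W) y (b : I -> R) (v : I -> V) : differentiable f y ->
  'D_(\sum_(k <- s) b k *: v k) f y = \sum_(k <- s) b k *: 'D_(v k) f y.
Proof.
move=> df; rewrite deriveE // linear_sum.
by apply: eq_bigr => k _; rewrite linearZ deriveE.
Qed.

Lemma ulsubmx_unit (R : realType) m q (A : 'M[R]_(m + q)) : A \in unitmx ->
  (forall k l, A (lshift q k) (rshift m l) = 0) -> ulsubmx A \in unitmx.
Proof.
move=> Au A0; have ur0 : ursubmx A = 0 by apply/matrixP => k l; rewrite !mxE A0.
by move: Au; rewrite -{1}(submxK A) ur0 !unitmxE det_lblock unitrM => /andP[].
Qed.

(** Lowers the free index: the first equation of the statement carries the inverse matrix [h^{ij}],
    the equation for the momentum does not. *)
Lemma invmx_system (R : realType) m (G : 'M[R]_m) (C w : 'I_m -> R) : G \in unitmx ->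
  (forall i, 0 = C i + \sum_j invmx G i j * w j) <->
  (forall j, \sum_i G j i * C i = - w j).
Proof.
move=> Gu; pose c : 'cV[R]_m := \col_i C i; pose v : 'cV[R]_m := \col_i w i.
have L : (forall i, 0 = C i + \sum_j invmx G i j * w j) <-> c = - (invmx G *m v).
  split=> [H|/colP H i].
    apply/colP => i; rewrite !mxE; apply/eqP; rewrite -addr_eq0 [X in X == _](_ : _ = 0) //.
    by rewrite [RHS](H i); congr (_ + _); apply: eq_bigr => j _; rewrite mxE.
  have := H i; rewrite !mxE => ->.
  have -> : \sum_j invmx G i j * v j 0 = \sum_j invmx G i j * w j.
    by apply: eq_bigr => j _; rewrite mxE.
  by rewrite addNr.
have Rt : (forall j, \sum_i G j i * C i = - w j) <-> G *m c = - v.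
  split=> [H|/colP H j].
    apply/colP => j; rewrite !mxE -H; by apply: eq_bigr => i _; rewrite mxE.
  by have := H j; rewrite !mxE => <-; apply: eq_bigr => i _; rewrite mxE.
rewrite L Rt; split=> [->|H].
  by rewrite mulmxN mulmxA mulmxV ?mul1mx.
by rewrite -mulmxN -H mulmxA mulVmx ?mul1mx.
Qed.

Section Local.
Context {R : realType} {m q : nat} {M : manifold R (m + q)}.
Context {S : subRiemannian M} {g : M -> 'M[R]_(m + q)}.
Hypothesis g_riemannian : riemannian g.
Hypothesis g_restricts : restricts_to g S.
Implicit Types (x : M) (i : chart M).

Lemma smooth_gloc i : smooth_on (phi i @` dom i) (gloc g i).
Proof. by case: g_riemannian => sg _ _; rewrite gloc.unlock; exact: sg. Qed.

Lemma smooth_hloc i : smooth_on (phi i @` dom i) (hloc S i).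
Proof. by rewrite hloc.unlock; exact: (sr_h_smooth S). Qed.

Lemma glocE i x : dom i x ->
  gloc g i (phi i x) = tjac i (chart_at x) x *m g x *m (tjac i (chart_at x) x)^T.
Proof. by move=> dx; rewrite gloc.unlock phiK // jac_tjac. Qed.

Lemma hlocE i x : dom i x ->
  hloc S i (phi i x) = (tjac (chart_at x) i x)^T *m sr_h S x *m tjac (chart_at x) i x.
Proof. by move=> dx; rewrite hloc.unlock phiK // jac_tjac. Qed.

Lemma ham_locE i y xi : ham_loc S i y xi = 2^-1 * (xi^T *m hloc S i y *m xi) 0 0.
Proof.
rewrite /ham_loc /ham /sharp hloc.unlock; congr (_ * _).
by rewrite trmx_mul !mulmxA.
Qed.

Lemma hloc_sym i x : dom i x -> (hloc S i (phi i x))^T = hloc S i (phi i x).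
Proof. by move=> dx; rewrite hlocE // !trmx_mul trmxK (sr_h_sym S) mulmxA. Qed.

Lemma gloc_sym i x : dom i x -> (gloc g i (phi i x))^T = gloc g i (phi i x).
Proof. by move=> dx; rewrite glocE // !trmx_mul trmxK (g_sym g_riemannian) mulmxA. Qed.

Lemma loc_cancel i x : dom i x ->
  tjac (chart_at x) i x *m tjac i (chart_at x) x = 1%:M.
Proof. by move=> dx; rewrite jac_inv //; exact: dom_chart_at. Qed.

Lemma loc_cancel' i x : dom i x ->
  tjac i (chart_at x) x *m tjac (chart_at x) i x = 1%:M.
Proof. by move=> dx; rewrite jac_inv //; exact: dom_chart_at. Qed.

Lemma gloc_hloc i x k (v : 'M[R]_(k, m + q)) : dom i x ->
  v *m tjac (chart_at x) i x *m gloc g i (phi i x) *m hloc S i (phi i x) =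
  v *m g x *m sr_h S x *m tjac (chart_at x) i x.
Proof.
move=> dx; rewrite glocE // hlocE //.
have JK := loc_cancel dx; move: (tjac _ i x) (tjac i _ x) JK => J K JK.
rewrite !mulmxA -(mulmxA v J K) JK mulmx1.
by rewrite -(mulmxA (v *m g x) K^T J^T) -trmx_mul JK trmx1 mulmx1.
Qed.

Lemma hloc_gloc_hloc i x : dom i x ->
  hloc S i (phi i x) *m gloc g i (phi i x) *m hloc S i (phi i x) = hloc S i (phi i x).
Proof.
move=> dx; rewrite {1}hlocE // gloc_hloc // -!mulmxA.
by rewrite [sr_h S x *m _]mulmxA [_ *m g x *m _]mulmxA (hgh g_restricts) mulmxA -hlocE.
Qed.

Variables (U : set M) (E : 'I_(m + q) -> vfield M).
Hypothesis E_adapted : adapted_frame S g U E.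

Lemma frame_open : open U. Proof. by case: E_adapted. Qed.

Lemma frame_smooth A : smooth_vfield U (E A).
Proof.
case: E_adapted => _ H V _; case: (fintype.split_ordP A) => a ->.
  by have [] := H a.
by have [] := V a.
Qed.

Lemma flocE i x : dom i x ->
  floc E i (phi i x) = frame_mx E x *m tjac (chart_at x) i x.
Proof.
move=> dx; apply/row_matrixP => A; rewrite row_mul rowK floc.unlock rowK.
exact: vlocE.
Qed.

Lemma smooth_floc i : smooth_on (phi i @` (U `&` dom i)) (floc E i).
Proof.
move=> k; have oV := @open_image _ _ _ i U frame_open.
apply/Ck_on_mxP => // A b.
have /(Ck_on_mxP _ _ oV) /(_ 0 b) := @frame_smooth A i k.
by apply: (Ck_on_eq oV) => y _; rewrite floc.unlock !mxE.
Qed.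

Lemma floc_differentiable i x : U x -> dom i x -> differentiable (floc E i) (phi i x).
Proof.
move=> Ux dx; have oV := @open_image _ _ _ i U frame_open.
exact: (Ck_on_differentiable oV (image_in Ux dx) (@smooth_floc i 1%N)).
Qed.

Lemma gloc_differentiable i x : dom i x -> differentiable (gloc g i) (phi i x).
Proof.
move=> dx; have H : (phi i @` dom i) (phi i x) by exists x.
have sG := @smooth_gloc i 1%N.
exact: (Ck_on_differentiable (@phi_open _ _ M i) H sG).
Qed.

Lemma hloc_differentiable i x : dom i x -> differentiable (hloc S i) (phi i x).
Proof.
move=> dx; have H : (phi i @` dom i) (phi i x) by exists x.
have sG := @smooth_hloc i 1%N.
exact: (Ck_on_differentiable (@phi_open _ _ M i) H sG).
Qed.

Lemma ham_loc_derive i x v xi : dom i x ->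
  'D_v (fun z => ham_loc S i z xi) (phi i x) =
  2^-1 * (xi^T *m 'D_v (hloc S i) (phi i x) *m xi) 0 0.
Proof.
move=> dx; have dh := hloc_differentiable dx.
have -> : (fun z => ham_loc S i z xi) = (fun z => 2^-1 * (xi^T *m hloc S i z *m xi) 0 0).
  by apply/funext => z; rewrite ham_locE.
have H0 := derivableP (diff_derivable (v := v) dh).
have H1 := is_derive_mulmx (is_derive_mulmx (is_derive_cst xi^T (phi i x) v) H0)
  (is_derive_cst xi (phi i x) v).
rewrite mul0mx add0r mulmx0 addr0 in H1.
have /is_derive_mxP /(_ 0 0) H2 := H1.
have H3 := is_deriveZ (2^-1) H2.
by have [_ E2] := H3; exact: E2.
Qed.

Definition gram x : 'M[R]_(m + q) := frame_mx E x *m g x *m (frame_mx E x)^T.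

Definition gramloc i y : 'M[R]_(m + q) := floc E i y *m gloc g i y *m (floc E i y)^T.

Lemma gramlocE i x : dom i x -> gramloc i (phi i x) = gram x.
Proof.
move=> dx; rewrite /gramloc flocE // glocE //.
have JK := loc_cancel dx; move: (tjac _ i x) (tjac i _ x) JK => J K JK.
rewrite trmx_mul !mulmxA -(mulmxA _ J K) JK mulmx1.
by rewrite -(mulmxA _ K^T J^T) -trmx_mul JK trmx1 mulmx1.
Qed.

Lemma inner_sym x v w : inner g x v w = inner g x w v.
Proof.
have T11 (A : 'M[R]_1) : A^T 0 0 = A 0 0 by rewrite mxE.
by rewrite /inner -T11 !trmx_mul trmxK (g_sym g_riemannian) mulmxA.
Qed.

Lemma inner_row x (P Q : 'M[R]_(m + q)) A B :
  inner g x (row A P) (row B Q) = (P *m g x *m Q^T) A B.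
Proof.
by rewrite /inner -row_mul mxE [RHS]mxE; apply: eq_bigr => C _; rewrite !mxE.
Qed.

Lemma gramE x A B : gram x A B = inner g x (E A x) (E B x).
Proof. by rewrite /gram -inner_row !frame_row. Qed.

Lemma gramloc_Ck i k : Ck_on k (phi i @` (U `&` dom i)) (gramloc i).
Proof.
have oV := @open_image _ _ _ i U frame_open.
have sg : Ck_on k (phi i @` (U `&` dom i)) (gloc g i).
  by apply: Ck_on_sub (@smooth_gloc i k) => _ [x [_ dx] <-]; exists x.
apply: Ck_on_mulmx => //; first by apply: Ck_on_mulmx => //; exact: smooth_floc.
by apply: Ck_on_trmx => //; exact: smooth_floc.
Qed.

Lemma gramloc_differentiable i x : U x -> dom i x -> differentiable (gramloc i) (phi i x).
Proof.
move=> Ux dx; have oV := @open_image _ _ _ i U frame_open.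
exact: (Ck_on_differentiable oV (image_in Ux dx) (gramloc_Ck i 1%N)).
Qed.

Lemma gram_unit x : U x -> gram x \in unitmx.
Proof.
move=> Ux; have F := frame_unit E_adapted Ux.
by rewrite /gram !unitmx_mul unitmx_tr F (g_unit g_riemannian).
Qed.

Lemma floc_unit i x : U x -> dom i x -> floc E i (phi i x) \in unitmx.
Proof.
move=> Ux dx; have [J _] := mulmx1_unit (loc_cancel dx).
by rewrite flocE // unitmx_mul (frame_unit E_adapted Ux) J.
Qed.

End Local.
Arguments gram {R m q M} g E x.
Arguments gramloc {R m q M} g E i y.

(** * Equivalence of the covariant equations and Hamilton's equations along a curve *)

Section Momentum.
Context {R : realType} {m q : nat} {M : manifold R (m + q)}.
Context {S : subRiemannian M} {g : M -> 'M[R]_(m + q)} {nb : connection M}.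
Hypothesis g_riemannian : riemannian g.
Hypothesis g_restricts : restricts_to g S.
Hypothesis nb_distinguished : distinguished S g nb.
Variables (U : set M) (E : 'I_(m + q) -> vfield M).
Hypothesis E_adapted : adapted_frame S g U E.

Local Notation fr := (frame_mx E).
Local Notation hor := (lshift q).

Let oU : open U := frame_open E_adapted.
Let sE A : smooth_vfield U (E A) := frame_smooth E_adapted A.

Definition nabla_mx C x : 'M[R]_(m + q) := \matrix_B nb (E C) (E B) x.

(** Metric compatibility for all pairs of frame fields at once, moved to the chart [i] by
    [dirderiv_chart]. *)
Lemma metric_deriv i x C : U x -> dom i x ->
  'D_(row C (floc E i (phi i x))) (gramloc g E i) (phi i x) =
  nabla_mx C x *m g x *m (fr x)^T + fr x *m g x *m (nabla_mx C x)^T.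
Proof.
move=> Ux dx; have dG := gramloc_differentiable g_riemannian E_adapted Ux dx.
have oV := @open_image _ _ _ i U oU.
apply/matrixP => A B; rewrite derive_mxE; last exact: diff_derivable.
have [metr _] := nb_distinguished oU.
have := metr _ _ _ (sE C) (sE A) (sE B) x Ux.
pose f z := inner g z (E A z) (E B z).
have fE y : (phi i @` (U `&` dom i)) y ->
    gramloc g E i y A B = (f \o psi i) y.
  by move=> [z [_ dz] <-] /=; rewrite phiK // gramlocE // gramE.
have df : differentiable (f \o psi i) (phi i x).
  apply: (Ck_on_differentiable1 (k := 0) oV (image_in Ux dx)).
  have /(Ck_on_mxP _ _ oV) /(_ A B) := gramloc_Ck g_riemannian E_adapted i 1.
  exact: (Ck_on_eq oV fE).
rewrite (dirderiv_chart (E C) dx df).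
have -> : vloc i (E C) (phi i x) = row C (floc E i (phi i x)).
  by rewrite floc.unlock rowK.
have H : \forall y \near phi i x, gramloc g E i y A B = (f \o psi i) y.
  exact: (near_open oV (image_in Ux dx) fE).
rewrite (near_eq_derive _ H) => ->.
rewrite mxE; congr (_ + _).
  by rewrite -inner_row /nabla_mx rowK frame_row.
by rewrite -inner_row /nabla_mx rowK frame_row.
Qed.

Section Curve.
Variables (i : chart M) (c : R -> M) (u : R -> 'rV[R]_(m + q))
  (nu : R -> 'cV[R]_(m + q)) (t : R).
Hypothesis c_cont : {for t, continuous c}.
Hypothesis dx : dom i (c t).
Hypothesis Ux : U (c t).
Hypothesis u_nu : \forall s \near t,
  (u s <= sr_D S (c s))%MS /\ sr_D S (c s) *m nu s = 0.
Hypothesis c_vel : is_derive t 1 (fun s => phi i (c s)) (tcomp i (c t) (u t)).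

Local Notation x := (c t).
Local Notation y s := (phi i (c s)).
Local Notation p s := (momentum g (c s) (u s) (nu s)).
Local Notation xi s := (ccomp i (c s) (p s)).
Local Notation P s := (fr (c s) *m p s).

(** The vector dual to [p] is [u] plus the dual of [nu]. Its horizontal frame coordinates are
    therefore those of [u], its vertical ones those of the dual of [nu], and one row carries both
    unknowns. *)
Definition sharp_coords s : 'rV[R]_(m + q) :=
  gsharp g (c s) (p s) *m invmx (fr (c s)).

Definition vel_coords : 'rV[R]_(m + q) := u t *m invmx (fr x).

(** Row [B] is nabla_u E_B; in [torsion_u] it is T(u, E_B). *)
Definition nabla_u : 'M[R]_(m + q) := \sum_k vel_coords 0 k *: nabla_mx k x.

Definition torsion_u : 'M[R]_(m + q) :=
  \sum_k vel_coords 0 k *: \matrix_B torsion nb (E k) (E B) x.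

Local Notation a := sharp_coords.
Local Notation b := vel_coords.

Lemma near_U : \forall s \near t, U (c s) /\ dom i (c s).
Proof.
have H : \forall z \near x, U z /\ dom i z.
  apply: open_nbhs_nbhs; split; last by split.
  by rewrite -[X in open X]/(U `&` dom i); apply: openI => //; exact: dom_open.
exact: c_cont H.
Qed.

Lemma ccompE s : xi s = tjac i (chart_at (c s)) (c s) *m p s.
Proof. by rewrite /ccomp jac_tjac. Qed.

Lemma floc_xi s : dom i (c s) -> floc E i (y s) *m xi s = P s.
Proof.
move=> ds; rewrite flocE // ccompE mulmxA -(mulmxA (fr _)).
by rewrite loc_cancel // mulmx1.
Qed.

Lemma gram_coords s : U (c s) -> gram g E (c s) *m (a s)^T = P s.
Proof.
move=> Us; rewrite /gram /sharp_coords trmx_mul !mulmxA -(mulmxA _ (fr (c s))^T).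
rewrite -trmx_mul mulVmx ?(frame_unit E_adapted Us) // trmx1 mulmx1.
by rewrite -mulmxA -{1}(g_sym g_riemannian) -trmx_mul gsharpK // trmxK.
Qed.

Lemma derivable_floc : is_derive t 1 (fun s => floc E i (y s))
  ('D_(tcomp i x (u t)) (floc E i) (y t)).
Proof.
exact: (is_derive_curve c_vel (floc_differentiable E_adapted Ux dx)).
Qed.

Lemma derivable_gram : is_derive t 1 (fun s => gram g E (c s))
  ('D_(tcomp i x (u t)) (gramloc g E i) (y t)).
Proof.
have H := is_derive_curve c_vel (gramloc_differentiable g_riemannian E_adapted Ux dx).
apply: near_eq_is_derive H; have := near_U; apply: filterS => s [Us ds] /=.
by rewrite gramlocE.
Qed.

(** Both sides are linked through [P] by [floc_xi] and [gram_coords], whose matrices are derivable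
    and invertible. *)
Lemma derivable_xi : derivable (fun s => xi s) t 1 <-> derivable a t 1.
Proof.
have [dfl _] := derivable_floc; have [dgr _] := derivable_gram.
split=> H.
  have dinv := derivable_invmx dgr (derivable_continuous dgr)
    (gram_unit g_riemannian E_adapted Ux).
  have dP := derivable_mulmx dinv (derivable_mulmx dfl H).
  apply: near_eq_derivable (derivable_trmx dP).
  have := near_U; apply: filterS => s [Us ds].
  rewrite floc_xi // -gram_coords // mulmxA mulVmx ?mul1mx ?trmxK //.
  exact: (gram_unit g_riemannian E_adapted Us).
have dinv := derivable_invmx dfl (derivable_continuous dfl) (floc_unit E_adapted Ux dx).
have dP := derivable_mulmx dinv (derivable_mulmx dgr (derivable_trmx H)).
apply: near_eq_derivable dP; have := near_U; apply: filterS => s [Us ds].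
rewrite gram_coords // -floc_xi // mulmxA mulVmx ?mul1mx //.
exact: (floc_unit E_adapted Us ds).
Qed.

Lemma tcomp_vel : tcomp i x (u t) = b *m floc E i (y t).
Proof.
rewrite flocE // mulmxA /vel_coords mulmxKV ?(frame_unit E_adapted Ux) //.
by rewrite /tcomp jac_tjac.
Qed.

Lemma u_D : (u t <= sr_D S x)%MS. Proof. by case: (nbhs_singleton u_nu). Qed.

Lemma nu_D : sr_D S x *m nu t = 0. Proof. by case: (nbhs_singleton u_nu). Qed.

Lemma vel_ver k : b 0 (rshift m k) = 0.
Proof. exact: (coord_hor g_riemannian E_adapted Ux k u_D). Qed.

Lemma tcomp_sum : tcomp i x (u t) = \sum_k b 0 k *: row k (floc E i (y t)).
Proof. by rewrite tcomp_vel mulmx_sum_row. Qed.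

Lemma gram_deriv : 'D_(tcomp i x (u t)) (gramloc g E i) (y t) =
  nabla_u *m g x *m (fr x)^T + fr x *m g x *m nabla_u^T.
Proof.
have dG := gramloc_differentiable g_riemannian E_adapted Ux dx.
rewrite tcomp_sum (derive_lincomb _ _ _ dG) /nabla_u.
under eq_bigr => k _ do rewrite metric_deriv // scalerDr.
rewrite big_split /= linear_sum /= !mulmx_suml mulmx_sumr; congr (_ + _).
  by apply: eq_bigr => k _; rewrite -!scalemxAl.
by apply: eq_bigr => k _; rewrite linearZ /= -scalemxAr.
Qed.

(** Frame coordinates of the covariant derivative along [c] of the vector dual to [p]; [cov_hor] and
    [cov_ver] identify them with [cov_along]. *)
Definition cov_coords : 'rV[R]_(m + q) := 'D_1 a t + a t *m nabla_u *m invmx (fr x).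

(** Differentiate [P = gram *m a^T]. Metricity splits the derivative of the Gram matrix in two: one
    half gives the term in [nabla_u], the other completes the derivative of [a] to the covariant
    one. *)
Lemma momentum_deriv_cov : derivable a t 1 ->
  is_derive t 1 (fun s => P s) (nabla_u *m p t + gram g E x *m cov_coords^T).
Proof.
move=> da.
have H := is_derive_mulmx derivable_gram (is_derive_trmx (derivableP da)).
have EP : \forall s \near t, gram g E (c s) *m (a s)^T = P s.
  by have := near_U; apply: filterS => s [Us _]; exact: gram_coords.
have := near_eq_is_derive EP H; rewrite gram_deriv mulmxDl => {}H.
have E1 : nabla_u *m g x *m (fr x)^T *m (a t)^T = nabla_u *m p t.
  rewrite /sharp_coords trmx_mul !mulmxA -(mulmxA _ (fr x)^T) -trmx_mul.
  rewrite mulVmx ?(frame_unit E_adapted Ux) // trmx1 mulmx1 -mulmxA.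
  by rewrite -{1}(g_sym g_riemannian) -trmx_mul gsharpK // trmxK.
have E2 : gram g E x *m cov_coords^T =
    fr x *m g x *m nabla_u^T *m (a t)^T + gram g E x *m ('D_1 a t)^T.
  rewrite /cov_coords linearD /= mulmxDr addrC; congr (_ + _).
  rewrite !trmx_mul /gram !mulmxA -(mulmxA _ (fr x)^T) -trmx_mul.
  by rewrite mulVmx ?(frame_unit E_adapted Ux) // trmx1 mulmx1.
by rewrite E2 -E1 addrA; exact: H.
Qed.

Definition ham_grad : 'cV[R]_(m + q) :=
  \col_A 'D_(delta_mx 0 A) (fun z => ham_loc S i z (xi t)) (y t).

Lemma ham_gradE v : v *m ham_grad =
  2^-1 *: ((xi t)^T *m 'D_v (hloc S i) (y t) *m xi t).
Proof.
have dh := @hloc_differentiable _ _ _ _ S i x dx.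
have H A : ham_grad A 0 = (2^-1 *: ((xi t)^T *m 'D_(delta_mx 0 A) (hloc S i) (y t) *m xi t)) 0 0.
  by rewrite /ham_grad mxE ham_loc_derive // [RHS]mxE.
apply: mx11_eqP; rewrite mxE (derive_coord_sum _ dh).
rewrite mulmx_sumr mulmx_suml scaler_sumr summxE; apply: eq_bigr => A _.
by rewrite H -scalemxAr -scalemxAl !mxE mulrCA.
Qed.

Lemma vel_comb_hor (F : 'I_(m + q) -> 'rV[R]_(m + q)) z :
  (forall k, (F (hor k) <= sr_D S z)%MS) ->
  ((\sum_k b 0 k *: F k)%R <= sr_D S z)%MS.
Proof.
move=> FD; rewrite big_split_ord /= [X in _ + X]big1 ?addr0; last first.
  by move=> k _; rewrite vel_ver scale0r.
by apply: summx_sub => k _; apply: scalemx_sub.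
Qed.

Lemma vel_frame z : U z -> (b *m fr z <= sr_D S z)%MS.
Proof.
move=> Uz; rewrite mulmx_sum_row; apply: vel_comb_hor => k.
rewrite frame_row; exact: (frame_hor E_adapted Uz).
Qed.

Lemma vel_nabla B : (b *m nabla_mx B x <= sr_D S x)%MS.
Proof.
rewrite mulmx_sum_row; apply: vel_comb_hor => k; rewrite rowK.
have [_ [HD _]] := nb_distinguished oU.
have [|_ H] := HD (E B) (E (hor k)) (sE B); last exact: H.
by case: E_adapted.
Qed.

Lemma velE : b *m fr x = u t.
Proof. by rewrite /vel_coords mulmxKV ?(frame_unit E_adapted Ux). Qed.

Lemma hloc_xi : (xi t)^T *m hloc S i (y t) = b *m floc E i (y t).
Proof.
rewrite ccompE hlocE // flocE // (mulmxA b) velE trmx_mul !mulmxA.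
rewrite -(mulmxA _ (tjac i _ x)^T) -trmx_mul loc_cancel // trmx1 mulmx1.
by have := sharp_momentum g_riemannian g_restricts u_D nu_D; rewrite /sharp => ->.
Qed.

(** This is [envelope] for the chart matrices of [h], [g] and the frame, with the coefficients [b]
    of [u] frozen. The derivative of the Gram matrix is then replaced using [metric_deriv], whose
    two halves contribute equally. *)
Lemma ham_grad_frame B : row B (floc E i (y t)) *m ham_grad =
  b *m 'D_(row B (floc E i (y t))) (floc E i) (y t) *m xi t -
  b *m nabla_mx B x *m p t.
Proof.
set v := row B _; have dh := @hloc_differentiable _ _ _ _ S i x dx.
have dg := gloc_differentiable g_riemannian dx.
have de := floc_differentiable E_adapted Ux dx.
have dG := gramloc_differentiable g_riemannian E_adapted Ux dx.
(* The last condition holds because [b] has no vertical entries: the combination stays horizontal at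
   nearby points, where the projection fixes it. *)
have Hnear : \forall z \near y t, [/\ (hloc S i z)^T = hloc S i z,
    (gloc g i z)^T = gloc g i z,
    hloc S i z *m gloc g i z *m hloc S i z = hloc S i z &
    b *m floc E i z *m gloc g i z *m hloc S i z = b *m floc E i z].
  apply: (near_open (@open_image _ _ _ i U oU) (image_in Ux dx)) => _ [z [Uz dz] <-].
  split; [exact: hloc_sym|exact: gloc_sym|exact: hloc_gloc_hloc|].
  by rewrite flocE // mulmxA gloc_hloc // (D_proj g_restricts) // vel_frame.
have := envelope (derivableP (diff_derivable (v := v) dh)) (diff_derivable (v := v) dg)
  (derivableP (diff_derivable (v := v) de)) (derivableP (diff_derivable (v := v) dG))
  Hnear hloc_xi.
rewrite ham_gradE => ->.
have -> : 'D_v (fun z => floc E i z *m gloc g i z *m (floc E i z)^T) (y t) =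
    nabla_mx B x *m g x *m (fr x)^T + fr x *m g x *m (nabla_mx B x)^T.
  exact: metric_deriv.
(* [nu] drops out of the momentum because the connection preserves the distribution, so
   [b *m nabla_mx B x] is horizontal. *)
have E1 : b *m (nabla_mx B x *m g x *m (fr x)^T) *m b^T = b *m nabla_mx B x *m p t.
  rewrite /momentum mulmxDr (D_annihil (vel_nabla B) nu_D) addr0.
  have -> : (u t)^T = (fr x)^T *m b^T by rewrite -trmx_mul velE.
  by rewrite !mulmxA.
have E2 : b *m (fr x *m g x *m (nabla_mx B x)^T) *m b^T = b *m nabla_mx B x *m p t.
  rewrite -E1; have T11 (A : 'M[R]_1) : A = A^T by apply/matrixP => k l; rewrite !ord1 mxE.
  move: b (nabla_mx B x) (fr x) => b0 N F.
  by rewrite [LHS]T11 !trmx_mul !trmxK (g_sym g_riemannian) !mulmxA.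
have half (A C : 'M[R]_1) : 2^-1 *: (A *+ 2 - (C + C)) = A - C.
  by rewrite -mulr2n -mulrnBl -[(A - C) *+ 2]scaler_nat scalerA mulVf ?scale1r // pnatr_eq0.
by rewrite mulmxDr mulmxDl E1 E2; exact: half.
Qed.

Lemma bracket_pair A B : ('D_(row A (floc E i (y t))) (vloc i (E B)) (y t) -
    'D_(row B (floc E i (y t))) (vloc i (E A)) (y t)) *m xi t =
  bracket (E A) (E B) x *m p t.
Proof.
have vE C : row C (floc E i (y t)) = vloc i (E C) (y t).
  by rewrite floc.unlock rowK.
rewrite !vE -(bracket_chart oU (sE A) (sE B) Ux dx) ccompE.
by rewrite mulmxA -(mulmxA (bracket _ _ _)) loc_cancel // mulmx1.
Qed.

Lemma floc_row_deriv v B : row B ('D_v (floc E i) (y t)) = 'D_v (vloc i (E B)) (y t).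
Proof.
have de := diff_derivable (v := v) (floc_differentiable E_adapted Ux dx).
have dX := diff_derivable (v := v) (vloc_differentiable oU (sE B) Ux dx).
apply/rowP => k; rewrite mxE !derive_mxE //.
have -> : (fun z => floc E i z B k) = (fun z => vloc i (E B) z 0 k).
  by apply/funext => z; rewrite floc.unlock mxE.
by [].
Qed.

(** For each [B] the derivatives of the frame fields combine into the brackets [E_k, E_B], and
    [ham_grad_frame] adds nabla_(E_B) E_k; the definition of torsion turns the sum into nabla_(E_k)
    E_B - T(E_k, E_B). *)
Lemma force_identity : 'D_(tcomp i x (u t)) (floc E i) (y t) *m xi t -
  floc E i (y t) *m ham_grad = (nabla_u - torsion_u) *m p t.
Proof.
have dX B := vloc_differentiable oU (sE B) Ux dx.
apply/row_matrixP => B.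
have E1 : row B ('D_(tcomp i x (u t)) (floc E i) (y t)) *m xi t =
    \sum_k b 0 k *: ('D_(row k (floc E i (y t))) (vloc i (E B)) (y t) *m xi t).
  rewrite floc_row_deriv tcomp_sum (derive_lincomb _ _ _ (dX B)) mulmx_suml.
  by apply: eq_bigr => k _; rewrite scalemxAl.
have E2 : b *m 'D_(row B (floc E i (y t))) (floc E i) (y t) *m xi t =
    \sum_k b 0 k *: ('D_(row B (floc E i (y t))) (vloc i (E k)) (y t) *m xi t).
  rewrite (mulmx_sum_row b) mulmx_suml; apply: eq_bigr => k _.
  by rewrite floc_row_deriv scalemxAl.
have E3 : b *m nabla_mx B x *m p t = \sum_k b 0 k *: (nb (E B) (E k) x *m p t).
  rewrite (mulmx_sum_row b) mulmx_suml; apply: eq_bigr => k _.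
  by rewrite rowK scalemxAl.
have E4 : row B (nabla_u - torsion_u) *m p t =
    \sum_k b 0 k *: ((nb (E k) (E B) x - torsion nb (E k) (E B) x) *m p t).
  rewrite /nabla_u /torsion_u -sumrB linear_sum /= mulmx_suml.
  apply: eq_bigr => k _; rewrite -scalerBr linearZ /= -scalemxAl.
  by congr (_ *: (_ *m _)); apply/rowP => l; rewrite !mxE.
rewrite linearB /= !row_mul E1 ham_grad_frame E2 E3 E4 opprB addrCA -sumrB -big_split /=.
apply: eq_bigr => k _; rewrite -scalerBr -scalerDr; congr (_ *: _).
rewrite -mulmxBl bracket_pair -mulmxDl; congr (_ *m _).
(* Applied with [v1 = nb (E k) (E B) x], [v2 = nb (E B) (E k) x] and [v3] the bracket. *)
have alg (v1 v2 v3 : 'rV[R]_(m + q)) : v2 + v3 = v1 - (v1 - v2 - v3).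
  by rewrite !opprD !opprK !addrA subrr add0r.
exact: alg.
Qed.

Definition cov_equation : Prop := derivable a t 1 /\
  gram g E x *m cov_coords^T = - (torsion_u *m p t).

(** The derivative of [P] is computed once from [floc *m xi] and once from [momentum_deriv_cov];
    [force_identity] compares the two, and invertibility of [floc] isolates the derivative of
    [xi]. *)
Lemma momentum_equation :
  cov_equation <-> is_derive t 1 (fun s => xi s) (- ham_grad).
Proof.
have Fu := floc_unit E_adapted Ux dx.
have Pxi : \forall s \near t, floc E i (y s) *m xi s = P s.
  by have := near_U; apply: filterS => s [_ ds]; exact: floc_xi.
have dP eta : is_derive t 1 (fun s => xi s) eta -> is_derive t 1 (fun s => P s)
    ('D_(tcomp i x (u t)) (floc E i) (y t) *m xi t + floc E i (y t) *m eta).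
  by move=> H; exact: (near_eq_is_derive Pxi (is_derive_mulmx derivable_floc H)).
have F := force_identity.
split=> [[da cE]|H].
  have dxi := derivableP ((derivable_xi).2 da).
  have [_ E1] := dP _ dxi; have [_ E2] := momentum_deriv_cov da.
  have : floc E i (y t) *m 'D_1 (fun s => xi s) t = floc E i (y t) *m (- ham_grad).
    rewrite mulmxN; apply: (addrI ('D_(tcomp i x (u t)) (floc E i) (y t) *m xi t)).
    by rewrite F -E1 E2 cE mulmxBl.
  move/(congr1 (mulmx (invmx (floc E i (y t))))).
  by rewrite !mulmxA mulVmx // !mul1mx => <-.
have [dxi _] := H; have da := (derivable_xi).1 dxi; split=> //.
have [_ E1] := dP _ H; have [_ E2] := momentum_deriv_cov da.
apply: (addrI (nabla_u *m p t)); rewrite -E2 E1 mulmxN F mulmxBl.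
by [].
Qed.

Local Notation ver := (rshift m).
Local Notation nus s := (gsharp g (c s) (nu s)).

Lemma sharp_coordsE s A : a s 0 A = fcoord E (c s) (u s) A + fcoord E (c s) (nus s) A.
Proof.
by rewrite /sharp_coords (gsharp_momentum g_riemannian) mulmxDl mxE.
Qed.

Lemma near_coord_ver k : \forall s \near t, fcoord E (c s) (u s) (ver k) = 0.
Proof.
apply: filterS2 near_U u_nu => s [Us _] [us _].
exact: (coord_hor g_riemannian E_adapted Us k us).
Qed.

Lemma near_coord_hor k : \forall s \near t, fcoord E (c s) (nus s) (hor k) = 0.
Proof.
apply: filterS2 near_U u_nu => s [Us _] [_ nus].
exact: (coord_ver g_riemannian E_adapted Us k (gsharp_perp g_riemannian nus)).
Qed.

Lemma near_sharp_hor k : \forall s \near t, a s 0 (hor k) = fcoord E (c s) (u s) (hor k).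
Proof.
by apply: filterS (near_coord_hor k) => s s0; rewrite sharp_coordsE s0 addr0.
Qed.

Lemma near_sharp_ver k : \forall s \near t, a s 0 (ver k) = fcoord E (c s) (nus s) (ver k).
Proof.
by apply: filterS (near_coord_ver k) => s s0; rewrite sharp_coordsE s0 add0r.
Qed.

(** The coordinates missing from [a], namely the vertical ones of [u] and the horizontal ones of the
    dual of [nu], vanish near [t]. *)
Lemma derivable_sharp_coords : derivable a t 1 <->
  forall A, derivable (fun r => fcoord E (c r) (u r) A) t 1 /\
            derivable (fun r => fcoord E (c r) (nus r) A) t 1.
Proof.
split=> [/derivable_mxP da A|H].
  case: (fintype.split_ordP A) => k ->; split.
  - exact: near_eq_derivable (near_sharp_hor k) (da 0 (hor k)).
  - apply: (@near_eq_derivable _ _ _ (cst (0 : R))); last exact: derivable_cst.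
    by apply: filterS (near_coord_hor k) => s ->.
  - apply: (@near_eq_derivable _ _ _ (cst (0 : R))); last exact: derivable_cst.
    by apply: filterS (near_coord_ver k) => s ->.
  - exact: near_eq_derivable (near_sharp_ver k) (da 0 (ver k)).
apply/derivable_mxP => l A; rewrite ord1.
case: (fintype.split_ordP A) => k ->.
- apply: near_eq_derivable (H (hor k)).1.
  by apply: filterS (near_sharp_hor k) => s ->.
- apply: near_eq_derivable (H (ver k)).2.
  by apply: filterS (near_sharp_ver k) => s ->.
Qed.

Lemma nabla_hor_ver k B l : fcoord E x (nb (E (hor k)) (E (ver B)) x) (hor l) = 0.
Proof.
have [_ [_ [HD _]]] := nb_distinguished oU.
have [|_ H] := HD (E (hor k)) (E (ver B)) (sE _); first by case: E_adapted.
exact: (coord_ver g_riemannian E_adapted Ux l (H _ Ux)).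
Qed.

Lemma nabla_hor_hor k B l : fcoord E x (nb (E (hor k)) (E (hor B)) x) (ver l) = 0.
Proof.
have [_ [HD _]] := nb_distinguished oU.
have [|_ H] := HD (E (hor k)) (E (hor B)) (sE _); first by case: E_adapted.
exact: (coord_hor g_riemannian E_adapted Ux l (H _ Ux)).
Qed.

Lemma nabla_coords (v : 'rV[R]_(m + q)) A : (v *m nabla_u *m invmx (fr x)) 0 A =
  \sum_(k < m) \sum_B b 0 (hor k) * v 0 B * fcoord E x (nb (E (hor k)) (E B) x) A.
Proof.
rewrite /nabla_u mulmx_sumr mulmx_suml summxE big_split_ord /=.
rewrite [X in _ + X]big1 ?addr0 => [|k _]; last first.
  by rewrite vel_ver scale0r mulmx0 mul0mx mxE.
apply: eq_bigr => k _; rewrite -scalemxAr -scalemxAl mxE (mulmx_sum_row v) mulmx_suml.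
rewrite summxE mulr_sumr; apply: eq_bigr => B _.
by rewrite rowK -scalemxAl [X in _ * X]mxE mulrA.
Qed.

(** [cov_coords] sums over all of [a], [cov_along] over the coordinates of [u] alone. The extra
    terms vanish because the connection preserves [Dp]. *)
Lemma cov_hor (da : derivable a t 1) j : cov_coords 0 (hor j) = cov_along nb E c u u t (hor j).
Proof.
rewrite /cov_coords mxE nabla_coords /cov_along; congr (_ + _).
  by rewrite derive_mx // mxE; exact: near_eq_derive (near_sharp_hor j).
apply: eq_bigr => k _; apply: eq_bigr => B _.
case: (fintype.split_ordP B) => l ->; last by rewrite nabla_hor_ver !mulr0.
by rewrite (nbhs_singleton (near_sharp_hor l)).
Qed.

Lemma cov_ver (da : derivable a t 1) j :
  cov_coords 0 (ver j) = cov_along nb E c u (fun s => nus s) t (ver j).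
Proof.
rewrite /cov_coords mxE nabla_coords /cov_along; congr (_ + _).
  by rewrite derive_mx // mxE; exact: near_eq_derive (near_sharp_ver j).
apply: eq_bigr => k _; apply: eq_bigr => B _.
case: (fintype.split_ordP B) => l ->; first by rewrite nabla_hor_hor !mulr0.
by rewrite (nbhs_singleton (near_sharp_ver l)).
Qed.

Lemma gram_hor_ver k l : gram g E x (hor k) (ver l) = 0.
Proof.
rewrite gramE /inner (D_perp_orth g_riemannian (frame_hor E_adapted Ux k)) ?mxE //.
exact: (frame_ver E_adapted Ux l).
Qed.

Lemma gram_ver_hor k l : gram g E x (ver l) (hor k) = 0.
Proof.
by rewrite gramE (inner_sym g_riemannian) -gramE gram_hor_ver.
Qed.

Lemma gram_hor_unit : ulsubmx (gram g E x) \in unitmx.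
Proof.
exact: (ulsubmx_unit (gram_unit g_riemannian E_adapted Ux) gram_hor_ver).
Qed.

Lemma torsion_uE B : (torsion_u *m p t) B 0 =
  \sum_(k < m) b 0 (hor k) * (torsion nb (E (hor k)) (E B) x *m p t) 0 0.
Proof.
rewrite /torsion_u mulmx_suml summxE big_split_ord /=.
rewrite [X in _ + X]big1 ?addr0 => [|k _]; last by rewrite vel_ver scale0r mul0mx mxE.
apply: eq_bigr => k _; rewrite -scalemxAl mxE; congr (_ * _).
by rewrite mxE [RHS]mxE; apply: eq_bigr => l _; rewrite mxE.
Qed.

Lemma pair_coords (v : 'rV[R]_(m + q)) (w : 'cV[R]_(m + q)) :
  (v *m w) 0 0 = \sum_A fcoord E x v A * (E A x *m w) 0 0.
Proof.
rewrite {1}(coord_sum E_adapted Ux v) mulmx_suml summxE.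
by apply: eq_bigr => A _; rewrite -scalemxAl mxE.
Qed.

Lemma hor_nu k : E (hor k) x *m nu t = 0.
Proof. exact: (D_annihil (frame_hor E_adapted Ux k) nu_D). Qed.

(** T(X_k, X_j) is vertical, so only [nu] sees it; [nu] annihilates both covariant derivatives,
    which leaves the Levi form, with its indices swapped by the sign of the bracket. *)
Lemma torsion_hor k j : (torsion nb (E (hor k)) (E (hor j)) x *m p t) 0 0 =
  \sum_(l < q) (E (ver l) x *m nu t) 0 0 *
    fcoord E x (bracket (E (hor j)) (E (hor k)) x) (ver l).
Proof.
have [_ [HD [_ [HT _]]]] := nb_distinguished oU.
have sec l : section_on (sr_D S) U (E (hor l)) by case: E_adapted.
have TD := HT _ _ (sec k) (sec j) _ Ux.
have Tp := proj_D_eq0 g_riemannian g_restricts TD.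
rewrite /momentum mulmxDr mulmxA.
have -> : torsion nb (E (hor k)) (E (hor j)) x *m g x *m (u t)^T = 0.
  have H := D_perp_orth g_riemannian u_D Tp.
  by apply: trmx_inj; rewrite !trmx_mul trmxK (g_sym g_riemannian) trmx0 mulmxA.
rewrite add0r {Tp TD HT}.
have Dnu l l' : nb (E (hor l)) (E (hor l')) x *m nu t = 0.
  have [_ H] := HD _ _ (sE (hor l)) (sec l').
  exact: (D_annihil (H _ Ux) nu_D).
have -> : torsion nb (E (hor k)) (E (hor j)) x *m nu t =
    bracket (E (hor j)) (E (hor k)) x *m nu t.
  have bN : bracket (E (hor j)) (E (hor k)) x = - bracket (E (hor k)) (E (hor j)) x.
    by rewrite /bracket opprB.
  rewrite bN /torsion; move: (bracket (E (hor k)) (E (hor j)) x) => br.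
  by rewrite !mulmxBl !Dnu subrr sub0r mulNmx.
rewrite pair_coords big_split_ord /= big1 ?add0r => [|l _]; last first.
  by rewrite hor_nu mxE mulr0.
by apply: eq_bigr => l _; rewrite mulrC.
Qed.

Lemma torsion_ver k j : (torsion nb (E (hor k)) (E (ver j)) x *m p t) 0 0 =
  \sum_(i < m) \sum_(l < m) inner g x (E (hor i) x) (E (hor l) x) *
     fcoord E x (u t) (hor i) *
     fcoord E x (torsion nb (E (hor k)) (E (ver j)) x) (hor l) +
  \sum_(l < q) (E (ver l) x *m nu t) 0 0 *
     fcoord E x (torsion nb (E (hor k)) (E (ver j)) x) (ver l).
Proof.
(* The expansion of p(T) = g(u, T) + nu(T) in the frame is valid for any vector T. *)
move: (torsion nb (E (hor k)) (E (ver j)) x) => T.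
rewrite /momentum mulmxDr mxE; congr (_ + _).
  have -> : (T *m (g x *m (u t)^T)) 0 0 = (u t *m (g x *m T^T)) 0 0.
    have T11 (A : 'M[R]_1) : A^T 0 0 = A 0 0 by rewrite mxE.
    by rewrite -T11 !trmx_mul trmxK (g_sym g_riemannian) mulmxA.
  rewrite pair_coords big_split_ord /= [X in _ + X]big1 ?addr0 => [|l _]; last first.
    by rewrite -/(b 0 _) -[fcoord _ _ _ _]/(b 0 (ver l)) vel_ver mul0r.
  apply: eq_bigr => i0 _.
  rewrite mulmxA -[_ *m T^T]trmxK mxE trmx_mul trmxK pair_coords big_split_ord /=.
  rewrite [X in _ + X]big1 ?addr0 => [|l _]; last first.
    rewrite trmx_mul (g_sym g_riemannian) mulmxA -/(inner g x (E (ver l) x) (E (hor i0) x)).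
    by rewrite -gramE gram_ver_hor mulr0.
  rewrite mulr_sumr; apply: eq_bigr => l _.
  rewrite trmx_mul (g_sym g_riemannian) mulmxA.
  rewrite -/(inner g x (E (hor l) x) (E (hor i0) x)).
  rewrite (inner_sym g_riemannian).
  by rewrite mulrCA mulrA mulrC mulrA mulrAC.
rewrite pair_coords big_split_ord /= big1 ?add0r => [|l _]; last first.
  by rewrite hor_nu mxE mulr0.
by apply: eq_bigr => l _; rewrite mulrC.
Qed.

Lemma gram_cov B : (gram g E x *m cov_coords^T) B 0 =
  \sum_A gram g E x B A * cov_coords 0 A.
Proof. by rewrite mxE; apply: eq_bigr => A _; rewrite [X in _ * X]mxE. Qed.

(** The off-diagonal Gram blocks vanish, so the rows of [cov_equation] decouple. Horizontal rows
    need the inverse of the horizontal block ([invmx_system]); vertical rows already have a lowered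
    index, as in the statement. *)
Lemma extremal_eqs_iff : extremal_eqs g nb E c u nu t <-> cov_equation.
Proof.
have Dsc := derivable_sharp_coords.
have Geq : (\matrix_(k < m, l < m) inner g x (E (hor k) x) (E (hor l) x)) =
    ulsubmx (gram g E x).
  apply/matrixP => k l; rewrite mxE [RHS]mxE [RHS]mxE; exact/esym/gramE.
have horE j : (torsion_u *m p t) (hor j) 0 =
    \sum_(l < q) \sum_(k < m) (E (ver l) x *m nu t) 0 0 *
      fcoord E x (bracket (E (hor j)) (E (hor k)) x) (ver l) * fcoord E x (u t) (hor k).
  rewrite torsion_uE exchange_big /=; apply: eq_bigr => k _.
  rewrite torsion_hor mulr_sumr; apply: eq_bigr => l _.
  by rewrite mulrC.
have Eq1 (da : derivable a t 1) :
    (forall i : 'I_m, 0 = cov_along nb E c u u t (hor i) +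
     \sum_(j < m) \sum_(l < q) \sum_(k < m)
       invmx (\matrix_(k < m, l < m) inner g x (E (hor k) x) (E (hor l) x)) i j *
       (E (ver l) x *m nu t) 0 0 *
       fcoord E x (bracket (E (hor j)) (E (hor k)) x) (ver l) *
       fcoord E x (u t) (hor k)) <->
    (forall j : 'I_m, (gram g E x *m cov_coords^T) (hor j) 0 = - (torsion_u *m p t) (hor j) 0).
  rewrite Geq.
  have := invmx_system (fun i => cov_along nb E c u u t (hor i))
    (fun j => (torsion_u *m p t) (hor j) 0) gram_hor_unit.
  have -> : (forall i : 'I_m, 0 = cov_along nb E c u u t (hor i) +
     \sum_(j < m) \sum_(l < q) \sum_(k < m)
       invmx (ulsubmx (gram g E x)) i j * (E (ver l) x *m nu t) 0 0 *
       fcoord E x (bracket (E (hor j)) (E (hor k)) x) (ver l) *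
       fcoord E x (u t) (hor k)) =
    (forall i : 'I_m, 0 = cov_along nb E c u u t (hor i) +
     \sum_j invmx (ulsubmx (gram g E x)) i j * (torsion_u *m p t) (hor j) 0).
    apply: eq_forall => k; congr (_ = _ + _); apply: eq_bigr => j _.
    rewrite horE mulr_sumr; apply: eq_bigr => l _; rewrite mulr_sumr.
    by apply: eq_bigr => k' _; rewrite !mulrA.
  have -> : (forall j : 'I_m, \sum_i ulsubmx (gram g E x) j i * cov_along nb E c u u t (hor i) =
      - (torsion_u *m p t) (hor j) 0) =
    (forall j : 'I_m, (gram g E x *m cov_coords^T) (hor j) 0 = - (torsion_u *m p t) (hor j) 0).
    apply: eq_forall => j; congr (_ = _).
    rewrite gram_cov big_split_ord /= [X in _ = _ + X]big1 ?addr0 => [|l _]; last first.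
      by rewrite gram_hor_ver mul0r.
    by apply: eq_bigr => k _; rewrite cov_hor // !mxE.
  by [].
have Eq2 (da : derivable a t 1) (l : 'I_q) :
    0 = \sum_(l' < q) inner g x (E (ver l) x) (E (ver l') x) *
          cov_along nb E c u (fun s => nus s) t (ver l') +
        \sum_(i < m) \sum_(j < m) \sum_(k < m)
          inner g x (E (hor i) x) (E (hor j) x) * fcoord E x (u t) (hor i) *
          fcoord E x (torsion nb (E (hor k)) (E (ver l)) x) (hor j) *
          fcoord E x (u t) (hor k) +
        \sum_(l' < q) \sum_(k < m) (E (ver l') x *m nu t) 0 0 *
          fcoord E x (torsion nb (E (hor k)) (E (ver l)) x) (ver l') *
          fcoord E x (u t) (hor k) <->
    (gram g E x *m cov_coords^T) (ver l) 0 = - (torsion_u *m p t) (ver l) 0.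
  set X1 := \sum_(l' < q) _ * cov_along _ _ _ _ _ _ _.
  set X2 := \sum_(i < m) _; set X3 := \sum_(l' < q) _.
  have -> : (gram g E x *m cov_coords^T) (ver l) 0 = X1.
    rewrite gram_cov big_split_ord /= big1 ?add0r => [|k _]; last first.
      by rewrite gram_ver_hor mul0r.
    by apply: eq_bigr => k _; rewrite cov_ver // gramE.
  have -> : (torsion_u *m p t) (ver l) 0 = X2 + X3.
    rewrite torsion_uE.
    under eq_bigr => k _ do rewrite torsion_ver mulrDr.
    rewrite big_split /=; congr (_ + _).
      under eq_bigr => k _ do rewrite mulr_sumr.
      rewrite exchange_big /=; apply: eq_bigr => i0 _.
      under eq_bigr => k _ do rewrite mulr_sumr.
      rewrite exchange_big /=; apply: eq_bigr => j _; apply: eq_bigr => k _.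
      by rewrite mulrC.
    under eq_bigr => k _ do rewrite mulr_sumr.
    rewrite exchange_big /=; apply: eq_bigr => l' _; apply: eq_bigr => k _.
    by rewrite mulrC.
  rewrite -addrA; split=> [/esym/eqP|->]; last by rewrite addNr.
  by rewrite addr_eq0 => /eqP.
split=> [[/Dsc da [E1 E2]]|[da cE]].
  split=> //; apply/colP => B; rewrite [RHS]mxE.
  case: (fintype.split_ordP B) => k ->; first exact: (Eq1 da).1 E1 k.
  exact: (Eq2 da k).1 (E2 k).
have cEB B : (gram g E x *m cov_coords^T) B 0 = - (torsion_u *m p t) B 0.
  by rewrite cE mxE.
split; first exact/Dsc.
split; first exact: (Eq1 da).2 (fun j => cEB (hor j)).
move=> k; exact: (Eq2 da k).2 (cEB (ver k)).
Qed.

End Curve.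
End Momentum.

(** * Existence of adapted frames *)

Section Frames.
Context {R : realType} {m q : nat} {M : manifold R (m + q)}.
Context {S : subRiemannian M} {g : M -> 'M[R]_(m + q)}.
Hypothesis g_riemannian : riemannian g.
Hypothesis g_restricts : restricts_to g S.

Local Notation D := (sr_D S).
Local Notation Dp := (perp g (sr_D S)).

Lemma smooth_vfield_sub (U V : set M) X : U `<=` V -> smooth_vfield V X -> smooth_vfield U X.
Proof.
move=> UV sX i k; apply: Ck_on_sub (sX i k) => _ [x [Ux dx] <-].
by exists x => //; split=> //; exact: UV.
Qed.

Lemma rank_perp x : \rank (Dp x) = q.
Proof.
have [rD _] := sr_D_smooth S.
have gfull : row_full (g x) by rewrite row_full_unit (g_unit g_riemannian).
by rewrite /perp mxrank_ker (eqmxMfull _ gfull) mxrank_tr rD addKn.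
Qed.

(** The orthogonal projection to [Dp] of the field with constant components [v] in the chart [i]. *)
Definition perp_field (i : chart M) (v : 'rV[R]_(m + q)) : vfield M := fun x =>
  (v - v *m gloc g i (phi i x) *m hloc S i (phi i x)) *m tjac i (chart_at x) x.

Lemma perp_field_smooth i v : smooth_vfield (dom i) (perp_field i v).
Proof.
have oV : open (phi i @` dom i) := @phi_open _ _ M i.
apply: (@smooth_vfield_of_chart _ _ M i (dom i)
  (fun y => v - v *m gloc g i y *m hloc S i y)) => //; first exact: dom_open.
move=> k; apply: Ck_onD => //; first exact: Ck_on_cst.
have : Ck_on k (phi i @` dom i) (fun y => (- v) *m gloc g i y *m hloc S i y).
  apply: Ck_on_mulmx => //; last exact: smooth_hloc.
  by apply: Ck_on_mulmx => //; [exact: Ck_on_cst|exact: smooth_gloc].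
by apply: (Ck_on_eq oV) => y _; rewrite !mulNmx.
Qed.

Lemma perp_fieldE i v x : dom i x ->
  let w := v *m tjac i (chart_at x) x in perp_field i v x = w - w *m g x *m sr_h S x.
Proof.
move=> dx w; rewrite /perp_field.
have -> : v = w *m tjac (chart_at x) i x by rewrite -mulmxA loc_cancel' // mulmx1.
by rewrite gloc_hloc // -mulmxBl -(mulmxA _ (tjac _ i x)) loc_cancel // mulmx1.
Qed.

Lemma perp_field_perp i v x : dom i x -> (perp_field i v x <= Dp x)%MS.
Proof.
move=> dx; rewrite perp_fieldE //; apply: (perp_of (S := S)).
rewrite !mulmxBl -!mulmxA (mulmxA (sr_h S x)) (hgh g_restricts) subrr //.
Qed.

(** The horizontal fields come from smoothness of the distribution. The vertical ones are
    projections of constant fields chosen to form a basis of [Dp] at [x0]. *)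
Lemma adapted_frame_exists (x0 : M) : exists (U : set M) (E : 'I_(m + q) -> vfield M),
  adapted_frame S g U E /\ U x0.
Proof.
have [rD /(_ x0)[U0 [X [oU0 U0x sX DX]]]] := sr_D_smooth S.
set i := chart_at x0; have dx0 : dom i x0 := dom_chart_at x0.
(* The rows of [z] are a basis of the orthogonal complement at [x0]. *)
pose z : 'M[R]_(q, m + q) := castmx (rank_perp x0, erefl) (row_base (Dp x0)).
have zD : (z :=: Dp x0)%MS.
  exact: eqmx_trans (eqmx_cast _ _) (eq_row_base _).
pose Z l := perp_field i (row l z *m tjac (chart_at x0) i x0).
pose E A := match fintype.split A with inl k => X k | inr l => Z l end.
have El k : E (lshift q k) = X k by rewrite /E (unsplitK (inl k)).
have Er k : E (rshift m k) = Z k by rewrite /E (unsplitK (inr k)).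
pose W := U0 `&` dom i.
have oW : open W by apply: openI => //; exact: dom_open.
have sE A : smooth_vfield W (E A).
  case: (fintype.split_ordP A) => k ->; rewrite ?El ?Er.
    by have [sXk _] := sX k; apply: smooth_vfield_sub sXk => y [].
  by apply: smooth_vfield_sub (@perp_field_smooth i _) => y [].
(* Independence may fail away from [x0]; invertibility of the frame matrix is an open condition. *)
pose U := [set y | W y /\ frame_mx E y \in unitmx].
have ED y k : W y -> (E (lshift q k) y <= D y)%MS.
  by move=> [U0y _]; rewrite El; have [_] := sX k; exact.
have EP y k : W y -> (E (rshift m k) y <= Dp y)%MS.
  by move=> [_ dy]; rewrite Er; exact: perp_field_perp.
have oU : open U.
  rewrite openE => y [[U0y dy] uy]; have Wy : W y by split.
  have cf : {for phi i y, continuous (floc E i)}.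
    apply/continuous_mxP => A k.
    have /differentiable_continuous /continuous_mxP /(_ 0 k) :=
      vloc_differentiable oW (sE A) Wy dy.
    have -> : (fun v => floc E i v A k) = (fun v => vloc i (E A) v 0 k).
      by apply/funext => v; rewrite floc.unlock mxE.
    by [].
  have uf : floc E i (phi i y) \in unitmx.
    have [J _] := mulmx1_unit (loc_cancel dy).
    by rewrite flocE // unitmx_mul uy J.
  have H1 := near_phi dy (near_unitmx cf uf).
  have H2 := open_nbhs_nbhs (conj oW Wy).
  apply: filterS2 H1 H2 => v uv [U0v dv]; split; first by split.
  by move: uv; rewrite flocE // unitmx_mul => /andP[].
have Wx0 : W x0 by split.
have sub A : smooth_vfield U (E A) by apply: smooth_vfield_sub (sE A) => y [].
exists U, E; split.
  split=> // [k|k|y [_ uy] //]; split=> // y [Wy _]; [exact: ED|exact: EP].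
split=> //.
(* At [x0] the projection fixes the rows of [z], so the frame matrix stacks a basis of [D x0] on one
   of [Dp x0]. *)
pose Xm := \matrix_(k < m) X k x0.
have Zl l : Z l x0 = row l z.
  rewrite /Z perp_fieldE // -mulmxA loc_cancel // mulmx1.
  have zl : (row l z <= Dp x0)%MS by rewrite -zD row_sub.
  by rewrite (perpP zl) subr0.
have frE : frame_mx E x0 = col_mx Xm z.
  apply/row_matrixP => A; rewrite rowK; case: (fintype.split_ordP A) => k ->.
    by rewrite El rowKu rowK.
  by rewrite Er rowKd Zl.
have Xfree : row_free Xm.
  rewrite -row_leq_rank -{1}(rD x0); apply: mxrankS; exact: DX.
have zfree : row_free z by rewrite /row_free zD rank_perp.
have XD : (Xm <= D x0)%MS.
  by apply/row_subP => k; rewrite rowK -El; exact: ED.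
rewrite /= frE -row_free_unit -kermx_eq0; apply/eqP/row_matrixP => l; rewrite row0.
have : row l (kermx (col_mx Xm z)) *m col_mx Xm z = 0 by rewrite -row_mul mulmx_ker row0.
move: (row l _) => b; rewrite -(hsubmxK b) mul_row_col.
move: (lsubmx b) (rsubmx b) => b1 b2 /eqP; rewrite addr_eq0 => /eqP bE.
have b1D : (b1 *m Xm <= D x0)%MS by exact: submx_trans (submxMl _ _) XD.
have b1P : (b1 *m Xm <= Dp x0)%MS.
  rewrite bE -mulNmx; apply: submx_trans (submxMl _ _) _; by rewrite zD.
have b10 := D_perp_eq0 g_riemannian b1D b1P.
have -> : b1 = 0 by apply: (row_free_inj Xfree); rewrite b10 mul0mx.
have -> : b2 = 0.
  apply: (row_free_inj zfree); rewrite mul0mx; apply/eqP; rewrite -oppr_eq0 -bE.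
  by apply/eqP.
by rewrite row_mx0.
Qed.

End Frames.

(** * The Hamiltonian vector field *)

Section Lipschitz.
Context {R : realType} {I : finType}.
Implicit Types (z c : I -> R) (f : (I -> R) -> R).

Definition in_box (c : I -> R) (r : R) (z : I -> R) := forall i, `|z i - c i| <= r.

(** Boundedness is part of the notion, which makes it stable under products; radius and constant may
    depend on the function. *)
Definition lip_near (c : I -> R) (f : (I -> R) -> R) := exists r L : R,
  [/\ 0 < r, 0 <= L & forall x y (e : R), 0 <= e -> in_box c r x -> in_box c r y ->
    (forall i, `|x i - y i| <= e) -> `|f x| <= L /\ `|f x - f y| <= L * e].

Lemma in_box_le c r r' z : r <= r' -> in_box c r z -> in_box c r' z.
Proof. by move=> rr zr i; exact: le_trans (zr i) rr. Qed.

Lemma lip_near_cst c (k : R) : lip_near c (fun=> k).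
Proof.
exists 1, `|k|; split=> // x y e e0 _ _ _; split=> //.
by rewrite subrr normr0 mulr_ge0.
Qed.

Lemma lip_near_proj c (i : I) : lip_near c (fun z => z i).
Proof.
exists 1, (`|c i| + 1); split=> // x y e e0 xc yc xy.
split.
  have -> : x i = c i + (x i - c i) by ring.
  by apply: le_trans (ler_normD _ _) _; rewrite lerD2l; exact: xc.
apply: le_trans (xy i) _; rewrite ler_peMl // lerDr //.
Qed.

Lemma lip_nearD c f1 f2 : lip_near c f1 -> lip_near c f2 ->
  lip_near c (fun z => f1 z + f2 z).
Proof.
move=> [r1 [L1 [r10 L10 H1]]] [r2 [L2 [r20 L20 H2]]].
exists (Num.min r1 r2), (L1 + L2); split; [by rewrite lt_min r10|exact: addr_ge0|].
move=> x y e e0 xc yc xy.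
have m1 : Num.min r1 r2 <= r1 by rewrite ge_min lexx.
have m2 : Num.min r1 r2 <= r2 by rewrite ge_min lexx orbT.
have [A1 B1] := H1 x y e e0 (in_box_le m1 xc) (in_box_le m1 yc) xy.
have [A2 B2] := H2 x y e e0 (in_box_le m2 xc) (in_box_le m2 yc) xy.
split; first exact: le_trans (ler_normD _ _) (lerD A1 A2).
have -> : f1 x + f2 x - (f1 y + f2 y) = (f1 x - f1 y) + (f2 x - f2 y) by ring.
by rewrite mulrDl; exact: le_trans (ler_normD _ _) (lerD B1 B2).
Qed.

Lemma lip_nearM c f1 f2 : lip_near c f1 -> lip_near c f2 ->
  lip_near c (fun z => f1 z * f2 z).
Proof.
move=> [r1 [L1 [r10 L10 H1]]] [r2 [L2 [r20 L20 H2]]].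
exists (Num.min r1 r2), (L1 * L2 + L1 * L2).
split; [by rewrite lt_min r10|by rewrite addr_ge0 // mulr_ge0|].
move=> x y e e0 xc yc xy.
have m1 : Num.min r1 r2 <= r1 by rewrite ge_min lexx.
have m2 : Num.min r1 r2 <= r2 by rewrite ge_min lexx orbT.
have yy i : `|y i - y i| <= e by rewrite subrr normr0.
have [A1 B1] := H1 x y e e0 (in_box_le m1 xc) (in_box_le m1 yc) xy.
have [A2 B2] := H2 x y e e0 (in_box_le m2 xc) (in_box_le m2 yc) xy.
have [A1' _] := H1 y y e e0 (in_box_le m1 yc) (in_box_le m1 yc) yy.
split.
  rewrite normrM; apply: le_trans (ler_pM _ _ A1 A2) _ => //.
  by rewrite lerDl mulr_ge0.
have -> : f1 x * f2 x - f1 y * f2 y = (f1 x - f1 y) * f2 x + f1 y * (f2 x - f2 y) by ring.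
apply: le_trans (ler_normD _ _) _; rewrite !normrM mulrDl lerD //.
  by rewrite mulrAC; apply: ler_pM.
by rewrite -mulrA; apply: ler_pM.
Qed.

Lemma lip_near_sum (J : Type) (s : seq J) c (f : J -> (I -> R) -> R) :
  (forall j, lip_near c (f j)) -> lip_near c (fun z => \sum_(j <- s) f j z).
Proof.
move=> H; elim: s => [|j s IH].
  have -> : (fun z => \sum_(j <- [::]) f j z) = (fun=> 0).
    by apply/funext => z; rewrite big_nil.
  exact: lip_near_cst.
have -> : (fun z => \sum_(k <- j :: s) f k z) = (fun z => f j z + \sum_(k <- s) f k z).
  by apply/funext => z; rewrite big_cons.
exact: lip_nearD.
Qed.

Lemma lip_near_C1 n (V : set 'rV[R]_n) (k : 'rV[R]_n -> R) (inj : 'I_n -> I) c :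
  open V -> Ck_on 1 V k -> V (\row_a c (inj a)) ->
  lip_near c (fun z => k (\row_a z (inj a))).
Proof.
move=> oV Ck Vc; have [r [L [r0 L0 H]]] := C1_locally_lipschitz oV Vc Ck.
(* [in_box] is a closed condition, while [C1_locally_lipschitz] speaks of an open ball. *)
exists (r / 2), L; split=> // [|x y e e0 xc yc xy]; first by rewrite divr_gt0.
have r20 : r / 2 < r by lra.
have box z : in_box c (r / 2) z -> `|\row_a z (inj a) - \row_a c (inj a)| < r.
  move=> zc; apply: le_lt_trans _ r20; apply: mx_norm_le; first lra.
  by move=> i j; rewrite !mxE; exact: zc.
have [A B] := H _ _ (box _ xc) (box _ yc); split=> //; apply: le_trans B _.
rewrite ler_wpM2l //; apply: mx_norm_le => // i j; rewrite !mxE; exact: xy.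
Qed.

Lemma box_lipschitz_of (F : (I -> R) -> I -> R) c :
  (forall i, lip_near c (fun z => F z i)) ->
  exists r L : R, [/\ 0 < r, 0 <= L & box_lipschitz F c r L].
Proof.
move=> H.
have [r Hr] := choice H; have [L HL] := choice Hr.
pose r0 := \big[Num.min/1]_i r i.
exists r0, (\sum_i L i); split.
- by apply: lt_bigmin => [|i _]; [exact: ltr01|have [] := HL i].
- by apply: sumr_ge0 => i _; have [] := HL i.
- move=> x y e xc yc xy i.
  have e0 : 0 <= e := le_trans (normr_ge0 _) (xy i).
  have ri : r0 <= r i by exact: bigmin_le.
  have [_ _ Hi] := HL i.
  have [_ B] := Hi x y e e0 (in_box_le ri xc) (in_box_le ri yc) xy.
  apply: le_trans B _; rewrite ler_wpM2r //.
  rewrite (bigD1 i) //= lerDl; apply: sumr_ge0 => j _; by have [] := HL j.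
Qed.

End Lipschitz.

Section HamiltonField.
Context {R : realType} {m q : nat} {M : manifold R (m + q)}.
Variables (S : subRiemannian M) (i : chart M).
Local Notation N := (m + q)%N.
Local Notation state := (('I_N + 'I_N)%type -> R).

Definition st_y (z : state) : 'rV[R]_N := \row_A z (inl A).
Definition st_xi (z : state) : 'cV[R]_N := \col_A z (inr A).

(** Hamilton's equations as a first-order system on states indexed by a finite type. Writing the
    field with [hloc] makes every component a polynomial in [xi] with coefficients smooth in [y]. *)
Definition ham_field (z : state) (k : 'I_N + 'I_N) : R :=
  match k with
  | inl A => ((st_xi z)^T *m hloc S i (st_y z)) 0 A
  | inr A => - (2^-1 * ((st_xi z)^T *m 'D_(delta_mx 0 A) (hloc S i) (st_y z) *m st_xi z) 0 0)
  end.

Lemma ham_field_lipschitz (c : state) : (phi i @` dom i) (st_y c) ->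
  exists r L : R, [/\ 0 < r, 0 <= L & box_lipschitz ham_field c r L].
Proof.
move=> Vc; apply: box_lipschitz_of => k.
have oV : open (phi i @` dom i) := @phi_open _ _ M i.
(* Order 2, because the first derivatives of [hloc] enter the field and must themselves be C^1. *)
have [_ Ch] := @smooth_hloc _ _ _ M S i 2%N.
have C1 := Ck_onW (@smooth_hloc _ _ _ M S i 2%N).
have Lxi A : lip_near c (fun z : state => z (inr A)) by exact: lip_near_proj.
case: k => A.
  have -> : (fun z => ham_field z (inl A)) =
      (fun z : state => \sum_B z (inr B) * hloc S i (st_y z) B A).
    by apply/funext => z; rewrite /= mxE; apply: eq_bigr => B _; rewrite !mxE.
  apply: lip_near_sum => B; apply: lip_nearM => //.
  apply: (lip_near_C1 (k := fun y => hloc S i y B A) oV _ Vc).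
  by have /(Ck_on_mxP _ _ oV) := C1; exact.
have [_ CD] := Ch A.
have -> : (fun z => ham_field z (inr A)) = (fun z : state => (- 2^-1) * \sum_B
    (\sum_C z (inr C) * 'D_(delta_mx 0 A) (hloc S i) (st_y z) C B) * z (inr B)).
  apply/funext => z; rewrite /= mulNr mxE; congr (- (_ * _)).
  apply: eq_bigr => B _; congr (_ * _); last by rewrite mxE.
  by rewrite mxE; apply: eq_bigr => C _; congr (_ * _); rewrite !mxE.
apply: lip_nearM; first exact: lip_near_cst.
apply: lip_near_sum => B; apply: lip_nearM => //.
apply: lip_near_sum => C; apply: lip_nearM => //.
apply: (lip_near_C1 (k := fun y => 'D_(delta_mx 0 A) (hloc S i) y C B) oV _ Vc).
exact: ((Ck_on_mxP 1 _ oV).1 CD C B).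
Qed.

End HamiltonField.

(** * Solutions *)

Section Flow.
Context {R : realType} {m q : nat} {M : manifold R (m + q)}.
Variable S : subRiemannian M.
Local Notation N := (m + q)%N.

(** [hamilton_at] with the fibre derivative of the Hamiltonian already evaluated, as the image of
    [p] under [h]. *)
Definition ham_flow (i : chart M) (c : R -> M) (p : R -> 'cV[R]_N) (t : R) : Prop :=
  is_derive t 1 (fun s => phi i (c s)) (tcomp i (c t) (sharp S (c t) (p t))) /\
  is_derive t 1 (fun s => ccomp i (c s) (p s))
    (- \col_A 'D_(delta_mx 0 A) (fun z => ham_loc S i z (ccomp i (c t) (p t))) (phi i (c t))).

Lemma tcomp_sharp i x p : dom i x ->
  tcomp i x (sharp S x p) = (ccomp i x p)^T *m hloc S i (phi i x).
Proof.
move=> dx; rewrite /tcomp /ccomp !jac_tjac hlocE // /sharp trmx_mul !mulmxA.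
by rewrite -(mulmxA _ (tjac i _ x)^T) -trmx_mul loc_cancel // trmx1 mulmx1.
Qed.

Lemma ham_loc_fiber_derive i x xi v : dom i x ->
  'D_v (ham_loc S i (phi i x)) xi = (xi^T *m hloc S i (phi i x) *m v) 0 0.
Proof.
move=> dx; have hT := hloc_sym dx (S := S).
have -> : ham_loc S i (phi i x) =
    (fun z => 2^-1 * (z^T *m hloc S i (phi i x) *m z) 0 0).
  by apply/funext => z; rewrite ham_locE.
move: (hloc S i (phi i x)) hT => h hT.
have I0 : is_derive xi v id v := is_derive_id xi v.
have H1 := is_derive_mulmx (is_derive_mulmx (is_derive_trmx I0) (is_derive_cst h xi v)) I0.
rewrite mulmx0 addr0 in H1.
have /is_derive_mxP /(_ 0 0) H2 := H1.
have H3 := is_deriveZ (2^-1) H2; have [_ E] := H3.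
apply: (etrans E); rewrite -[LHS]/(2^-1 * _) mxE.
have T11 (A : 'M[R]_1) : A^T 0 0 = A 0 0 by rewrite mxE.
have -> : (v^T *m h *m xi) 0 0 = (xi^T *m h *m v) 0 0.
  by rewrite -T11 !trmx_mul trmxK hT mulmxA.
have half (r : R) : 2^-1 * (r + r) = r by lra.
exact: half.
Qed.

Lemma hamilton_at_flow i c p t : dom i (c t) -> ham_flow i c p t -> hamilton_at S c p t i.
Proof.
move=> dx [H1 H2]; split=> //.
have -> : \row_a 'D_(delta_mx a 0) (ham_loc S i (phi i (c t))) (ccomp i (c t) (p t)) =
    tcomp i (c t) (sharp S (c t) (p t)).
  apply/rowP => a; rewrite mxE ham_loc_fiber_derive // tcomp_sharp //.
  by rewrite -colE mxE.
exact: H1.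
Qed.

Lemma velocity_chart i j (c : R -> M) t w : {for t, continuous c} ->
  dom i (c t) -> dom j (c t) ->
  is_derive t 1 (fun s => phi i (c s)) w ->
  is_derive t 1 (fun s => phi j (c s)) (w *m tjac i j (c t)).
Proof.
move=> cc di dj H; have H1 := is_derive_curve H (transition_differentiable di dj).
rewrite (jacE w di dj); apply: near_eq_is_derive H1.
have Hd : \forall s \near t, dom i (c s) := cc _ (near_dom di).
apply: filterS Hd => s ds /=; by rewrite phiK.
Qed.

Lemma ham_flow_state i c p t : dom i (c t) ->
  let st s (k : 'I_N + 'I_N) :=
    match k with inl A => phi i (c s) 0 A | inr A => ccomp i (c s) (p s) A 0 end in
  ham_flow i c p t <-> forall k, is_derive t 1 (st^~ k) (ham_field S i (st t) k).
Proof.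
move=> dx st.
have yE s : st_y (st s) = phi i (c s) by apply/rowP => A; rewrite mxE.
have xiE s : st_xi (st s) = ccomp i (c s) (p s) by apply/colP => A; rewrite mxE.
have F1 A : ham_field S i (st t) (inl A) = tcomp i (c t) (sharp S (c t) (p t)) 0 A.
  by rewrite /ham_field yE xiE tcomp_sharp.
have F2 A : ham_field S i (st t) (inr A) = (- \col_A 'D_(delta_mx 0 A)
    (fun z => ham_loc S i z (ccomp i (c t) (p t))) (phi i (c t))) A 0.
  by rewrite /ham_field yE xiE [RHS]mxE [X in _ = - X]mxE ham_loc_derive.
split=> [[/is_derive_mxP H1 /is_derive_mxP H2] [A|A]|H].
- by rewrite F1; exact: H1.
- by rewrite F2; exact: H2.
split; apply/is_derive_mxP => k A.
  by rewrite ord1 -F1; exact: (H (inl A)).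
by rewrite (ord1 A) -F2; exact: (H (inr k)).
Qed.

End Flow.

Section Solutions.
Context {R : realType} {m q : nat} {M : manifold R (m + q)}.
Context {S : subRiemannian M} {g : M -> 'M[R]_(m + q)} {nb : connection M}.
Hypothesis g_riemannian : riemannian g.
Hypothesis g_restricts : restricts_to g S.
Hypothesis nb_distinguished : distinguished S g nb.
Local Notation N := (m + q)%N.

(** The equations hold in every adapted frame; a single frame around [c t] already gives Hamilton's
    equations in any chart there. *)
Lemma solution_flow J c u nu t i : open J -> solution S g nb J c u nu -> J t ->
  dom i (c t) -> ham_flow S i c (fun s => momentum g (c s) (u s) (nu s)) t.
Proof.
move=> oJ sol Jt dx; have [[cc vel] uD nuD eqs] := sol _ Jt.
have [U [E [Ead Ux]]] := adapted_frame_exists g_riemannian g_restricts (c t).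
have un : \forall s \near t, (u s <= sr_D S (c s))%MS /\ sr_D S (c s) *m nu s = 0.
  by apply: (near_open oJ Jt) => s Js; have [_ ? ? _] := sol _ Js; split.
have veli : is_derive t 1 (fun s => phi i (c s)) (tcomp i (c t) (u t)).
  have := velocity_chart cc (dom_chart_at (c t)) dx vel.
  by rewrite /tcomp jac_tjac.
split.
  by rewrite (sharp_momentum g_riemannian g_restricts uD nuD).
have ext := eqs _ _ Ead Ux.
have cov := (extremal_eqs_iff g_riemannian g_restricts nb_distinguished Ead cc dx Ux un).1 ext.
exact: (momentum_equation g_riemannian g_restricts nb_distinguished Ead cc dx Ux un veli).1 cov.
Qed.

(** The pair is chosen so that its momentum is [p] again; the equivalences along the curve can then
    be read backwards in each adapted frame. *)
Lemma flow_solution J c p i : open J ->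
  (forall t, J t -> [/\ {for t, continuous c}, dom i (c t) & ham_flow S i c p t]) ->
  solution S g nb J c (fun s => sharp S (c s) (p s))
    (fun s => p s - g (c s) *m (sharp S (c s) (p s))^T).
Proof.
move=> oJ H t Jt; have [cc dx [vel mom]] := H _ Jt.
have uD s : (sharp S (c s) (p s) <= sr_D S (c s))%MS := sharp_in_D _ _.
have nuD s : sr_D S (c s) *m (p s - g (c s) *m (sharp S (c s) (p s))^T) = 0.
  exact: (momentum_sharp g_restricts).
have pE s : momentum g (c s) (sharp S (c s) (p s))
    (p s - g (c s) *m (sharp S (c s) (p s))^T) = p s.
  by rewrite /momentum addrC subrK.
split=> //.
  split=> //; have := velocity_chart cc dx (dom_chart_at (c t)) vel.
  by rewrite /tcomp jac_tjac -mulmxA loc_cancel // mulmx1.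
move=> U E Ead Ux.
have un : \forall s \near t, (sharp S (c s) (p s) <= sr_D S (c s))%MS /\
    sr_D S (c s) *m (p s - g (c s) *m (sharp S (c s) (p s))^T) = 0.
  by apply: (near_open oJ Jt) => s _; split.
apply/(extremal_eqs_iff g_riemannian g_restricts nb_distinguished Ead cc dx Ux un).
apply/(momentum_equation g_riemannian g_restricts nb_distinguished Ead cc dx Ux un vel).
have -> : (fun s => ccomp i (c s) (momentum g (c s) (sharp S (c s) (p s))
    (p s - g (c s) *m (sharp S (c s) (p s))^T))) = (fun s => ccomp i (c s) (p s)).
  by apply/funext => s; rewrite pE.
by rewrite /ham_grad pE.
Qed.

Lemma solution_exists x u0 nu0 : (u0 <= sr_D S x)%MS -> sr_D S x *m nu0 = 0 ->
  exists (J : set R) (c : R -> M) (u : R -> 'rV[R]_N) (nu : R -> 'cV[R]_N),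
    [/\ open_interval0 J, solution S g nb J c u nu, c 0 = x, u 0 = u0 & nu 0 = nu0].
Proof.
move=> u0D nu0D; set i := chart_at x; have dx : dom i x := dom_chart_at x.
pose p0 := momentum g x u0 nu0; pose xi0 := ccomp i x p0.
pose st0 (k : 'I_N + 'I_N) := match k with inl A => phi i x 0 A | inr A => xi0 A 0 end.
have y0E : st_y st0 = phi i x by apply/rowP => A; rewrite mxE.
have xi0E : st_xi st0 = xi0 by apply/colP => A; rewrite mxE.
have Vx : (phi i @` dom i) (st_y st0) by rewrite y0E; exists x.
have [r [L [r0 L0 FL]]] := ham_field_lipschitz S Vx.
have [d [w [d0 w0 Hw]]] := ode_exists r0 L0 FL.
have zeroJ : `|0 : R| < d by rewrite normr0.
pose st s k := w k s.
have st0E : st 0 = st0 by apply/funext => k; exact: w0.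
pose y s := st_y (st s).
have dy t : `|t| < d -> {for t, continuous y}.
  move=> td; have [_ D] := Hw _ td; apply/continuous_mxP => l A.
  have -> : (fun s => y s l A) = w (inl A) by apply/funext => s; rewrite mxE.
  by have [dw _] := D (inl A); exact/differentiable_continuous/derivable1_diffP.
have oV : open (phi i @` dom i) := @phi_open _ _ M i.
(* The time interval is shrunk so that [y] stays in the image of the chart, where [psi i] is
   meaningful. *)
have [d' [d'0 d'd yV]] : exists d', [/\ 0 < d', d' <= d &
    forall t, `|t| < d' -> (phi i @` dom i) (y t)].
  have := dy _ zeroJ (phi i @` dom i); rewrite /y st0E.
  move=> /(_ (open_nbhs_nbhs (conj oV Vx))) /nbhs_ballP[d1 /= d10 d1P].
  exists (Num.min d d1); split; [by rewrite lt_min d0|by rewrite ge_min lexx|].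
  move=> t; rewrite lt_min => /andP[_ t1]; apply: d1P.
  by rewrite -ball_normE /= sub0r normrN.
pose J := [set t : R | `|t| < d'].
have oJ : open J.
  apply: (@open_comp _ _ (@Num.norm _ R) [set s | s < d']); last exact: open_lt.
  by move=> s _; exact: norm_continuous.
pose c s := psi i (y s).
(* On [J] this is the covector whose components in the chart [i] are [st_xi (st s)]. *)
pose p s := tjac (chart_at (c s)) i (c s) *m st_xi (st s).
have cJ t : J t -> dom i (c t) /\ phi i (c t) = y t by move=> /yV /image_domP.
have xiE t : J t -> ccomp i (c t) (p t) = st_xi (st t).
  by move=> /cJ[dc _]; rewrite /ccomp jac_tjac mulmxA loc_cancel' // mul1mx.
have c0 : c 0 = x by rewrite /c /y st0E y0E phiK.
have p0E : p 0 = p0.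
  rewrite /p st0E xi0E /xi0 c0 /ccomp jac_tjac mulmxA loc_cancel // mul1mx //.
have J0 : J 0 by rewrite /J /= normr0.
exists J, c, (fun s => sharp S (c s) (p s)), (fun s => p s - g (c s) *m (sharp S (c s) (p s))^T).
have u0E : sharp S x p0 = u0 := sharp_momentum g_riemannian g_restricts u0D nu0D.
split=> //.
- split=> //; move=> a b Ja Jb z /andP[az zb]; rewrite /J /= in Ja Jb *.
  by move: Ja Jb; rewrite !ltr_norml => /andP[? ?] /andP[? ?]; apply/andP; split; lra.
- apply: (flow_solution (i := i)) => // t Jt; have [dc cy] := cJ _ Jt.
  have td : `|t| < d := lt_le_trans Jt d'd.
  have cc : {for t, continuous c}.
    apply: (continuous_comp (dy _ td)); rewrite -cy; exact: psi_continuous.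
  split=> //; apply/ham_flow_state => // k.
  have [_ D] := Hw _ td.
  have stE s : J s -> forall k, (match k with inl A => phi i (c s) 0 A
      | inr A => ccomp i (c s) (p s) A 0 end) = w k s.
    by move=> Js [A|A]; rewrite ?xiE // ?(cJ _ Js).2 mxE.
  have -> : (fun k => match k with inl A => phi i (c t) 0 A
      | inr A => ccomp i (c t) (p t) A 0 end) = w^~ t.
    by apply/funext => k'; exact: stE.
  apply: near_eq_is_derive (D k).
  by apply: (near_open oJ Jt) => s Js; rewrite stE.
- by rewrite c0 p0E.
- by rewrite c0 p0E u0E /p0 /momentum addrC addKr.
Qed.

(** Both curves are read in the chart around their common point, where they solve the same Lipschitz
    system; equal chart components give back equal points and covectors. *)
Lemma solution_locally_unique J c c' u u' nu nu' t0 : open J ->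
  solution S g nb J c u nu -> solution S g nb J c' u' nu' -> J t0 ->
  c t0 = c' t0 ->
  momentum g (c t0) (u t0) (nu t0) = momentum g (c' t0) (u' t0) (nu' t0) ->
  \forall s \near t0, c s = c' s /\
    momentum g (c s) (u s) (nu s) = momentum g (c' s) (u' s) (nu' s).
Proof.
move=> oJ sol sol' Jt cE.
pose p s := momentum g (c s) (u s) (nu s).
pose p' s := momentum g (c' s) (u' s) (nu' s).
rewrite -/(p t0) -/(p' t0) => pE.
set i := chart_at (c t0); have dx : dom i (c t0) := dom_chart_at (c t0).
have dx' : dom i (c' t0) by rewrite -cE.
pose st (c0 : R -> M) (p0 : R -> 'cV[R]_N) s (k : 'I_N + 'I_N) :=
  match k with inl A => phi i (c0 s) 0 A | inr A => ccomp i (c0 s) (p0 s) A 0 end.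
have y0E : st_y (st c p t0) = phi i (c t0) by apply/rowP => A; rewrite mxE.
have Vx : (phi i @` dom i) (st_y (st c p t0)) by rewrite y0E; exists (c t0).
have [r [L [r0 L0 FL]]] := ham_field_lipschitz S Vx.
have nearP c0 u1 nu1 : solution S g nb J c0 u1 nu1 -> dom i (c0 t0) ->
    \forall s \near t0, dom i (c0 s) /\
      forall k, is_derive s 1 (fun s => st c0 (fun s => momentum g (c0 s) (u1 s) (nu1 s)) s k)
        (ham_field S i (st c0 (fun s => momentum g (c0 s) (u1 s) (nu1 s)) s) k).
  move=> so d0; have [[cc _] _ _ _] := so _ Jt.
  have H1 : \forall s \near t0, dom i (c0 s) := cc _ (near_dom d0).
  have H2 : \forall s \near t0, J s := open_nbhs_nbhs (conj oJ Jt).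
  apply: filterS2 H1 H2 => s ds Js; split=> // k.
  have flow := solution_flow oJ so Js ds.
  exact: ((ham_flow_state S _ ds).1 flow k).
have H := nearP _ _ _ sol dx; have H' := nearP _ _ _ sol' dx'.
have HD : \forall s \near t0, forall k, is_derive s (1 : R) (fun s => st c p s k)
    (ham_field S i (st c p s) k) by apply: filterS H => s [].
have HD' : \forall s \near t0, forall k, is_derive s (1 : R) (fun s => st c' p' s k)
    (ham_field S i (st c' p' s) k) by apply: filterS H' => s [].
have st0' k : st c' p' t0 k = st c p t0 k by rewrite /st -cE pE.
have EQ := @ode_unique R _ (ham_field S i) (st c p t0) r L t0
  (fun k s => st c p s k) (fun k s => st c' p' s k) r0 L0 FL (fun k => erefl) st0' HD HD'.
apply: filterS3 EQ H H' => s E [ds _] [ds' _].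
have phiE : phi i (c s) = phi i (c' s) by apply/rowP => A; exact: (E (inl A)).
have csE : c s = c' s by rewrite -(phiK ds) phiE phiK.
split=> //; suff : p s = p' s by [].
have : ccomp i (c s) (p s) = ccomp i (c' s) (p' s).
  by apply/colP => A; exact: (E (inr A)).
rewrite /ccomp !jac_tjac -csE => /(congr1 (mulmx (tjac (chart_at (c s)) i (c s)))).
by rewrite !mulmxA loc_cancel // !mul1mx.
Qed.

Lemma eq_on_closure (T U : topologicalType) (f f' : T -> U) (B : set T) (t : T) :
  hausdorff_space U -> {for t, continuous f} -> {for t, continuous f'} ->
  closure B t -> (forall s, B s -> f s = f' s) -> f t = f' t.
Proof.
move=> hU cf cf' cB fE; apply: hU => A A' HA HA'.
have H : \forall s \near t, A (f s) := cf _ HA.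
have H' : \forall s \near t, A' (f' s) := cf' _ HA'.
have [s [Bs [As A's]]] := cB _ (filterI H H').
by exists (f s); split=> //; rewrite fE.
Qed.

Lemma solution_unique J c c' u u' nu nu' : open_interval0 J ->
  solution S g nb J c u nu -> solution S g nb J c' u' nu' ->
  c 0 = c' 0 -> u 0 = u' 0 -> nu 0 = nu' 0 ->
  forall t, J t -> [/\ c t = c' t, u t = u' t & nu t = nu' t].
Proof.
move=> [oJ iJ J0] sol sol' c0 u00 nu00.
pose p s := momentum g (c s) (u s) (nu s).
pose p' s := momentum g (c' s) (u' s) (nu' s).
(* The agreement set is nonempty, open by local uniqueness and closed in [J] by continuity; no
   single chart has to contain the curves. *)
pose B := [set t | [/\ J t, c t = c' t & p t = p' t]].
have BJ : B = J.
  have cJ : connected J by apply/connected_intervalP.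
  apply: cJ.
  - by exists 0; split=> //; rewrite /p /p' c0 u00 nu00.
  - exists B; last by apply/seteqP; split=> [t [? ? ?]|t []].
    rewrite openE => t [Jt ct pt].
    have H1 := solution_locally_unique oJ sol sol' Jt ct pt.
    have H2 := open_nbhs_nbhs (conj oJ Jt).
    by apply: filterS2 H1 H2 => s [? ?] ?; split.
  - exists (closure B); first exact: closed_closure.
    apply/seteqP; split=> [t Bt|t [Jt cB]].
      by split; [case: Bt|exact: subset_closure].
    have [[cc _] _ _ _] := sol _ Jt; have [[cc' _] _ _ _] := sol' _ Jt.
    have ct : c t = c' t.
      by apply: (eq_on_closure (@manifold_hausdorff _ _ M) cc cc' cB) => s [].
    (* The stored [p] need not be continuous, its preferred chart varying with the point; the limit
       is taken for its components in one chart around [c t]. *)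
    split=> //; set i := chart_at (c t); have dx : dom i (c t) := dom_chart_at (c t).
    have dx' : dom i (c' t) by rewrite -ct.
    have [_ [dxi _]] := solution_flow oJ sol Jt dx.
    have [_ [dxi' _]] := solution_flow oJ sol' Jt dx'.
    have cxi := derivable_continuous dxi; have cxi' := derivable_continuous dxi'.
    have : ccomp i (c t) (p t) = ccomp i (c' t) (p' t).
      apply: (eq_on_closure (@norm_hausdorff _ _) cxi cxi' cB) => s [_ cs ps].
      by rewrite -/(p s) -/(p' s) cs ps.
    rewrite /ccomp !jac_tjac -ct => /(congr1 (mulmx (tjac (chart_at (c t)) i (c t)))).
    by rewrite !mulmxA loc_cancel // !mul1mx.
move=> t Jt; have [_ ct pt] : B t by rewrite BJ.
have [_ uD nuD _] := sol _ Jt; have [_ uD' nuD' _] := sol' _ Jt.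
(* [p] determines [u] as its image under [h], and then [nu] as the remainder. *)
have uE : u t = u' t.
  rewrite -(sharp_momentum g_riemannian g_restricts uD nuD).
  rewrite -(sharp_momentum g_riemannian g_restricts uD' nuD').
  by rewrite -/(p t) -/(p' t) pt ct.
split=> //; move: pt; rewrite /p /p' /momentum ct uE.
by move/addrI.
Qed.

End Solutions.

Theorem theorem8 (R : realType) (m q : nat) (M : manifold R (m + q))
    (S : subRiemannian M) (g : M -> 'M[R]_(m + q))
    (g_riemannian : riemannian g) (g_restricts : restricts_to g S)
    (nb : connection M) (nb_distinguished : distinguished S g nb)
    (x : M) (u0 : 'rV[R]_(m + q)) (nu0 : 'cV[R]_(m + q))
    (u0_horizontal : (u0 <= sr_D S x)%MS)
    (nu0_annihilates : sr_D S x *m nu0 = 0) :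
  (exists (J : set R) (c : R -> M) (u : R -> 'rV[R]_(m + q))
      (nu : R -> 'cV[R]_(m + q)),
     [/\ open_interval0 J, solution S g nb J c u nu,
         c 0 = x, u 0 = u0 & nu 0 = nu0]) /\
  (forall (J : set R) (c c' : R -> M) (u u' : R -> 'rV[R]_(m + q))
      (nu nu' : R -> 'cV[R]_(m + q)),
     open_interval0 J ->
     solution S g nb J c u nu ->
     [/\ c 0 = x, u 0 = u0 & nu 0 = nu0] ->
     solution S g nb J c' u' nu' ->
     [/\ c' 0 = x, u' 0 = u0 & nu' 0 = nu0] ->
     forall t, J t -> [/\ c t = c' t, u t = u' t & nu t = nu' t]) /\
  (forall (J : set R) (c : R -> M) (u : R -> 'rV[R]_(m + q))
      (nu : R -> 'cV[R]_(m + q)),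
     open_interval0 J ->
     solution S g nb J c u nu ->
     [/\ c 0 = x, u 0 = u0 & nu 0 = nu0] ->
     [/\ normal_extremal S J c, c 0 = x &
         forall t, J t -> velocity c t (u t)]).
Proof.
split; first exact: solution_exists.
split=> [J c c' u u' nu nu' oJ sol [c0 u00 nu00] sol' [c0' u00' nu00']|].
  apply: (solution_unique g_riemannian g_restricts nb_distinguished oJ sol sol').
  - by rewrite c0 c0'.
  - by rewrite u00 u00'.
  - by rewrite nu00 nu00'.
move=> J c u nu [oJ _ _] sol [c0 _ _]; split=> //.
  (* The momentum is the lift of [c] to the cotangent bundle. *)
  exists (fun s => momentum g (c s) (u s) (nu s)) => t Jt.
  have [[cc _] _ _ _] := sol _ Jt; split=> // i dx.
  apply: hamilton_at_flow => //.
  exact: (solution_flow g_riemannian g_restricts nb_distinguished oJ sol Jt dx).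
by move=> t Jt; have [] := sol _ Jt.
Qed.
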